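(* Let $q$ be a prime power, $v\in\mathbb{F}_q[t]$ monic irreducible of degree $d$, $K\supset\mathbb{F}_q$ a field with $K\cap\overline{\mathbb{F}_q}=\mathbb{F}_q$, and let $M$ be a $K^{\mathrm{sep}}(t)_v$-trivial $\varphi$-module over $K(t)_v$ of dimension $r$. Let $\Gamma\subset\mathrm{GL}_{r/\mathbb{F}_q(t)_v}$ be the group scheme attached to $M$ and let $\pi_M:\Gamma\to\Gamma_M$ be the natural homomorphism to the Tannakian Galois group of $M$, as described in the context. Then $\pi_M$ is an isomorphism of affine group schemes over $\mathbb{F}_q(t)_v$.
   Context: For a field $k\supset\mathbb{F}_q$ put $k[t]_v:=\varprojlim k[t]/v^n$ and $k(t)_v:=\mathbb{F}_q(t)\otimes_{\mathbb{F}_q[t]}k[t]_v$; $\sigma$ is the endomorphism $\sum a_it^i\mapsto\sum a_i^qt^i$ extended to $k(t)_v$. Put $F=\mathbb{F}_q(t)_v$, $E=K(t)_v$ (a field), $L=K^{\mathrm{sep}}(t)_v=\prod_{l\in\mathbb{Z}/d}K^{\mathrm{sep}}((t-\lambda_l))$ where $v=\prod_l(t-\lambda_l)$, $\lambda_l^q=\lambda_{l+1}$; write $L_l=K^{\mathrm{sep}}((t-\lambda_l))$. A $\varphi$-module over $E$ is an $E$-vector space $M$ with an additive $\varphi$ satisfying $\varphi(ax)=\sigma(a)\varphi(x)$; $V(M):=(L\otimes_EM)^{\varphi}$ with $\varphi$ acting as $\sigma\otimes\varphi$; $M$ is $L$-trivial if $\dim_E M<\infty$ and the natural map $L\otimes_F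 V(M)\to L\otimes_E M$ is bijective. $L$-trivial $\varphi$-modules form a neutral Tannakian category over $F$ with fiber functor $V$ (tensor product $\otimes_E$ with $\varphi\otimes\varphi$); $\mathcal T_M$ is the Tannakian subcategory generated by $M$, and $\Gamma_M$ is the Tannakian Galois group of $(\mathcal T_M,V|_{\mathcal T_M})$, a closed subgroup scheme of $\mathrm{GL}(V(M))$. Choose an $E$-basis $\mathbf m$ of $M$ (column vector), $\Phi\in\mathrm{GL}_r(E)$ with $\varphi\mathbf m=\Phi\mathbf m$, and $\Psi\in\mathrm{GL}_r(L)$ with $\sigma\Psi=\Phi\Psi$. With $X=(X_{ij})$ indeterminates and $\Delta=\det X$, let $\Sigma:=E[\Psi,\det\Psi^{-1}]\subset L$ and $\Gamma:=\mathrm{Spec}\,F[X,\Delta^{-1}]/\mathfrak q$, where $\mathfrak q$ is the kernel of $F[X,\Delta^{-1}]\to L\otimes_EL$, $X\mapsto(\Psi_{ij}\otimes1)^{-1}(1\otimes\Psi_{ij})$. For every $N\in\mathcal T_M$ and $F$-algebra $R$, the natural map $(R\otimes_F\Sigma)\otimes_FV(N)\to(R\otimes_F\Sigma)\otimes_EN$ is an isomorphism, and $\gamma\in\Gamma(R)$ acts on $R\otimes_FV(N)$ by restricting $h(\Psi)\otimes x\mapsto h(\Psi\gamma)\otimes x$; this defines representations $\Gamma\to\mathrm{GL}(V(N))$ functorial in $N$ and a tensor functor $\mathcal T_M\to\mathrm{Rep}(\Gamma,F)$ whose composite with the forgetful functor is $V$. $\pi_M$ is the unique homomorphism $\Gamma\to\Gamma_M$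 inducing this functor via Tannakian duality. *)

(* Defs.v *)
From HB Require Import structures.
From mathcomp Require Import all_boot all_order all_algebra all_field.
From mathcomp Require Import boolp.
From mathcomp.multinomials Require Import mpoly.

Set Implicit Arguments.
Unset Strict Implicit.
Unset Printing Implicit Defensive.

Import GRing.Theory.
Local Open Scope ring_scope.
Local Open Scope quotient_scope.

Section TensorDef.
Context (R : comPzRingType) (A B : lmodType R).

(* A formal sum of symbols [a (x) b] is a list of pairs; [tens_eq] is the
   congruence generated by the bilinearity relations. *)
Inductive tens_eq : seq (A * B) -> seq (A * B) -> Prop :=
| te_refl s : tens_eq s s
| te_sym s t : tens_eq s t -> tens_eq t s
| te_trans s t u : tens_eq s t -> tens_eq t u -> tens_eq s u
| te_cat s s' t t' : tens_eq s s' -> tens_eq t t' -> tens_eq (s ++ t) (s' ++ t')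
| te_catC s t : tens_eq (s ++ t) (t ++ s)
| te_0 : tens_eq [:: (0, 0)] [::]
| te_addl a a' b : tens_eq [:: (a + a', b)] [:: (a, b); (a', b)]
| te_addr a b b' : tens_eq [:: (a, b + b')] [:: (a, b); (a, b')]
| te_scale r a b : tens_eq [:: (r *: a, b)] [:: (a, r *: b)].

Definition tens_eqb : rel (seq (A * B)) := fun s t => `[< tens_eq s t >].

Lemma tens_eqb_equiv : equiv_class_of tens_eqb.
Proof.
split=> [s | s t | t s u].
- by apply/asboolP; apply: te_refl.
- by apply/asboolP/asboolP; apply: te_sym.
- by move=> /asboolP st /asboolP tu; apply/asboolP; apply: te_trans tu.
Qed.

Canonical tens_equiv := EquivRelPack tens_eqb_equiv.

Definition tensor : Type := {eq_quot tens_equiv}.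
HB.instance Definition _ := Choice.on tensor.
HB.instance Definition _ := EqQuotient.on tensor.

Definition tpure (a : A) (b : B) : tensor := \pi_tensor [:: (a, b)].

Lemma tens_piP (s t : seq (A * B)) :
  tens_eq s t <-> \pi_tensor s = \pi_tensor t.
Proof. by split=> [st | /eqquotP /asboolP //]; apply/eqquotP/asboolP. Qed.

Lemma tens_reprP (s : seq (A * B)) : tens_eq (repr (\pi_tensor s)) s.
Proof. by apply/tens_piP; rewrite reprK. Qed.

Definition tens0 : tensor := \pi_tensor [::].
Definition tens_add (x y : tensor) : tensor := \pi_tensor (repr x ++ repr y).
Definition tens_scale (r : R) (x : tensor) : tensor :=
  \pi_tensor [seq (r *: p.1, p.2) | p <- repr x].
Definition tens_opp (x : tensor) : tensor := tens_scale (-1) x.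

Lemma tens_addE s t : tens_add (\pi s) (\pi t) = \pi_tensor (s ++ t).
Proof. by apply/tens_piP; apply: te_cat; apply: tens_reprP. Qed.

Lemma te_0l b : tens_eq [:: (0, b)] [::].
Proof.
apply: te_trans te_0; apply: te_sym.
by have := te_scale 0 (0 : A) b; rewrite !scale0r => /te_sym.
Qed.

Lemma te_0r a : tens_eq [:: (a, 0)] [::].
Proof.
apply: te_trans te_0.
by have := te_scale 0 a (0 : B); rewrite !scale0r => /te_sym.
Qed.

Lemma tens_eq_map r s t : tens_eq s t ->
  tens_eq [seq (r *: p.1, p.2) | p <- s] [seq (r *: p.1, p.2) | p <- t].
Proof.
elim=> {s t} /=.
- by move=> s; apply: te_refl.
- by move=> s t _; apply: te_sym.
- by move=> s t u _ + _; apply: te_trans.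
- by move=> s s' t t' _ hs _ ht; rewrite !map_cat; apply: te_cat.
- by move=> s t; rewrite !map_cat; apply: te_catC.
- by rewrite scaler0; apply: te_0.
- by move=> a a' b; rewrite scalerDr; apply: te_addl.
- by move=> a b b'; apply: te_addr.
- by move=> r' a b; rewrite scalerA mulrC -scalerA; apply: te_scale.
Qed.

Lemma tens_scaleE r s :
  tens_scale r (\pi s) = \pi_tensor [seq (r *: p.1, p.2) | p <- s].
Proof. by apply/tens_piP; apply: tens_eq_map; apply: tens_reprP. Qed.

Lemma tens_addA : associative tens_add.
Proof. by elim/quotW=> s; elim/quotW=> t; elim/quotW=> u; rewrite !tens_addE catA. Qed.

Lemma tens_addC : commutative tens_add.
Proof.
elim/quotW=> s; elim/quotW=> t; rewrite !tens_addE.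
by apply/tens_piP; apply: te_catC.
Qed.

Lemma tens_add0 : left_id tens0 tens_add.
Proof. by elim/quotW=> s; rewrite /tens0 tens_addE. Qed.

Lemma tens_scaleDl x r s :
  tens_scale (r + s) x = tens_add (tens_scale r x) (tens_scale s x).
Proof.
elim/quotW: x => t; rewrite !tens_scaleE tens_addE; apply/tens_piP.
elim: t => [|[a b] t IH] /=; first exact: te_refl.
rewrite scalerDl -cat1s.
apply: te_trans (te_cat (te_addl _ _ _) IH) _.
rewrite /= -cat1s -[X in tens_eq _ X]cat1s.
apply: te_cat; first exact: te_refl.
rewrite -cat1s -[X in tens_eq _ (_ ++ X)]cat1s !catA.
by apply: te_cat (te_refl _); apply: te_catC.
Qed.

Lemma tens_scale0 x : tens_scale 0 x = tens0.
Proof.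
elim/quotW: x => t; rewrite tens_scaleE; apply/tens_piP.
elim: t => [|[a b] t IH] /=; first exact: te_refl.
by rewrite scale0r -cat1s; exact: te_cat (te_0l b) IH.
Qed.

Lemma tens_scale1 : left_id 1 tens_scale.
Proof.
elim/quotW=> s; rewrite tens_scaleE; congr (\pi _).
by rewrite -[RHS]map_id; apply: eq_map => -[a b] /=; rewrite scale1r.
Qed.

Lemma tens_addN : left_inverse tens0 tens_opp tens_add.
Proof.
move=> x; rewrite /tens_opp -{2}[x]tens_scale1 -tens_scaleDl addNr.
exact: tens_scale0.
Qed.

HB.instance Definition _ :=
  GRing.isZmodule.Build tensor tens_addA tens_addC tens_add0 tens_addN.

Lemma tens_piD s t : \pi_tensor s + \pi_tensor t = \pi_tensor (s ++ t).
Proof. exact: tens_addE. Qed.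

Lemma tens_scaleA r s x : tens_scale r (tens_scale s x) = tens_scale (r * s) x.
Proof.
elim/quotW: x => t; rewrite !tens_scaleE; congr (\pi _).
by rewrite -map_comp; apply: eq_map => -[a b] /=; rewrite scalerA.
Qed.

Lemma tens_scaleDr : right_distributive tens_scale +%R.
Proof.
move=> r; elim/quotW=> s; elim/quotW=> t.
by rewrite tens_piD !tens_scaleE tens_piD map_cat.
Qed.

HB.instance Definition _ := GRing.Zmodule_isLmodule.Build R tensor
  tens_scaleA tens_scale1 tens_scaleDr (fun x r s => tens_scaleDl x r s).

Lemma tpureDl a a' b : tpure (a + a') b = tpure a b + tpure a' b.
Proof. by rewrite tens_piD; apply/tens_piP; apply: te_addl. Qed.

Lemma tpureDr a b b' : tpure a (b + b') = tpure a b + tpure a b'.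
Proof. by rewrite tens_piD; apply/tens_piP; apply: te_addr. Qed.

Lemma tpureZ r a b : tpure (r *: a) b = tpure a (r *: b).
Proof. by apply/tens_piP; apply: te_scale. Qed.

Lemma tpureZl r a b : tpure (r *: a) b = r *: tpure a b.
Proof. by apply: esym; exact: tens_scaleE. Qed.

Lemma tpureZr r a b : tpure a (r *: b) = r *: tpure a b.
Proof. by rewrite -tpureZ tpureZl. Qed.

Lemma tensor_ind (P : tensor -> Prop) :
  P 0 -> (forall a b, P (tpure a b)) -> (forall x y, P x -> P y -> P (x + y)) ->
  forall x, P x.
Proof.
move=> P0 Pp PD; elim/quotW; elim=> [|[a b] s IH]; first exact: P0.
have -> : \pi_tensor ((a, b) :: s) = tpure a b + \pi_tensor s.
  by rewrite tens_piD.
exact: PD.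
Qed.

Section Lift.
Context (T : zmodType).

Definition balanced (f : A -> B -> T) : Prop :=
  [/\ forall a a' b, f (a + a') b = f a b + f a' b,
      forall a b b', f a (b + b') = f a b + f a b'
    & forall r a b, f (r *: a) b = f a (r *: b)].

(* The additive map induced by a balanced [f]; junk when [f] is not balanced. *)
Definition tlift (f : A -> B -> T) (x : tensor) : T :=
  \sum_(p <- repr x) f p.1 p.2.

Context (f : A -> B -> T) (bf : balanced f).

Lemma tlift_pi s : tlift f (\pi s) = \sum_(p <- s) f p.1 p.2.
Proof.
have [fDl fDr fZ] := bf.
have f0 b : f 0 b = 0.
  by apply: (@addrI _ (f 0 b)); rewrite -fDl !addr0.
have H u t : tens_eq u t -> \sum_(p <- u) f p.1 p.2 = \sum_(p <- t) f p.1 p.2.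
  elim=> {u t} //.
  - by move=> u t w _ -> _ ->.
  - by move=> u u' t t' _ h _ h'; rewrite !big_cat /= h h'.
  - by move=> u t; rewrite !big_cat /= addrC.
  - by rewrite big_seq1 big_nil /= f0.
  - by move=> a a' b; rewrite !big_cons !big_nil /= !addr0 fDl.
  - by move=> a b b'; rewrite !big_cons !big_nil /= !addr0 fDr.
  - by move=> r a b; rewrite !big_seq1 /= fZ.
exact/H/tens_reprP.
Qed.

Lemma tlift_pure a b : tlift f (tpure a b) = f a b.
Proof. by rewrite tlift_pi big_seq1. Qed.

Lemma tliftD : {morph tlift f : x y / x + y}.
Proof.
elim/quotW=> s; elim/quotW=> t.
by rewrite tens_piD !tlift_pi big_cat.
Qed.

Lemma tlift0 : tlift f 0 = 0.
Proof. by apply: (@addrI _ (tlift f 0)); rewrite -tliftD !addr0. Qed.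

Lemma tlift_sum I (r : seq I) (F : I -> tensor) :
  tlift f (\sum_(i <- r) F i) = \sum_(i <- r) tlift f (F i).
Proof. by apply: (big_morph _ tliftD tlift0). Qed.

End Lift.
End TensorDef.

Arguments tlift {R A B T} f x.
Arguments tpure {R A B} a b.


Section Restriction.
Context (R A : pzRingType) (f : {rmorphism R -> A}) (V : lmodType A).

Definition restr of {rmorphism R -> A} : Type := V.
Local Notation W := (restr f).
HB.instance Definition _ := GRing.Zmodule.on W.

Definition restr_scale (r : R) (x : W) : W := (f r *: (x : V) : V).

Lemma restr_scaleA r s x :
  restr_scale r (restr_scale s x) = restr_scale (r * s) x.
Proof. by rewrite /restr_scale scalerA rmorphM. Qed.
Lemma restr_scale1 : left_id 1 restr_scale.
Proof. by move=> x; rewrite /restr_scale rmorph1 scale1r. Qed.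
Lemma restr_scaleDr : right_distributive restr_scale +%R.
Proof. by move=> r x y; rewrite /restr_scale scalerDr. Qed.
Lemma restr_scaleDl x : {morph restr_scale^~ x : r s / r + s}.
Proof. by move=> r s; rewrite /restr_scale rmorphD scalerDl. Qed.

HB.instance Definition _ := GRing.Zmodule_isLmodule.Build R W
  restr_scaleA restr_scale1 restr_scaleDr restr_scaleDl.

Lemma restr_scaleE r (x : W) : r *: x = (f r *: (x : V) : V).
Proof. by []. Qed.

End Restriction.

Arguments restr {R A} V f.

Section TensorRing.
Context (R A B : comPzRingType) (f : {rmorphism R -> A}) (g : {rmorphism R -> B}).

(* [A (x)_R B] for commutative [R]-algebras given by their structure maps. *)
Definition tensR : Type := tensor (restr A^o f) (restr B^o g).
HB.instance Definition _ := GRing.Zmodule.on tensR.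

Definition tmk (a : A) (b : B) : tensR := @tpure _ (restr A^o f) (restr B^o g) a b.

Lemma tmkDl a a' b : tmk (a + a') b = tmk a b + tmk a' b.
Proof. exact: tpureDl. Qed.
Lemma tmkDr a b b' : tmk a (b + b') = tmk a b + tmk a b'.
Proof. exact: tpureDr. Qed.
Lemma tmkZ r a b : tmk (f r * a) b = tmk a (g r * b).
Proof. exact: (@tpureZ _ (restr A^o f) (restr B^o g) r a b). Qed.

Lemma tensR_ind (P : tensR -> Prop) :
  P 0 -> (forall a b, P (tmk a b)) -> (forall x y, P x -> P y -> P (x + y)) ->
  forall x, P x.
Proof.
by move=> P0 Pp PD x; apply: (@tensor_ind _ (restr A^o f) (restr B^o g) P).
Qed.

Definition rbalanced (T : zmodType) (h : A -> B -> T) : Prop :=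
  [/\ forall a a' b, h (a + a') b = h a b + h a' b,
      forall a b b', h a (b + b') = h a b + h a b'
    & forall r a b, h (f r * a) b = h a (g r * b)].

Definition rlift (T : zmodType) (h : A -> B -> T) (x : tensR) : T :=
  @tlift _ (restr A^o f) (restr B^o g) T h x.

Section RLift.
Context (T : zmodType) (h : A -> B -> T) (bh : rbalanced h).
Lemma rlift_mk a b : rlift h (tmk a b) = h a b.
Proof. exact: (@tlift_pure _ (restr A^o f) (restr B^o g) T h bh a b). Qed.
Lemma rliftD : {morph rlift h : x y / x + y}.
Proof. exact: (@tliftD _ (restr A^o f) (restr B^o g) T h bh ). Qed.
Lemma rlift0 : rlift h 0 = 0.
Proof. exact: (@tlift0 _ (restr A^o f) (restr B^o g) T h bh ). Qed.
End RLift.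

Definition tmul (x y : tensR) : tensR :=
  rlift (fun a b => rlift (fun c d => tmk (a * c) (b * d)) y) x.

Lemma tmul_bal2 a b : rbalanced (fun c d => tmk (a * c) (b * d)).
Proof.
split=> [c c' d | c d d' | r c d].
- by rewrite mulrDr tmkDl.
- by rewrite mulrDr tmkDr.
- by rewrite mulrCA tmkZ mulrCA.
Qed.

Lemma tmul_bal1 y :
  rbalanced (fun a b => rlift (fun c d => tmk (a * c) (b * d)) y).
Proof.
split.
- move=> a a' b; elim/tensR_ind: y => [|c d|y z IHy IHz].
  + by rewrite !(rlift0 (tmul_bal2 _ _)) addr0.
  + by rewrite !(rlift_mk (tmul_bal2 _ _)) mulrDl tmkDl.
  + by rewrite !(rliftD (tmul_bal2 _ _)) IHy IHz addrACA.
- move=> a b b'; elim/tensR_ind: y => [|c d|y z IHy IHz].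
  + by rewrite !(rlift0 (tmul_bal2 _ _)) addr0.
  + by rewrite !(rlift_mk (tmul_bal2 _ _)) mulrDl tmkDr.
  + by rewrite !(rliftD (tmul_bal2 _ _)) IHy IHz addrACA.
- move=> r a b; elim/tensR_ind: y => [|c d|y z IHy IHz].
  + by rewrite !(rlift0 (tmul_bal2 _ _)).
  + by rewrite !(rlift_mk (tmul_bal2 _ _)) -!mulrA tmkZ.
  + by rewrite !(rliftD (tmul_bal2 _ _)) IHy IHz.
Qed.

Lemma tmul_mk a b c d : tmul (tmk a b) (tmk c d) = tmk (a * c) (b * d).
Proof. by rewrite /tmul (rlift_mk (tmul_bal1 _)) (rlift_mk (tmul_bal2 _ _)). Qed.

Lemma tmulDl : left_distributive tmul +%R.
Proof. by move=> x x' y; rewrite /tmul (rliftD (tmul_bal1 _)). Qed.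

Lemma tmul0 y : tmul 0 y = 0.
Proof. by rewrite /tmul (rlift0 (tmul_bal1 _)). Qed.

Lemma tmulDr_mk a b y z :
  tmul (tmk a b) (y + z) = tmul (tmk a b) y + tmul (tmk a b) z.
Proof. by rewrite /tmul !(rlift_mk (tmul_bal1 _)) (rliftD (tmul_bal2 _ _)). Qed.

Lemma tmul_mk0 a b : tmul (tmk a b) 0 = 0.
Proof. by rewrite /tmul !(rlift_mk (tmul_bal1 _)) (rlift0 (tmul_bal2 _ _)). Qed.

Lemma tmulDr x y z : tmul x (y + z) = tmul x y + tmul x z.
Proof.
elim/tensR_ind: x => [|a b|x x' IH IH']; first by rewrite !tmul0 addr0.
  exact: tmulDr_mk.
by rewrite !tmulDl IH IH' addrACA.
Qed.

Lemma tmulx0 x : tmul x 0 = 0.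
Proof. by apply: (@addrI _ (tmul x 0)); rewrite -tmulDr !addr0. Qed.

Lemma tmulC : commutative tmul.
Proof.
move=> x y; elim/tensR_ind: x => [|a b|x x' IH IH'].
- by rewrite tmul0 tmulx0.
- elim/tensR_ind: y => [|c d|y z IHy IHz].
  + by rewrite tmul0 tmulx0.
  + by rewrite !tmul_mk mulrC [b * d]mulrC.
  + by rewrite tmulDl tmulDr IHy IHz.
- by rewrite tmulDl tmulDr IH IH'.
Qed.

Lemma tmulA : associative tmul.
Proof.
move=> x y z; elim/tensR_ind: x => [|a b|x x' IH IH'].
- by rewrite !tmul0.
- elim/tensR_ind: y => [|c d|y y' IHy IHy'].
  + by rewrite !(tmul0, tmulx0).
  + elim/tensR_ind: z => [|e e'|z z' IHz IHz'].
    * by rewrite !tmulx0.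
    * by rewrite !tmul_mk !mulrA.
    * by rewrite !tmulDr IHz IHz'.
  + by rewrite !(tmulDr, tmulDl) IHy IHy'.
- by rewrite !tmulDl IH IH'.
Qed.

Lemma tmul1 : left_id (tmk 1 1) tmul.
Proof.
elim/tensR_ind=> [|a b|x x' IH IH']; first by rewrite tmulx0.
  by rewrite tmul_mk !mul1r.
by rewrite tmulDr IH IH'.
Qed.

HB.instance Definition _ := GRing.Zmodule_isComPzRing.Build tensR
  tmulA tmulC tmul1 tmulDl.

Lemma tmkM a b c d : tmk a b * tmk c d = tmk (a * c) (b * d).
Proof. exact: tmul_mk. Qed.

Definition inl_t (a : A) : tensR := tmk a 1.
Definition inr_t (b : B) : tensR := tmk 1 b.

Lemma tmk0l b : tmk 0 b = 0.
Proof. by apply: (@addrI _ (tmk 0 b)); rewrite -tmkDl !addr0. Qed.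
Lemma tmk0r a : tmk a 0 = 0.
Proof. by apply: (@addrI _ (tmk a 0)); rewrite -tmkDr !addr0. Qed.

Fact inl_t_nmod : nmod_morphism inl_t.
Proof. by split=> [|a b]; rewrite /inl_t ?tmk0l ?tmkDl. Qed.
Fact inl_t_mon : monoid_morphism inl_t.
Proof. by split=> [|a b] //; rewrite /inl_t tmkM mulr1. Qed.
HB.instance Definition _ := GRing.isNmodMorphism.Build A tensR inl_t inl_t_nmod.
HB.instance Definition _ := GRing.isMonoidMorphism.Build A tensR inl_t inl_t_mon.

Fact inr_t_nmod : nmod_morphism inr_t.
Proof. by split=> [|a b]; rewrite /inr_t ?tmk0r ?tmkDr. Qed.
Fact inr_t_mon : monoid_morphism inr_t.
Proof. by split=> [|a b] //; rewrite /inr_t tmkM mulr1. Qed.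
HB.instance Definition _ := GRing.isNmodMorphism.Build B tensR inr_t inr_t_nmod.
HB.instance Definition _ := GRing.isMonoidMorphism.Build B tensR inr_t inr_t_mon.

Lemma inlr_t r : inl_t (f r) = inr_t (g r).
Proof. by rewrite /inl_t /inr_t -[f r]mulr1 tmkZ mulr1. Qed.

Section Universal.
Context (S : comPzRingType) (u : {rmorphism A -> S}) (w : {rmorphism B -> S}).

Definition tensR_desc of (forall r, u (f r) = w (g r)) :=
  rlift (fun a b => u a * w b).

Context (uw : forall r, u (f r) = w (g r)).

Lemma tensR_desc_bal : rbalanced (fun a b => u a * w b).
Proof.
split=> [a a' b|a b b'|r a b]; first by rewrite rmorphD mulrDl.
  by rewrite rmorphD mulrDr.
by rewrite !rmorphM uw mulrCA mulrA.
Qed.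

Lemma tensR_desc_mk a b : tensR_desc uw (tmk a b) = u a * w b.
Proof. exact: (rlift_mk tensR_desc_bal). Qed.

Fact tensR_desc_nmod : nmod_morphism (tensR_desc uw).
Proof.
by split; [exact: (rlift0 tensR_desc_bal) | exact: (rliftD tensR_desc_bal)].
Qed.
Fact tensR_desc_mon : monoid_morphism (tensR_desc uw).
Proof.
split=> [|x y]; first by rewrite tensR_desc_mk !rmorph1 mulr1.
have [h0 hD] := tensR_desc_nmod.
elim/tensR_ind: x => [|a b|x x' IH IH'].
- by rewrite !(mul0r, h0).
- elim/tensR_ind: y => [|c d|y y' IHy IHy'].
  + by rewrite !(mulr0, h0).
  + by rewrite tmkM !tensR_desc_mk !rmorphM mulrACA.
  + by rewrite !(mulrDr, hD) IHy IHy'.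
- by rewrite !(mulrDl, hD) IH IH'.
Qed.
HB.instance Definition _ :=
  GRing.isNmodMorphism.Build tensR S (tensR_desc uw) tensR_desc_nmod.
HB.instance Definition _ :=
  GRing.isMonoidMorphism.Build tensR S (tensR_desc uw) tensR_desc_mon.
End Universal.

End TensorRing.

Arguments inl_t {R A B} f g.
Arguments inr_t {R A B} f g.
Arguments tmk {R A B} f g.

Section BaseChange.
Context (R A : comPzRingType) (f : {rmorphism R -> A}) (V : lmodType R).

(* [A (x)_R V], as an [A]-module. *)
Definition baseChange : Type := tensor (restr A^o f) V.
HB.instance Definition _ := GRing.Zmodule.on baseChange.

Definition bmk (a : A) (v : V) : baseChange := @tpure _ (restr A^o f) V a v.

Definition bbalanced (T : zmodType) (h : A -> V -> T) : Prop :=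
  [/\ forall a a' v, h (a + a') v = h a v + h a' v,
      forall a v v', h a (v + v') = h a v + h a v'
    & forall r a v, h (f r * a) v = h a (r *: v)].

Definition blift (T : zmodType) (h : A -> V -> T) (x : baseChange) : T :=
  @tlift _ (restr A^o f) V T h x.

Lemma bmkDl a a' v : bmk (a + a') v = bmk a v + bmk a' v.
Proof. exact: tpureDl. Qed.
Lemma bmkDr a v v' : bmk a (v + v') = bmk a v + bmk a v'.
Proof. exact: tpureDr. Qed.
Lemma bmkZ r a v : bmk (f r * a) v = bmk a (r *: v).
Proof. exact: (@tpureZ _ (restr A^o f) V r a v). Qed.

Lemma baseChange_ind (P : baseChange -> Prop) :
  P 0 -> (forall a v, P (bmk a v)) -> (forall x y, P x -> P y -> P (x + y)) ->
  forall x, P x.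
Proof.
by move=> P0 Pp PD x; apply: (@tensor_ind _ (restr A^o f) V P).
Qed.

Section BLift.
Context (T : zmodType) (h : A -> V -> T) (bh : bbalanced h).
Lemma blift_mk a v : blift h (bmk a v) = h a v.
Proof. exact: (@tlift_pure _ (restr A^o f) V T h bh a v). Qed.
Lemma bliftD : {morph blift h : x y / x + y}.
Proof. exact: (@tliftD _ (restr A^o f) V T h bh ). Qed.
Lemma blift0 : blift h 0 = 0.
Proof. exact: (@tlift0 _ (restr A^o f) V T h bh ). Qed.
End BLift.

Definition bscale (a : A) : baseChange -> baseChange :=
  blift (fun a' v => bmk (a * a') v).

Lemma bscale_bal a : bbalanced (fun a' v => bmk (a * a') v).
Proof.
split=> [b c v|b v v'|r b v]; first by rewrite mulrDr bmkDl.
  by rewrite bmkDr.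
by rewrite mulrCA bmkZ.
Qed.

Lemma bscale_mk a b v : bscale a (bmk b v) = bmk (a * b) v.
Proof. exact: (blift_mk (bscale_bal a)). Qed.
Lemma bscaleDr : right_distributive bscale +%R.
Proof. by move=> a; exact: (bliftD (bscale_bal a)). Qed.
Lemma bscale0 a : bscale a 0 = 0.
Proof. exact: (blift0 (bscale_bal a)). Qed.
Lemma bscaleA a b x : bscale a (bscale b x) = bscale (a * b) x.
Proof.
elim/baseChange_ind: x => [|c v|x y IHx IHy]; first by rewrite !bscale0.
  by rewrite !bscale_mk mulrA.
by rewrite !bscaleDr IHx IHy.
Qed.
Lemma bscale1 : left_id 1 bscale.
Proof.
elim/baseChange_ind=> [|c v|x y IHx IHy]; first by rewrite !bscale0.
  by rewrite bscale_mk mul1r.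
by rewrite !bscaleDr IHx IHy.
Qed.
Lemma bscaleDl x : {morph bscale^~ x : a b / a + b}.
Proof.
move=> a b; elim/baseChange_ind: x => [|c v|x y IHx IHy].
- by rewrite !bscale0 addr0.
- by rewrite !bscale_mk mulrDl bmkDl.
- by rewrite !bscaleDr IHx IHy addrACA.
Qed.

HB.instance Definition _ := GRing.Zmodule_isLmodule.Build A baseChange
  bscaleA bscale1 bscaleDr bscaleDl.

Lemma bmkZl a b v : a *: bmk b v = bmk (a * b) v.
Proof. exact: bscale_mk. Qed.

End BaseChange.

Arguments bmk {R A} f {V}.
Arguments blift {R A} f {V T} h x.

Section Adic.
Context (k : fieldType) (w : {poly k}).

(* [lim k[t]/w^n], a residue class mod [w^n] being given by its remainder. *)
Record adic : Type := Adic {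
  adic_seq : nat -> {poly k};
  adicP : forall n, adic_seq n = adic_seq n.+1 %% w ^+ n }.

HB.instance Definition _ := gen_eqMixin adic.
HB.instance Definition _ := gen_choiceMixin adic.

Implicit Types a b : adic.

Lemma adic_eq a b : (forall n, adic_seq a n = adic_seq b n) -> a = b.
Proof.
case: a b => [a Pa] [b Pb] /= /funext ab; rewrite -{b}ab in Pb *.
by congr Adic; apply: Prop_irrelevance.
Qed.

Lemma adic_mod a n : adic_seq a n %% w ^+ n = adic_seq a n.
Proof. by rewrite adicP modp_id. Qed.

Lemma modp_expS (p : {poly k}) n : (p %% w ^+ n.+1) %% w ^+ n = p %% w ^+ n.
Proof.
rewrite {2}(divp_eq p (w ^+ n.+1)) modpD.
by rewrite [X in X + _]modp_eq0 ?add0r // exprS mulrA dvdp_mull.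
Qed.

Fact to_adic_subproof (p : {poly k}) n :
  p %% w ^+ n = (p %% w ^+ n.+1) %% w ^+ n.
Proof. by rewrite modp_expS. Qed.
Definition to_adic (p : {poly k}) : adic := Adic (to_adic_subproof p).

Fact adic_add_subproof a b n : adic_seq a n + adic_seq b n =
  (adic_seq a n.+1 + adic_seq b n.+1) %% w ^+ n.
Proof. by rewrite modpD -!adicP. Qed.
Definition adic_add a b := Adic (adic_add_subproof a b).

Fact adic_opp_subproof a n : - adic_seq a n = (- adic_seq a n.+1) %% w ^+ n.
Proof. by rewrite modpN -adicP. Qed.
Definition adic_opp a := Adic (adic_opp_subproof a).

Fact adic_mul_subproof a b n : (adic_seq a n * adic_seq b n) %% w ^+ n =
  ((adic_seq a n.+1 * adic_seq b n.+1) %% w ^+ n.+1) %% w ^+ n.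
Proof.
by rewrite modp_expS [adic_seq b n]adicP modp_mul mulrC [adic_seq a n]adicP modp_mul mulrC.
Qed.
Definition adic_mul a b := Adic (adic_mul_subproof a b).

Lemma adic_addA : associative adic_add.
Proof. by move=> a b c; apply: adic_eq => n /=; rewrite addrA. Qed.
Lemma adic_addC : commutative adic_add.
Proof. by move=> a b; apply: adic_eq => n /=; rewrite addrC. Qed.
Lemma adic_add0 : left_id (to_adic 0) adic_add.
Proof. by move=> a; apply: adic_eq => n /=; rewrite mod0p add0r. Qed.
Lemma adic_addN : left_inverse (to_adic 0) adic_opp adic_add.
Proof. by move=> a; apply: adic_eq => n /=; rewrite mod0p addNr. Qed.

HB.instance Definition _ :=
  GRing.isZmodule.Build adic adic_addA adic_addC adic_add0 adic_addN.

Lemma adic_mulC : commutative adic_mul.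
Proof. by move=> a b; apply: adic_eq => n /=; rewrite mulrC. Qed.
Lemma adic_mulA : associative adic_mul.
Proof.
move=> a b c; apply: adic_eq => n /=.
by rewrite modp_mul [X in _ = X %% _]mulrC modp_mul [in RHS]mulrC mulrA.
Qed.
Lemma adic_mul1 : left_id (to_adic 1) adic_mul.
Proof.
by move=> a; apply: adic_eq => n /=; rewrite mulrC modp_mul mulr1 adic_mod.
Qed.
Lemma adic_mulDl : left_distributive adic_mul adic_add.
Proof. by move=> a b c; apply: adic_eq => n /=; rewrite mulrDl modpD. Qed.

HB.instance Definition _ := GRing.Zmodule_isComPzRing.Build adic
  adic_mulA adic_mulC adic_mul1 adic_mulDl.

Fact to_adic_nmod : nmod_morphism to_adic.
Proof. by split=> // p q; apply: adic_eq => n /=; rewrite modpD. Qed.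
Fact to_adic_mon : monoid_morphism to_adic.
Proof.
split=> // p q; apply: adic_eq => n /=.
by rewrite modp_mul [in RHS]mulrC modp_mul mulrC.
Qed.
HB.instance Definition _ := GRing.isNmodMorphism.Build _ _ to_adic to_adic_nmod.
HB.instance Definition _ := GRing.isMonoidMorphism.Build _ _ to_adic to_adic_mon.

End Adic.

Section AdicMap.
Context (k k' : fieldType) (w : {poly k}) (w' : {poly k'}).
Context (j : {rmorphism k -> k'}).

(* The coefficientwise map [lim k[t]/w^n -> lim k'[t]/w'^n], for [w' = j(w)]. *)
Fact adic_map_subproof (jw : map_poly j w = w') (a : adic w) n :
  map_poly j (adic_seq a n) = map_poly j (adic_seq a n.+1) %% w' ^+ n.
Proof. by rewrite adicP map_modp rmorphXn /= jw. Qed.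
Definition adic_map (jw : map_poly j w = w') (a : adic w) : adic w' :=
  Adic (adic_map_subproof jw a).

Context (jw : map_poly j w = w').

Lemma adic_map_to (p : {poly k}) :
  adic_map jw (to_adic w p) = to_adic w' (map_poly j p).
Proof. by apply: adic_eq => n /=; rewrite map_modp rmorphXn /= jw. Qed.

Fact adic_map_nmod : nmod_morphism (adic_map jw).
Proof.
split=> [|a b]; first by rewrite [LHS]adic_map_to rmorph0.
by apply: adic_eq => n /=; rewrite rmorphD.
Qed.
Fact adic_map_mon : monoid_morphism (adic_map jw).
Proof.
split=> [|a b]; first by rewrite [LHS]adic_map_to rmorph1.
by apply: adic_eq => n /=; rewrite map_modp rmorphXn rmorphM /= jw.
Qed.
HB.instance Definition _ :=
  GRing.isNmodMorphism.Build _ _ (adic_map jw) adic_map_nmod.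
HB.instance Definition _ :=
  GRing.isMonoidMorphism.Build _ _ (adic_map jw) adic_map_mon.
End AdicMap.

Record place (k : fieldType) : Type := Place {
  place_poly :> {poly k};
  place_monic : place_poly \is monic;
  place_irr : irreducible_poly place_poly }.

Section LocalRing.
Context (Fq k : fieldType) (i : {rmorphism Fq -> k}) (v : place Fq).

Local Notation vk := (map_poly i v).

Definition kv_of_poly : {rmorphism {poly Fq} -> adic vk} :=
  to_adic vk \o map_poly i.

(* [k(t)_v = Fq(t) (x)_{Fq[t]} k[t]_v] *)
Definition ktv : Type :=
  tensR (FracField.tofrac (R := {poly Fq})) kv_of_poly.
HB.instance Definition _ := GRing.ComPzRing.on ktv.

End LocalRing.

Section LocalRingNontrivial.
Context (Fq k : fieldType) (i : {rmorphism Fq -> k}) (v : place Fq).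
Local Notation vk := (map_poly i v).
Local Notation kv := (adic vk).
Local Notation "x %:F" := (FracField.tofrac x).
Local Notation FF := {fraction {poly Fq}}.
Local Notation act := (kv_of_poly i v).

Lemma size_vk : (1 < size vk)%N.
Proof. by rewrite size_map_poly; apply: (place_irr v).1. Qed.

Lemma adic_v_tfree (y : kv) : act v * y = 0 -> y = 0.
Proof.
move=> vy; apply: adic_eq => n.
have vk0 : vk != 0 by rewrite -size_poly_gt0 (ltn_trans _ size_vk).
have := congr1 (fun a : kv => adic_seq a n.+1) vy.
rewrite /= mod0p mulrC modp_mul mulrC => /modp_eq0P.
rewrite exprS dvdp_mul2l // => /modp_eq0 h.
by rewrite mod0p adicP h.
Qed.

Lemma adic_tfree (D : {poly Fq}) (y : kv) : D != 0 -> act D * y = 0 -> y = 0.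
Proof.
move: {2}(size D) (leqnn (size D)) => m.
elim: m D y => [|m IH] D y; first by rewrite leqn0 size_poly_eq0 => ->.
move=> szD D0 Dy; have [vD | nvD] := boolP ((v : {poly Fq}) %| D).
  have /dvdpP [D1 eD] := vD.
  have D10 : D1 != 0 by apply: contraNneq D0 => h; rewrite eD h mul0r.
  apply: (IH D1) => //.
    rewrite -ltnS; apply: leq_trans szD.
    rewrite eD size_mul ?(irredp_neq0 (place_irr v)) //.
    have := (place_irr v).1; case: (size (v : {poly Fq})) => [|[|z]] // _.
    by rewrite addnS /= addnS ltnS leq_addr.
  have e : act v * (act D1 * y) = 0.
    by rewrite mulrA -rmorphM [_ * D1]mulrC -eD.
  exact: adic_v_tfree e.
have cop : coprimep vk (map_poly i D).
  rewrite coprimep_map; have [_ irr] := place_irr v.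
  rewrite /coprimep; apply: contraR nvD => h.
  have /andP [_ h2] := irr _ h (dvdp_gcdl _ _).
  exact: dvdp_trans h2 (dvdp_gcdr _ _).
apply: adic_eq => n; have := congr1 (fun a : kv => adic_seq a n) Dy.
rewrite /= mod0p mulrC modp_mul mulrC => /modp_eq0P.
by rewrite Gauss_dvdpr ?coprimep_expl // => /modp_eq0; rewrite adic_mod.
Qed.

(* A common denominator [D] turns a formal sum in [Fq(t) (x) k[t]_v] into an
   element of [k[t]_v]; this detects nontriviality. *)
Let num (D : {poly Fq}) (a : FF) : {poly Fq} :=
  match pselect (exists n, D%:F * a == n%:F) with
  | left h => xchoose h | right _ => 0 end.
Let good (D : {poly Fq}) (s : seq (FF * kv)) :=
  forall p, p \in s -> exists n, D%:F * p.1 = n%:F.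
Let val (D : {poly Fq}) (s : seq (FF * kv)) : kv :=
  \sum_(p <- s) act (num D p.1) * p.2.

Let numE D a n : D%:F * a = n%:F -> num D a = n.
Proof.
move=> e; rewrite /num; case: pselect => [h|[]]; last by exists n; apply/eqP.
apply/eqP; rewrite -tofrac_eq; apply/eqP.
by rewrite -(eqP (xchooseP h)).
Qed.

Let numD D (a a' : FF) n n' :
  D%:F * a = n%:F -> D%:F * a' = n'%:F -> num D (a + a') = n + n'.
Proof. by move=> e e'; apply: numE; rewrite mulrDr e e' -tofracD. Qed.

Let numM D r (a : FF) n : D%:F * a = n%:F -> num D (r%:F * a) = r * n.
Proof. by move=> e; apply: numE; rewrite mulrCA e -tofracM. Qed.

Let actD p q (x : kv) : act (p + q) * x = act p * x + act q * x.
Proof. by rewrite rmorphD mulrDl. Qed.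

Let actM p q (x : kv) : act (p * q) * x = act q * (act p * x).
Proof. by rewrite rmorphM mulrCA mulrA. Qed.

Let good_ex s : exists2 D, D != 0 & good D s.
Proof.
elim: s => [|[a x] s [D D0 gD]]; first by exists 1; rewrite ?oner_eq0.
have [c [d [d0 ea]]] : exists c d, d != 0 /\ d%:F * a = c%:F.
  elim/quotW: a => r; exists (\n_r), (\d_r); split; first exact: denom_ratioP.
  unlock FracField.tofrac; rewrite [LHS](esym (FracField.pi_mul _ _)).
  apply/eqmodP; rewrite /= FracField.equivfE /FracField.mulf.
  rewrite !numden_Ratio ?oner_eq0 ?mulr1 ?mul1r ?denom_ratioP //.
exists (D * d); first by rewrite mulf_neq0.
move=> p; rewrite inE => /orP[/eqP -> /=|ps].
  by exists (D * c); rewrite !rmorphM /= -mulrA ea.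
have [n e] := gD _ ps; exists (d * n).
by rewrite !rmorphM /= -e -mulrA mulrCA.
Qed.

Let good_num D s p : good D s -> p \in s -> D%:F * p.1 = (num D p.1)%:F.
Proof. by move=> gD /gD [n e]; rewrite e (numE e). Qed.

Let goodM D D' s : good D s -> good (D' * D) s.
Proof.
move=> gD p /gD [n e]; exists (D' * n).
by rewrite !rmorphM /= -e mulrA.
Qed.

Let valM D D' s : good D s -> val (D' * D) s = act D' * val D s.
Proof.
move=> gD; rewrite /val mulr_sumr; apply: eq_big_seq => p ps.
have e : (D' * D)%:F * p.1 = (D' * num D p.1)%:F.
  by rewrite !rmorphM /= -(good_num gD ps) mulrA.
by rewrite (numE e) rmorphM mulrA.
Qed.

Let good_cat D s t : good D (s ++ t) <-> good D s /\ good D t.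
Proof.
split=> [h|[hs ht] p]; last by rewrite mem_cat => /orP[/hs|/ht].
by split=> p ps; apply: h; rewrite mem_cat ps ?orbT.
Qed.

Let val_cat D s t : val D (s ++ t) = val D s + val D t.
Proof. by rewrite /val big_cat. Qed.

Let val1 D p : val D [:: p] = act (num D p.1) * p.2.
Proof. by rewrite /val big_seq1. Qed.

Let val2 D p p' :
  val D [:: p; p'] = act (num D p.1) * p.2 + act (num D p'.1) * p'.2.
Proof. by rewrite /val big_cons big_seq1. Qed.

Let val_eq (s t : seq (FF * kv)) :
  @tens_eq _ (restr FF^o (FracField.tofrac (R := {poly Fq}))) (restr kv^o act)
    s t ->
  forall D, D != 0 -> good D s -> good D t -> val D s = val D t.
Proof.
elim=> {s t}.
- by [].
- by move=> s t _ IH D D0 gs gt; rewrite (IH D).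
- move=> s t u _ IH1 _ IH2 D D0 gs gu.
  have [D' D'0 gt] := good_ex t.
  apply/eqP; rewrite -subr_eq0; apply/eqP; apply: (adic_tfree D'0).
  rewrite mulrBr -!valM //; apply/eqP; rewrite subr_eq0; apply/eqP.
  have DD : D' * D != 0 by rewrite mulf_neq0.
  have gt' : good (D' * D) t by rewrite mulrC; apply: goodM.
  by rewrite (IH1 _ DD (goodM D' gs) gt') (IH2 _ DD gt' (goodM D' gu)).
- move=> s s' t t' _ IH1 _ IH2 D D0 /good_cat [? ?] /good_cat [? ?].
  by rewrite !val_cat (IH1 D) ?(IH2 D).
- by move=> s t D _ _ _; rewrite !val_cat addrC.
- by move=> D _ _ _; rewrite val1 /= mulr0 /val big_nil.
- move=> a a' b D _ _ g; rewrite val1 val2 /=.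
  have ga : D%:F * a = (num D a)%:F.
    by apply: (good_num (p := (a, b)) g); rewrite inE eqxx.
  have ga' : D%:F * a' = (num D a')%:F.
    by apply: (good_num (p := (a', b)) g); rewrite !inE eqxx orbT.
  by rewrite (numD ga ga') actD.
- by move=> a b b' D _ _ _; rewrite val1 val2 /= mulrDr.
- move=> r a b D _ _ g; rewrite !val1 /=.
  have /g /= [n e] : (a, r *: b) \in [:: (a, r *: b)] by rewrite inE.
  by rewrite (numE e) [num _ _](numM r e) actM.
Qed.

Lemma ktv_neq0 : 1 != 0 :> ktv i v.
Proof.
apply/eqP => /tens_piP /val_eq /(_ 1 (oner_neq0 _)).
have g1 : good 1 [:: (1, 1)].
  by move=> p; rewrite inE => /eqP ->; exists 1; rewrite mulr1.
move=> /(_ g1) h; have {h} : val 1 [:: (1, 1)] = val 1 [::] by apply: h.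
rewrite val1 /val big_nil /= (numE (n := 1)) ?mulr1 // rmorph1.
move=> /(congr1 (fun a : kv => adic_seq a 1)) /=.
by rewrite mod0p expr1 modp_small ?size_poly1 ?size_vk // => /eqP; rewrite oner_eq0.
Qed.

HB.instance Definition _ := GRing.PzSemiRing_isNonZero.Build (ktv i v) ktv_neq0.

End LocalRingNontrivial.

Section LocalRingMap.
Context (Fq k k' : fieldType) (v : place Fq).
Context (i : {rmorphism Fq -> k}) (i' : {rmorphism Fq -> k'}).
Context (j : {rmorphism k -> k'}) (ji : forall a, j (i a) = i' a).

Fact place_map : map_poly j (map_poly i v) = map_poly i' v.
Proof. by rewrite -map_poly_comp; apply: eq_map_poly => a /=; rewrite ji. Qed.

Fact kv_map_compat (p : {poly Fq}) :
  inl_t (FracField.tofrac (R := {poly Fq})) (kv_of_poly i' v)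
    (FracField.tofrac p) =
  (inr_t (FracField.tofrac (R := {poly Fq})) (kv_of_poly i' v) \o
    adic_map place_map) (kv_of_poly i v p).
Proof.
rewrite inlr_t /= adic_map_to -map_poly_comp; congr (inr_t _ _ (to_adic _ _)).
by apply: eq_map_poly => a /=; rewrite ji.
Qed.

(* The map [k(t)_v -> k'(t)_v] induced by [j] on coefficients; [ji] only enters
   its type. *)
Definition ktv_map : ktv i v -> ktv i' v := tensR_desc kv_map_compat.
HB.instance Definition _ := GRing.RMorphism.on ktv_map.

Lemma ktv_mapE a b : ktv_map (tmk _ _ a b) = tmk _ _ a (adic_map place_map b).
Proof. by rewrite /ktv_map tensR_desc_mk /= tmkM mulr1 mul1r. Qed.

End LocalRingMap.

Lemma ktv_ind (Fq k : fieldType) (i : {rmorphism Fq -> k}) (v : place Fq)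
    (P : ktv i v -> Prop) :
  P 0 -> (forall a b, P (tmk _ _ a b)) ->
  (forall x y, P x -> P y -> P (x + y)) -> forall x, P x.
Proof. exact: tensR_ind. Qed.

Section Frobenius.
Context (Fq : finFieldType) (k : fieldType) (i : {rmorphism Fq -> k}).

Definition qfrob of {rmorphism Fq -> k} : k -> k := fun x => x ^+ #|Fq|.

Fact qfrob_nmod : nmod_morphism (qfrob i).
Proof.
have [p p_pr pF] := finPcharP Fq.
have pk : p \in [pchar k] by rewrite (rmorph_pchar i pF).
have qk : [pchar k].-nat #|Fq|.
  by rewrite (card_pprimeChar pF) pnatX (eq_pnat _ (pcharf_eq pk)) pnat_id.
split=> [|x y]; last exact: exprDn_pchar.
by rewrite /qfrob expr0n; case: #|Fq| (fintype0 (T := Fq) (0 : Fq)) => // n [].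
Qed.
Fact qfrob_mon : monoid_morphism (qfrob i).
Proof. by split=> [|x y]; rewrite /qfrob ?expr1n ?exprMn. Qed.
HB.instance Definition _ := GRing.isNmodMorphism.Build k k (qfrob i) qfrob_nmod.
HB.instance Definition _ := GRing.isMonoidMorphism.Build k k (qfrob i) qfrob_mon.

Lemma qfrob_base a : qfrob i (i a) = i a.
Proof. by rewrite /qfrob -rmorphXn expf_card. Qed.

(* [sigma], raising coefficients to the [q]-th power *)
Definition sigma (v : place Fq) : ktv i v -> ktv i v := ktv_map qfrob_base.
HB.instance Definition _ (v : place Fq) := GRing.RMorphism.on (@sigma v).
End Frobenius.

Arguments sigma {Fq k} i v.

(* The rings [F -> E -> L] with their Frobenius endomorphisms, [sigma] being
   the identity on [F]. *)
Record frobTower : Type := FrobTower {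
  tF : comNzRingType;
  tE : comNzRingType;
  tL : comNzRingType;
  tFE : {rmorphism tF -> tE};
  tEL : {rmorphism tE -> tL};
  tsE : {rmorphism tE -> tE};
  tsL : {rmorphism tL -> tL};
  tsEL : forall x, tsL (tEL x) = tEL (tsE x);
  tsFE : forall x, tsE (tFE x) = tFE x }.

Section Tower.
Context (Fq : finFieldType) (v : place Fq) (K Ks : fieldType).
Context (iota : {rmorphism Fq -> K}) (j : {rmorphism K -> Ks}).

Definition twF := ktv (idfun : Fq -> Fq) v.
Definition twE := ktv iota v.
Definition twL := ktv (j \o iota) v.

Definition twFE : twF -> twE :=
  @ktv_map _ _ _ v idfun iota iota (fun=> erefl).
Definition twEL : twE -> twL := @ktv_map _ _ _ v iota (j \o iota) j (fun=> erefl).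

HB.instance Definition _ := GRing.RMorphism.on twFE.
HB.instance Definition _ := GRing.RMorphism.on twEL.

Fact tw_sEL x : sigma (j \o iota) v (twEL x) = twEL (sigma iota v x).
Proof.
elim/ktv_ind: x => [|a b|x y IHx IHy]; first by rewrite !rmorph0.
- rewrite /sigma /twEL !ktv_mapE; congr (tmk _ _ a _); apply: adic_eq => n /=.
  rewrite -!map_poly_comp; apply: eq_map_poly => c /=.
  by rewrite /qfrob rmorphXn.
- by rewrite !rmorphD /= IHx IHy.
Qed.

Fact tw_sFE x : sigma iota v (twFE x) = twFE x.
Proof.
elim/ktv_ind: x => [|a b|x y IHx IHy]; first by rewrite !rmorph0.
- rewrite /sigma /twFE !ktv_mapE; congr (tmk _ _ a _); apply: adic_eq => n /=.
  rewrite -!map_poly_comp; apply: eq_map_poly => c /=.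
  by rewrite /qfrob -rmorphXn expf_card.
- by rewrite !rmorphD /= IHx IHy.
Qed.

Definition tower : frobTower := FrobTower tw_sEL tw_sFE.
End Tower.

Definition is_basis (R : nzRingType) (V : lmodType R) n (e : 'I_n -> V) : Prop :=
  forall x, exists! c : 'rV[R]_n, x = \sum_i c 0 i *: e i.

Section PhiModules.
Context (T : frobTower).
Local Notation F := (tF T).
Local Notation E := (tE T).
Local Notation L := (tL T).
Local Notation sE := (tsE T).
Local Notation sL := (tsL T).

Definition tFL : {rmorphism F -> L} := tEL T \o tFE T.

Lemma tsFL a : sL (tFL a) = tFL a.
Proof. by rewrite /= tsEL tsFE. Qed.

Record phiMod : Type := PhiMod {
  pmod :> lmodType E;
  pphi : {additive pmod -> pmod};
  pphiZ : forall a x, pphi (a *: x) = sE a *: pphi x }.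

Record phiHom (M N : phiMod) : Type := PhiHom {
  phom :> {linear M -> N};
  phomP : forall x, phom (pphi M x) = pphi N (phom x) }.

Section Solutions.
Context (M : phiMod).

(* [L (x)_E M] *)
Definition LM : Type := baseChange (tEL T) M.
HB.instance Definition _ := GRing.Lmodule.on LM.

(* [sigma (x) phi] on [L (x)_E M] *)
Definition phiL : LM -> LM := blift (tEL T) (fun l m => bmk (tEL T) (sL l) (pphi M m)).

Lemma phiL_bal : bbalanced (tEL T) (fun l m => bmk (tEL T) (sL l) (pphi M m)).
Proof.
split=> [l l' m|l m m'|a l m]; first by rewrite rmorphD bmkDl.
  by rewrite raddfD bmkDr.
by rewrite rmorphM /= tsEL pphiZ bmkZ.
Qed.

Lemma phiL_mk l m : phiL (bmk (tEL T) l m) = bmk (tEL T) (sL l) (pphi M m).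
Proof. exact: (blift_mk phiL_bal). Qed.
Lemma phiLD : {morph phiL : x y / x + y}.
Proof. exact: (bliftD phiL_bal). Qed.
Lemma phiL0 : phiL 0 = 0.
Proof. exact: (blift0 phiL_bal). Qed.

Lemma phiLZ l x : phiL (l *: x) = sL l *: phiL x.
Proof.
elim/baseChange_ind: x => [|l' m|x y IHx IHy]; first by rewrite !(scaler0, phiL0).
  by rewrite phiL_mk !bmkZl phiL_mk rmorphM.
by rewrite !(scalerDr, phiLD) IHx IHy.
Qed.

Definition phiL_fixed : {pred restr LM tFL} := fun x => phiL x == x.

Fact phiL_fixed_closed : submod_closed phiL_fixed.
Proof.
split=> [|a x y /eqP ex /eqP ey]; apply/eqP; first exact: phiL0.
by rewrite restr_scaleE phiLD phiLZ tsFL ex ey.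
Qed.
HB.instance Definition _ :=
  GRing.isSubmodClosed.Build F (restr LM tFL) phiL_fixed phiL_fixed_closed.

(* [V(M) = (L (x)_E M)^phi], an [F]-module *)
Record VM : Type := VMk { vmval : restr LM tFL; _ : phiL_fixed vmval }.
HB.instance Definition _ := [isSub for vmval].
HB.instance Definition _ := [Choice of VM by <:].
HB.instance Definition _ := [SubChoice_isSubLmodule of VM by <:].

Definition vL (x : VM) : LM := vmval x.

Lemma vLP x : phiL (vL x) = vL x.
Proof. by case: x => x /= /eqP. Qed.

Definition mkVM (x : LM) (xP : phiL x = x) : VM :=
  @VMk (x : restr LM tFL) (introT eqP xP).

(* the natural map [L (x)_F V(M) -> L (x)_E M] *)
Definition LV_to_LM : baseChange tFL VM -> LM := blift tFL (fun l x => l *: vL x).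

Definition L_trivial : Prop :=
  (exists n (e : 'I_n -> M), is_basis e) /\ bijective LV_to_LM.
End Solutions.

Section HomFunctor.
Context (M N : phiMod) (f : phiHom M N).

Definition LMmap : LM M -> LM N := blift (tEL T) (fun l m => bmk (tEL T) l (f m)).

Lemma LMmap_bal : bbalanced (tEL T) (fun l m => bmk (tEL T) l (f m)).
Proof.
split=> [l l' m|l m m'|a l m]; first by rewrite bmkDl.
  by rewrite raddfD bmkDr.
by rewrite linearZ bmkZ.
Qed.

Lemma LMmap_phi x : phiL (LMmap x) = LMmap (phiL x).
Proof.
have b0 := blift0 LMmap_bal; have bD := bliftD LMmap_bal.
have bE := blift_mk LMmap_bal.
rewrite /LMmap; elim/baseChange_ind: x => [|l m|x y IHx IHy].
- by rewrite !(b0, phiL0).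
- by rewrite bE !phiL_mk bE phomP.
- by rewrite !(bD, phiLD) IHx IHy.
Qed.

Fact Vmap_subproof (x : VM M) : phiL (LMmap (vL x)) = LMmap (vL x).
Proof. by rewrite LMmap_phi vLP. Qed.
Definition Vmap (x : VM M) : VM N := mkVM (Vmap_subproof x).
End HomFunctor.

Section TensorProduct.
Context (M N : phiMod).

Definition phi_tens (x : tensor M N) : tensor M N :=
  tlift (fun m n => tpure (pphi M m) (pphi N n)) x.

Lemma phi_tens_bal : balanced (fun m n => tpure (pphi M m) (pphi N n)).
Proof.
split=> [m m' n|m n n'|a m n]; first by rewrite raddfD tpureDl.
  by rewrite raddfD tpureDr.
by rewrite !pphiZ tpureZ.
Qed.

Fact phi_tens_nmod : nmod_morphism phi_tens.
Proof. by split; [exact: (tlift0 phi_tens_bal) | exact: (tliftD phi_tens_bal)]. Qed.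
HB.instance Definition _ :=
  GRing.isNmodMorphism.Build (tensor M N) (tensor M N) phi_tens phi_tens_nmod.

Lemma phi_tensZ a x : phi_tens (a *: x) = sE a *: phi_tens x.
Proof.
elim/tensor_ind: x => [|m n|x y IHx IHy]; first by rewrite !(scaler0, raddf0).
  by rewrite -tpureZl /phi_tens !(tlift_pure phi_tens_bal) pphiZ tpureZl.
by rewrite !(scalerDr, raddfD) /= IHx IHy.
Qed.

Definition tensMod : phiMod := PhiMod phi_tensZ.

(* multiplication [(L (x)_E M) x (L (x)_E N) -> L (x)_E (M (x)_E N)], and its
   restriction to [phi]-invariants *)
Definition muL (x : LM M) (y : LM N) : LM tensMod :=
  blift (tEL T) (fun l m => blift (tEL T) (fun l' n =>
    @bmk _ _ (tEL T) tensMod (l * l') (tpure m n)) y) x.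

Lemma muL_bal2 l m : bbalanced (tEL T) (fun l' (n : N) =>
  @bmk _ _ (tEL T) tensMod (l * l') (tpure m n)).
Proof.
split=> [l1 l2 n|l1 n n'|a l1 n]; first by rewrite mulrDr bmkDl.
  by rewrite tpureDr bmkDr.
by rewrite tpureZr mulrCA bmkZ.
Qed.

Lemma muL_bal1 y : bbalanced (tEL T) (fun l (m : M) => blift (tEL T) (fun l' (n : N) =>
  @bmk _ _ (tEL T) tensMod (l * l') (tpure m n)) y).
Proof.
have b0 l m := blift0 (muL_bal2 l m); have bD l m := bliftD (muL_bal2 l m).
have bE l m := blift_mk (muL_bal2 l m).
split=> [l l' m|l m m'|a l m]; elim/baseChange_ind: y => [|l2 n|y y' IH IH'].
- by rewrite !b0 addr0.
- by rewrite !bE mulrDl bmkDl.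
- by rewrite !bD IH IH' addrACA.
- by rewrite !b0 addr0.
- by rewrite !bE tpureDl bmkDr.
- by rewrite !bD IH IH' addrACA.
- by rewrite !b0.
- by rewrite !bE tpureZl -mulrA bmkZ.
- by rewrite !bD IH IH'.
Qed.

Lemma muL_phi x y : phiL (muL x y) = muL (phiL x) (phiL y).
Proof.
have b0 l m := blift0 (muL_bal2 l m); have bD l m := bliftD (muL_bal2 l m).
have bE l m := blift_mk (muL_bal2 l m).
rewrite /muL; elim/baseChange_ind: x => [|l m|x x' IHx IHx'].
- by rewrite !(phiL0, blift0 (muL_bal1 _)).
- rewrite phiL_mk !(blift_mk (muL_bal1 _)).
  elim/baseChange_ind: y => [|l' n|y y' IHy IHy'].
  + by rewrite !(phiL0, b0).
  + by rewrite phiL_mk !bE phiL_mk rmorphM /= /phi_tens (tlift_pure phi_tens_bal).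
  + by rewrite !(phiLD, bD) IHy IHy'.
- by rewrite !(phiLD, bliftD (muL_bal1 _)) IHx IHx'.
Qed.

Fact muV_subproof (x : VM M) (y : VM N) : phiL (muL (vL x) (vL y)) = muL (vL x) (vL y).
Proof. by rewrite muL_phi !vLP. Qed.
Definition muV (x : VM M) (y : VM N) : VM tensMod := mkVM (muV_subproof x y).
End TensorProduct.

Section Unit.
Definition phi_unit : E^o -> E^o := sE.
HB.instance Definition _ := GRing.Additive.on phi_unit.
Fact phi_unitZ a (x : E^o) : phi_unit (a *: x) = sE a *: phi_unit x.
Proof. exact: rmorphM. Qed.
Definition unitMod : phiMod := PhiMod phi_unitZ.
End Unit.

Section DirectSum.
Context (M N : phiMod).
Definition phi_sum (x : M * N) : M * N := (pphi M x.1, pphi N x.2).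
Fact phi_sum_nmod : nmod_morphism phi_sum.
Proof. by split=> [|x y]; rewrite /phi_sum ?raddf0 ?raddfD. Qed.
HB.instance Definition _ :=
  GRing.isNmodMorphism.Build (M * N)%type (M * N)%type phi_sum phi_sum_nmod.
Fact phi_sumZ a x : phi_sum (a *: x) = sE a *: phi_sum x.
Proof. by rewrite /phi_sum /= !pphiZ. Qed.
Definition sumMod : phiMod := PhiMod phi_sumZ.
End DirectSum.

(* [N'] is a dual of [N]: there is a perfect pairing [N x N' -> E] which is
   compatible with [phi]. *)
Definition is_dual (N N' : phiMod) : Prop :=
  exists b : N -> N' -> E,
  [/\ forall a x x' y, b (a *: x + x') y = a * b x y + b x' y,
      forall a x y y', b x (a *: y + y') = a * b x y + b x y',
      forall x y, b (pphi N x) (pphi N' y) = sE (b x y)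
    & forall f : {linear N -> E^o}, exists! y, forall x, b x y = f x].

(* The objects of the Tannakian subcategory [T_M] generated by [M]: the smallest
   class of [L]-trivial modules containing [M] and the unit and closed under
   sums, tensor products, duals, subobjects and quotients. *)
Inductive tannakian_gen (M : phiMod) : phiMod -> Prop :=
| tg_self : tannakian_gen M M
| tg_unit : tannakian_gen M unitMod
| tg_sum N N' : tannakian_gen M N -> tannakian_gen M N' ->
    tannakian_gen M (sumMod N N')
| tg_tens N N' : tannakian_gen M N -> tannakian_gen M N' ->
    tannakian_gen M (tensMod N N')
| tg_dual N N' : tannakian_gen M N -> L_trivial N' -> is_dual N N' ->
    tannakian_gen M N'
| tg_sub N N' (f : phiHom N' N) : tannakian_gen M N -> L_trivial N' ->
    injective f -> tannakian_gen M N'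
| tg_quo N N' (f : phiHom N N') : tannakian_gen M N -> L_trivial N' ->
    (forall y, exists x, f x = y) -> tannakian_gen M N'.

Record tanObj (M : phiMod) : Type := TanObj {
  tobj :> phiMod;
  tobjP : tannakian_gen M tobj }.

Definition tanUnit M : tanObj M := TanObj (tg_unit M).
Definition tanTens M (N N' : tanObj M) : tanObj M :=
  TanObj (tg_tens (tobjP N) (tobjP N')).

(* [F]-algebras are commutative rings [R] with a structure map [a : F -> R]. *)
Section Points.
Context (R : comPzRingType) (a : {rmorphism F -> R}).

(* [R (x)_F V(N)] *)
Definition RV (N : phiMod) : Type := baseChange a (VM N).
HB.instance Definition _ N := GRing.Lmodule.on (RV N).

Definition RVmap (N N' : phiMod) (f : phiHom N N') : RV N -> RV N' :=
  blift a (fun r x => bmk a r (Vmap f x)).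

Definition muRV (N N' : phiMod) (x : RV N) (y : RV N') : RV (tensMod N N') :=
  blift a (fun r v => blift a (fun r' v' => bmk a (r * r') (muV v v')) y) x.

(* The [R]-points of the Tannakian Galois group [Gamma_M = Aut^(x)(V|T_M)]:
   [R]-linear tensor automorphisms of [N |-> R (x)_F V(N)] on [T_M]. *)
Record tensAut (M : phiMod) : Type := TensAut {
  taut :> forall N : tanObj M, RV N -> RV N;
  taut_lin : forall N r x y, @taut N (r *: x + y) = r *: @taut N x + @taut N y;
  taut_bij : forall N, bijective (@taut N);
  taut_nat : forall (N N' : tanObj M) (f : phiHom N N') x,
    @taut N' (RVmap f x) = RVmap f (@taut N x);
  taut_tens : forall (N N' : tanObj M) x y,
    @taut (tanTens N N') (muRV x y) = muRV (@taut N x) (@taut N' y);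
  taut_unit : forall x, @taut (tanUnit M) x = x }.
Arguments taut {M} _ N x.
End Points.

Arguments RV {R} a N.
Arguments tensAut {R} a M.

Definition RVbc (R R' : comPzRingType) (a : {rmorphism F -> R})
    (a' : {rmorphism F -> R'}) (h : R -> R') (N : phiMod) : RV a N -> RV a' N :=
  blift a (fun r x => bmk a' (h r) x).

End PhiModules.

Arguments RV {T R} a N.
Arguments tensAut {T R} a M.
Arguments taut {T R a M} _ N x.
Arguments L_trivial {T} M.

Section GL.
Record GL (R : comPzRingType) (r : nat) : Type := GLMk {
  glmx :> 'M[R]_r;
  glinv : 'M[R]_r;
  glmxV : glmx *m glinv = 1%:M;
  glVmx : glinv *m glmx = 1%:M }.

Context (R S : comPzRingType) (r : nat).

Definition glV (g : GL R r) : GL R r := GLMk (glVmx g) (glmxV g).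

Fact glM_subproof (g h : GL R r) :
  (g *m h) *m (glinv h *m glinv g) = 1%:M.
Proof. by rewrite mulmxA -[_ *m h *m _]mulmxA glmxV mulmx1 glmxV. Qed.
Fact glM_subproofV (g h : GL R r) :
  (glinv h *m glinv g) *m (g *m h) = 1%:M.
Proof. by rewrite mulmxA -[_ *m _ *m g]mulmxA glVmx mulmx1 glVmx. Qed.
Definition glM (g h : GL R r) : GL R r := GLMk (glM_subproof g h) (glM_subproofV g h).

Fact glmap_subproof (f : {rmorphism R -> S}) (g : GL R r) :
  map_mx f g *m map_mx f (glinv g) = 1%:M.
Proof. by rewrite -map_mxM glmxV map_mx1. Qed.
Fact glmap_subproofV (f : {rmorphism R -> S}) (g : GL R r) :
  map_mx f (glinv g) *m map_mx f g = 1%:M.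
Proof. by rewrite -map_mxM glVmx map_mx1. Qed.
Definition glmap (f : {rmorphism R -> S}) (g : GL R r) : GL S r :=
  GLMk (glmap_subproof f g) (glmap_subproofV f g).

End GL.

(* [A[X, Delta^-1]] is presented by polynomials in [r * r + 1] variables: the
   first [r * r] stand for the entries [X_ij], the last one for [Delta^-1].
   [evalGL f h g] is the value [h(g)], coefficients being mapped by [f]; it
   unfolds [mmap f _ h], which the library states for nonzero target rings. *)
Definition evalGL (A : comNzRingType) (S : comPzRingType) (r : nat) (f : A -> S)
    (h : {mpoly A[r * r + 1]}) (g : GL S r) : S :=
  let x := row_mx (mxvec g) (\det (glinv g))%:M in
  \sum_(m <- msupp h) f h@_m * \prod_i x 0 i ^+ m i.

Section GaloisGroup.
Context (T : frobTower) (r : nat) (Psi : GL (tL T) r).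
Local Notation F := (tF T).
Local Notation E := (tE T).
Local Notation L := (tL T).
Local Notation EL := (tEL T).
Local Notation FL := (tFL T).
Local Notation LL := (tensR EL EL).

(* [(Psi (x) 1)^-1 (1 (x) Psi)] in [GL_r(L (x)_E L)] *)
Definition PsiPsi : GL LL r :=
  glM (glV (glmap (inl_t EL EL) Psi)) (glmap (inr_t EL EL) Psi).

Definition in_q (P : {mpoly F[r * r + 1]}) : Prop :=
  evalGL (inl_t EL EL \o FL) P PsiPsi = 0.

Section Points.
Context (R : comPzRingType) (a : {rmorphism F -> R}).

(* [Gamma(R)], for [Gamma = Spec F[X, Delta^-1]/q] *)
Record Gamma : Type := GammaMk {
  gam :> GL R r;
  gamP : forall P, in_q P -> evalGL a P gam = 0 }.

Definition RL := tensR a FL.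
HB.instance Definition _ := GRing.ComPzRing.on RL.

(* [Psi gamma] in [GL_r(R (x)_F L)] *)
Definition Psi_act (g : Gamma) : GL RL r :=
  glM (glmap (inr_t a FL) Psi) (glmap (inl_t a FL) g).

Definition E_RL : {rmorphism E -> RL} := inr_t a FL \o EL.

(* the natural map [R (x)_F V(N) -> (R (x)_F L) (x)_E N] *)
Definition RV_to_RLN (N : phiMod T) : RV a N -> baseChange E_RL N :=
  blift a (fun r v => blift EL (fun l n => bmk E_RL (tmk a FL r l) n) (vL v)).

(* Elements [sum_k (s_k (x) h_k(Psi)) (x) n_k] of [(R (x)_F Sigma) (x)_E N],
   where [Sigma = E[Psi, det Psi^-1]], inside [(R (x)_F L) (x)_E N]. *)
Definition sigma_elt (N : phiMod T) (s : seq (R * {mpoly E[r * r + 1]} * N)) :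
    baseChange E_RL N :=
  \sum_(p <- s) bmk E_RL (tmk a FL p.1.1 (evalGL EL p.1.2 Psi)) p.2.

(* Its image under [h(Psi) (x) n |-> h(Psi gamma) (x) n] *)
Definition sigma_elt_act (g : Gamma) (N : phiMod T)
    (s : seq (R * {mpoly E[r * r + 1]} * N)) : baseChange E_RL N :=
  \sum_(p <- s)
     bmk E_RL (inl_t a FL p.1.1 * evalGL E_RL p.1.2 (Psi_act g)) p.2.
End Points.

Arguments Gamma {R} a.
Arguments RV_to_RLN {R} a {N} x.
Arguments sigma_elt {R} a {N} s.

Definition Gamma_subgroup : Prop :=
  forall (R : comPzRingType) (a : {rmorphism F -> R}),
  [/\ exists e : Gamma a, e = 1%:M :> 'M_r,
      forall g h : Gamma a, exists gh : Gamma a, gh = g *m h :> 'M_r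
    & forall g : Gamma a, exists g' : Gamma a, g' = glinv g :> 'M_r].

Definition point_map (M : phiMod T) : Type :=
  forall (R : comPzRingType) (a : {rmorphism F -> R}), Gamma a -> tensAut a M.

(* [pi] is a homomorphism of group functors on [F]-algebras. *)
Definition is_hom (M : phiMod T) (pi : point_map M) : Prop :=
  (forall (R : comPzRingType) (a : {rmorphism F -> R}) (g h gh : Gamma a),
     gh = g *m h :> 'M_r ->
     forall (N : tanObj M) x, pi R a gh N x = pi R a g N (pi R a h N x)) /\
  (forall (R R' : comPzRingType) (a : {rmorphism F -> R})
     (a' : {rmorphism F -> R'}) (u : {rmorphism R -> R'}),
     (forall c, u (a c) = a' c) ->
     forall (g : Gamma a) (g' : Gamma a'), g' = map_mx u g :> 'M_r ->
     forall (N : tanObj M) x,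
     RVbc a' u (pi R a g N x) = pi R' a' g' N (RVbc a' u x)).

(* [pi] is [pi_M]: a homomorphism through which [g] acts on [R (x)_F V(N)] by
   restricting [h(Psi) (x) n |-> h(Psi g) (x) n]. *)
Definition is_piM (M : phiMod T) (pi : point_map M) : Prop :=
  is_hom pi /\
  forall (R : comPzRingType) (a : {rmorphism F -> R}) (g : Gamma a)
    (N : tanObj M) (x : RV a N) (s : seq (R * {mpoly E[r * r + 1]} * N)),
  RV_to_RLN a x = sigma_elt a s ->
  RV_to_RLN a (pi R a g N x) = sigma_elt_act g s.

(* Affine group schemes being identified with their functors of points, a
   homomorphism is an isomorphism when it is bijective on [R]-points. *)
Definition is_group_iso (M : phiMod T) (pi : point_map M) : Prop :=
  is_hom pi /\
  forall (R : comPzRingType) (a : {rmorphism F -> R}), bijective (pi R a).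

End GaloisGroup.

Definition separable_closure (K Ks : fieldType) (j : {rmorphism K -> Ks}) : Prop :=
  (forall x : Ks, exists2 p : {poly K},
     separable_poly p & root (map_poly j p) x) /\
  (forall p : {poly Ks}, (1 < size p)%N -> separable_poly p ->
     exists x, root p x).

(* Main.v *)
(* Everything rests on four facts about F -> E -> L: F and E are fields, F is the
   fixed ring of sigma on L, and L has no proper nonzero sigma-stable ideal.  The
   last two give the usual descent: phi-fixed vectors that are independent over F
   are independent over L.
   Applied to L (x)_E L, where the entries of Z = (Psi (x) 1)^-1 (1 (x) Psi) are
   fixed, this shows that Gamma(R) consists of the g in GL_r(R) for which
   h(Psi) |-> h(Psi g) is well defined on Sigma; hence Gamma is a group and acts on
   R (x) V(N) for every N in T_M, since V(N) and N generate each other over Sigma.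
   Injectivity is seen on V(M).  For surjectivity, a tensor automorphism t is
   determined by its matrix C on V(M), so that P(C) = 0 has to be shown for P in q.
   Now P(Z), up to a power of det Z, is the image of a vector v in V(N) under
   L (x) f for some N in T_M and some morphism f from N to L.  If P(Z) = 0 then v
   dies in V(f(N)), where f(N), being a quotient of N, is again in T_M; so t v dies
   there too, and evaluating f on t v gives P(C) times a power of det C. *)

Require Import Defs.
From HB Require Import structures.
From mathcomp Require Import all_boot all_order all_algebra all_field.
From mathcomp Require Import boolp classical_sets.
From mathcomp.multinomials Require Import mpoly.

Set Implicit Arguments.
Unset Strict Implicit.
Unset Printing Implicit Defensive.

Import GRing.Theory.
Local Open Scope ring_scope.


(** * Linear algebra over a field *)

(** Two obstacles shape the proof. The ring [L] is only a product of fields, which sigma permutes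
    cyclically, so a nonzero coefficient cannot be inverted; wherever a vector-space argument would
    divide in [L], sigma-simplicity produces a 1 from the iterates of the coefficient. The rings [F]
    and [E] are constructed as tensor products with a bare ring structure, so that being a field is
    a property to be proved, [fieldlike], and linear algebra is built on it for modules of arbitrary
    dimension. The second obstacle is in surjectivity. A relation P(Z) = 0 lives in L (x)_E L, on
    which a tensor automorphism does not act, since [L] is not given as an object of T_M. Passing to
    the image f(N) in [L] replaces [L] by an object of T_M that still embeds into it, and flatness
    over [E] keeps the embedding after tensoring with [L]. All of this is done on [R]-points for an
    arbitrary [F]-algebra [R]; being free over the field [F] is what [R] contributes. *)

Definition fieldlike (R : comNzRingType) : Prop :=
  forall x : R, x != 0 -> exists y, y * x = 1.

Section Families.
Context (R : pzRingType) (V : lmodType R).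

Definition lfree n (b : 'I_n -> V) : Prop :=
  forall c : 'I_n -> R, \sum_i c i *: b i = 0 -> forall i, c i = 0.

Definition lspan n (b : 'I_n -> V) (x : V) : Prop :=
  exists c : 'I_n -> R, x = \sum_i c i *: b i.

Lemma lspan_sum n (b : 'I_n -> V) m (c : 'I_m -> R) (u : 'I_m -> V) :
  (forall i, lspan b (u i)) -> lspan b (\sum_i c i *: u i).
Proof.
move=> /choice[e eE]; exists (fun k => \sum_i c i * e i k).
under eq_bigr do rewrite eE scaler_sumr; rewrite exchange_big /=.
by apply: eq_bigr => k _; rewrite scaler_suml; apply: eq_bigr => i _; rewrite scalerA.
Qed.

Lemma lspan_mem n (b : 'I_n -> V) i : lspan b (b i).
Proof.
exists (fun k => (k == i)%:R); rewrite (bigD1 i) //= eqxx scale1r big1 ?addr0 //.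
by move=> k /negbTE ->; rewrite scale0r.
Qed.

Lemma lfree_eq n (b : 'I_n -> V) (c c' : 'I_n -> R) :
  lfree b -> \sum_i c i *: b i = \sum_i c' i *: b i -> c =1 c'.
Proof.
move=> fb e i; apply/eqP; rewrite -subr_eq0; apply/eqP.
apply: (fb (fun i => c i - c' i)); under eq_bigr do rewrite scalerBl.
by rewrite sumrB e subrr.
Qed.

End Families.

Section FieldLinear.
Context (R : comNzRingType) (Rf : fieldlike R).

(** The basis is a reindexing of the given family, so whatever is known of each [u i] (being fixed
    by Frobenius, being the value of a polynomial) remains known of its members. *)
Lemma basis_extract (V : lmodType R) n (u : 'I_n -> V) :
  exists m (f : 'I_m -> 'I_n),
    lfree (u \o f) /\ forall i, lspan (u \o f) (u i).
Proof.
elim: n u => [|n IH] u; first by exists 0, id; split=> [c _ []|[]].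
have [m [f [fr sp]]] := IH (u \o lift ord0).
have [s0|ns0] := pselect (lspan (u \o (lift ord0 \o f)) (u ord0)).
  exists m, (lift ord0 \o f); split=> // i.
  by have [k ->|->] := unliftP ord0 i; [exact: sp|].
pose f' i := oapp (lift ord0 \o f) ord0 (unlift (@ord0 m) i).
have E c : \sum_i c i *: (u \o f') i =
    c ord0 *: u ord0 + \sum_i c (lift ord0 i) *: (u \o (lift ord0 \o f)) i.
  rewrite big_ord_recl /f' /= unlift_none; congr (_ + _).
  by apply: eq_bigr => i _; rewrite liftK.
exists m.+1, f'; split.
  move=> c; rewrite E => c0.
  (* Otherwise [c ord0] is invertible and the relation can be solved for [u ord0], which lies
     outside the span. *)
  have c00 : c ord0 = 0.
    apply/eqP/negP => /negP/Rf[y yc]; apply: ns0.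
    exists (fun i => - (y * c (lift ord0 i))).
    move/(congr1 (fun x => y *: x)): c0; rewrite scaler0 scalerDr scalerA yc scale1r.
    move/eqP; rewrite addr_eq0 => /eqP ->; rewrite scaler_sumr -sumrN.
    by apply: eq_bigr => i _; rewrite scaleNr scalerA.
  move: c0; rewrite c00 scale0r add0r => /fr c1 i.
  by have [k ->|->] := unliftP ord0 i; [exact: c1|].
move=> i; have [k ->|->] := unliftP ord0 i.
  have [c e] := sp k; exists (fun i => oapp c 0 (unlift ord0 i)).
  rewrite E unlift_none /= scale0r add0r; rewrite /= in e; rewrite e.
  by apply: eq_bigr => j _; rewrite liftK.
exists (fun i => oapp (fun=> 0) 1 (unlift ord0 i)).
rewrite E unlift_none /= scale1r big1 ?addr0 // => j _.
by rewrite liftK scale0r.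
Qed.

Section Functionals.
Context (V : lmodType R).

Lemma linear_pack (f : V -> R^o) :
  (forall a x y, f (a *: x + y) = a *: f x + f y) ->
  exists g : {linear V -> R^o}, g =1 f.
Proof.
move=> fl; pose m := GRing.isLinear.Build R V R^o *:%R f (fun a x y => fl a x y).
by pose g : {linear V -> R^o} := HB.pack f m; exists g.
Qed.

(** A subspace containing [W] and maximal among those avoiding [x] is a complement of the line of
    [x]; the functional is the coordinate along that line. *)
Lemma separating_functional (W : set V) (x : V) :
  W 0 -> (forall c y z, W y -> W z -> W (c *: y + z)) -> ~ W x ->
  exists2 f : {linear V -> R^o}, f x = 1 & forall y, W y -> f y = 0.
Proof.
move=> W0 Wl nWx.
(* The last condition asks for [W] inside [A] only when [A] is nonempty, so that the union of the
   empty chain satisfies [P] too. *)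
pose P (A : set V) := [/\ forall c y z, A y -> A z -> A (c *: y + z), ~ A x
  & forall y, A y -> forall z, W z -> A z].
have [| A [[Al nAx AW] Amax]] := @Zorn_bigcup V P.
  move=> C CP tot; split.
  - move=> c y z [B CB By] [B' CB' B'z].
    have [BB'|B'B] := tot _ _ CB CB'.
      by exists B' => //; have [Bl _ _] := CP _ CB'; exact: (Bl _ _ _ (BB' _ By) B'z).
    by exists B => //; have [Bl _ _] := CP _ CB; exact: (Bl _ _ _ By (B'B _ B'z)).
  - by move=> [B CB]; have [] := CP _ CB.
  - by move=> y [B CB By] z Wz; exists B => //; have [_ _ h] := CP _ CB; exact: (h _ By).
have A0 : A 0.
  apply: contrapT => nA0; apply: (Amax W) => //.
  split; first by move=> y Ay; case: nA0; exact: (AW _ Ay).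
  by move=> h; apply: nA0; exact: h.
have {}AW : forall y, W y -> A y by exact: (AW _ A0).
have AZ c y : A y -> A (c *: y) by move=> Ay; rewrite -[_ *: _]addr0; exact: Al.
have AD y z : A y -> A z -> A (y + z).
  by move=> Ay Az; rewrite -[y]scale1r; exact: Al.
have AN y : A y -> A (- y) by rewrite -scaleN1r; exact: AZ.
(* If [y] is outside [A], then [A] plus the line of [y] is strictly larger and must contain [x]. The
   coefficient of [y] in [x] is nonzero because [x] is not in [A], so the relation can be solved for
   [y]. *)
have ex y : exists c, A (y - c *: x).
  have [Ay|nAy] := pselect (A y); first by exists 0; rewrite scale0r subr0.
  pose B z := exists c, A (z - c *: y).
  have [Bx|nBx] := pselect (B x).
    have [c Ac] := Bx.
    have c0 : c != 0.
      by apply/eqP => c0; apply: nAx; move: Ac; rewrite c0 scale0r subr0.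
    have [c' e] := Rf c0; exists c'.
    have := AN _ (AZ c' _ Ac).
    by rewrite scalerBr scalerA e scale1r opprB.
  case: (Amax B).
    split; first by move=> z Az; exists 0; rewrite scale0r subr0.
    by move=> h; apply: nAy; apply: h; exists 1; rewrite scale1r subrr.
  split=> //.
  - move=> c z z' [d Az] [d' Az']; exists (c * d + d').
    have -> : c *: z + z' - (c * d + d') *: y = c *: (z - d *: y) + (z' - d' *: y).
      by rewrite scalerBr scalerA scalerDl opprD !addrA; congr (_ - _); rewrite addrAC.
    exact: Al.
  - by move=> z _ z' Wz'; exists 0; rewrite scale0r subr0; exact: AW.
have [f fE] := choice ex.
have uni c y : A (y - c *: x) -> f y = c.
  move=> Ac; apply/eqP; rewrite -subr_eq0; apply: contrapT => /negP /Rf[d e].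
  apply: nAx; have := AZ d _ (AD _ _ Ac (AN _ (fE y))).
  by rewrite opprB [X in _ + X]addrC addrACA subrr add0r addrC -scalerBl scalerA e scale1r.
have [|g gE] := @linear_pack f.
  move=> a y z; apply: uni.
  have -> : a *: y + z - (a * f y + f z : R) *: x = a *: (y - f y *: x) + (z - f z *: x).
    by rewrite scalerBr scalerA scalerDl opprD !addrA; congr (_ - _); rewrite addrAC.
  exact: Al.
exists g => [|y Wy]; rewrite gE; apply: uni.
  by rewrite scale1r subrr.
by rewrite scale0r subr0; apply: AW.
Qed.

(** The functional [d i] separates [b i] from the combinations of the family whose [i]-th
    coefficient vanishes. *)
Lemma dual_family n (b : 'I_n -> V) : lfree b ->
  exists d : 'I_n -> {linear V -> R^o}, forall i k, d i (b k) = (k == i)%:R.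
Proof.
move=> fb; suff /choice[d dE] : forall i, exists d : {linear V -> R^o},
  forall k, d (b k) = (k == i)%:R by exists d.
move=> i.
pose W y := exists2 c : 'I_n -> R, c i = 0 & y = \sum_k c k *: b k.
have [||| f f1 f0] := @separating_functional W (b i).
- by exists (fun=> 0) => //; rewrite big1 // => k _; rewrite scale0r.
- move=> a _ _ [c c0 ->] [c' c'0 ->]; exists (fun k => a * c k + c' k).
    by rewrite c0 c'0 mulr0 addr0.
  rewrite scaler_sumr -big_split; apply: eq_bigr => k _.
  by rewrite scalerDl scalerA.
- move=> [c c0]; have [e eE] := lspan_mem b i; rewrite eE => h.
  have := lfree_eq fb (etrans (esym eE) (etrans eE h)) i.
  rewrite c0 => ei.
  have := fb (fun k => (k == i)%:R - c k).
  under eq_bigr do rewrite scalerBl; rewrite sumrB -h -eE.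
  rewrite (bigD1 i) //= eqxx scale1r big1; last by move=> k /negbTE ->; rewrite scale0r.
  by rewrite addr0 subrr => /(_ erefl i)/eqP; rewrite eqxx c0 subr0 oner_eq0.
exists f => k; case: eqVneq => [->|ki]; first exact: f1.
apply: f0; exists (fun l => (l == k)%:R); first by rewrite eq_sym (negbTE ki).
rewrite (bigD1 k) //= eqxx scale1r big1 ?addr0 // => l /negbTE ->.
by rewrite scale0r.
Qed.

End Functionals.

Section Tensors.
Context (A V : lmodType R).

Lemma tpure0r (a : A) : tpure a (0 : V) = 0.
Proof. by apply: (@addrI _ (tpure a 0)); rewrite -tpureDr !addr0. Qed.
Lemma tpure0l (v : V) : tpure (0 : A) v = 0.
Proof. by apply: (@addrI _ (tpure 0 v)); rewrite -tpureDl !addr0. Qed.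

Lemma tpure_suml I (s : seq I) (P : pred I) (a : I -> A) (v : V) :
  tpure (\sum_(i <- s | P i) a i) v = \sum_(i <- s | P i) tpure (a i) v.
Proof.
exact: (big_morph (fun a => tpure a v) (fun a a' => tpureDl a a' v) (tpure0l v)).
Qed.
Lemma tpure_sumr I (s : seq I) (P : pred I) (a : A) (v : I -> V) :
  tpure a (\sum_(i <- s | P i) v i) = \sum_(i <- s | P i) tpure a (v i).
Proof. exact: (big_morph (tpure a) (tpureDr a) (tpure0r a)). Qed.

(** Contracting the second factor with the functional dual to [b i] isolates [a i]. *)
Lemma tens_freer n (a : 'I_n -> A) (b : 'I_n -> V) :
  lfree b -> \sum_i tpure (a i) (b i) = 0 -> forall i, a i = 0.
Proof.
move=> /dual_family[d dE] e i.
have bal : balanced (fun (a : A) (v : V) => (d i v : R) *: a).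
  split=> [x x' v|x v v'|r x v]; first by rewrite scalerDr.
    by rewrite linearD scalerDl.
  have -> : (d i (r *: v) : R) = r * d i v by exact: (linearZ_LR (d i) r v).
  by rewrite scalerA mulrC.
move/(congr1 (tlift (fun (a : A) (v : V) => (d i v : R) *: a))): e.
rewrite (tlift0 bal) (tlift_sum bal) => <-; rewrite (bigD1 i) //=.
rewrite (tlift_pure bal) dE eqxx scale1r big1 ?addr0 // => k /negbTE ki.
by rewrite (tlift_pure bal) dE ki scale0r.
Qed.

Lemma tens_freel n (a : 'I_n -> V) (b : 'I_n -> A) :
  lfree b -> \sum_i tpure (b i) (a i) = 0 -> forall i, a i = 0.
Proof.
move=> /dual_family[d dE] e i.
have bal : balanced (fun (a : A) (v : V) => (d i a : R) *: v).
  split=> [x x' v|x v v'|r x v]; first by rewrite linearD scalerDl.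
    by rewrite scalerDr.
  have -> : (d i (r *: x) : R) = r * d i x by exact: (linearZ_LR (d i) r x).
  by rewrite scalerA mulrC.
move/(congr1 (tlift (fun (a : A) (v : V) => (d i a : R) *: v))): e.
rewrite (tlift0 bal) (tlift_sum bal) => <-; rewrite (bigD1 i) //=.
rewrite (tlift_pure bal) dE eqxx scale1r big1 ?addr0 // => k /negbTE ki.
by rewrite (tlift_pure bal) dE ki scale0r.
Qed.

Lemma tens_sum (x : tensor A V) :
  exists n (a : 'I_n -> A) (b : 'I_n -> V), x = \sum_i tpure (a i) (b i).
Proof.
have [s ->] : exists s : seq (A * V), x = \sum_(p <- s) tpure p.1 p.2.
  elim/tensor_ind: x => [|a b|x y [s ->] [t ->]].
  - by exists [::]; rewrite big_nil.
  - by exists [:: (a, b)]; rewrite big_seq1.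
  - by exists (s ++ t); rewrite big_cat.
exists (size s), (fun i => (nth (0, 0) s i).1), (fun i => (nth (0, 0) s i).2).
by rewrite (big_nth (0, 0)) big_mkord.
Qed.

Lemma tens_reprr (x : tensor A V) : exists n (a : 'I_n -> A) (b : 'I_n -> V),
  lfree b /\ x = \sum_i tpure (a i) (b i).
Proof.
have [n [a [b ->]]] := tens_sum x.
have [m [f [fr /choice[c cE]]]] := basis_extract b.
exists m, (fun k => \sum_i c i k *: a i), (b \o f); split=> //.
under eq_bigr => i _ do rewrite cE tpure_sumr.
rewrite exchange_big /=; apply: eq_bigr => k _; rewrite tpure_suml.
by apply: eq_bigr => i _; rewrite tpureZ.
Qed.

Lemma tens_reprl (x : tensor A V) : exists n (a : 'I_n -> A) (b : 'I_n -> V),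
  lfree a /\ x = \sum_i tpure (a i) (b i).
Proof.
have [n [a [b ->]]] := tens_sum x.
have [m [f [fr /choice[c cE]]]] := basis_extract a.
exists m, (a \o f), (fun k => \sum_i c i k *: b i); split=> //.
under eq_bigr => i _ do rewrite cE tpure_suml.
rewrite exchange_big /=; apply: eq_bigr => k _; rewrite tpure_sumr.
by apply: eq_bigr => i _; rewrite tpureZ.
Qed.

End Tensors.

Lemma lfree_inj (V W : lmodType R) (g : {linear V -> W}) n (b : 'I_n -> V) :
  injective g -> lfree b -> lfree (g \o b).
Proof.
move=> gi fb c c0; apply: fb; apply: gi; rewrite linear0 linear_sum -[RHS]c0.
by apply: eq_bigr => i _; rewrite linearZ.
Qed.

(** Flatness over a field: the tensor is written with independent second entries, and [g] keeps them
    independent. *)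
Lemma tens_inj (A V W : lmodType R) (g : {linear V -> W}) : injective g ->
  forall x : tensor A V, tlift (fun a v => tpure a (g v)) x = 0 -> x = 0.
Proof.
move=> gi x; have [n [a [b [fb ->]]]] := tens_reprr x.
have bal : balanced (fun (a : A) (v : V) => tpure a (g v)).
  split=> [y y' v|y v v'|r y v]; first by rewrite tpureDl.
    by rewrite linearD tpureDr.
  by rewrite linearZ /= tpureZ.
rewrite (tlift_sum bal); under eq_bigr do rewrite (tlift_pure bal).
move=> /(tens_freer (lfree_inj gi fb)) a0; rewrite big1 // => i _.
by rewrite a0 tpure0l.
Qed.

End FieldLinear.

(* A nonzero relation of minimal support can be normalised, by simplicity of [L],
   to have a coefficient 1; subtracting its image under [phi] shortens it, so that
   its coefficients are fixed by [sigma]. *)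
Lemma fixed_lfree (F : pzRingType) (L : comNzRingType) (sg : {rmorphism L -> L})
    (iF : F -> L)
    (Lfix : forall x, sg x = x -> exists a, iF a = x)
    (Lsimple : forall x, x != 0 -> exists m (a : 'I_m -> L),
       \sum_i a i * iter i sg x = 1)
    (A : lmodType L) (phi : A -> A)
    (phiD : {morph phi : x y / x + y})
    (phiZ : forall l x, phi (l *: x) = sg l *: phi x) n (w : 'I_n -> A) :
  (forall i, phi (w i) = w i) -> iF 0 = 0 ->
  (forall c : 'I_n -> F, \sum_i iF (c i) *: w i = 0 -> forall i, c i = 0) ->
  lfree w.
Proof.
move=> phw iF0 fw c.
have phi0 : phi 0 = 0 by apply: (@addrI _ (phi 0)); rewrite -phiD !addr0.
have rel_phi (e : 'I_n -> L) : \sum_i e i *: w i = 0 -> \sum_i sg (e i) *: w i = 0.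
  move=> /(congr1 phi); rewrite phi0 (big_morph _ phiD phi0) => e0.
  by rewrite -[RHS]e0; apply: eq_bigr => i _; rewrite phiZ phw.
have [k] := ubnP #|[set i | c i != 0]|; elim: k c => // k IH c lec c0.
have rel_it m : \sum_i iter m sg (c i) *: w i = 0.
  by elim: m => //= m; exact: rel_phi.
have [all0|] := pselect (forall i, c i = 0) => //.
move=> /existsNP[i0 /eqP /Lsimple[m [a a1]]].
pose c' i := \sum_(j < m) a j * iter j sg (c i).
have c'0 : \sum_i c' i *: w i = 0.
  under eq_bigr do rewrite scaler_suml.
  rewrite exchange_big big1 //= => j _; under eq_bigr do rewrite -scalerA.
  by rewrite -scaler_sumr rel_it scaler0.
have it0 j : iter j sg 0 = 0 by elim: j => //= j ->; rewrite rmorph0.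
have c's i : c i = 0 -> c' i = 0.
  by move=> ci; rewrite /c' big1 // => j _; rewrite ci it0 mulr0.
have c'1 : c' i0 = 1 := a1.
have fix' i : sg (c' i) = c' i.
  apply/eqP; rewrite -subr_eq0; apply/eqP; move: i; apply: IH; last first.
    by under eq_bigr do rewrite scalerBl; rewrite sumrB (rel_phi _ c'0) c'0 subrr.
  rewrite ltnS in lec; apply: leq_trans lec.
  apply: proper_card; apply/properP; split.
    apply/fintype.subsetP => i; rewrite !inE; apply: contra_neq => ci.
    by rewrite c's // rmorph0 subrr.
  exists i0; rewrite !inE; last by rewrite c'1 rmorph1 subrr eqxx.
  by apply: contra_eq_neq c'1 => /eqP ci; rewrite c's ?(eqP ci) // eq_sym oner_eq0.
have /choice[f fE] i := Lfix _ (fix' i).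
have f0 : f i0 = 0.
  by apply: fw; rewrite -[RHS]c'0; apply: eq_bigr => i _; rewrite fE.
by move/eqP: c'1; rewrite -fE f0 iF0 eq_sym oner_eq0.
Qed.


(** * Polynomial functions on GL_r *)

Lemma mpoly_alg_ind (A : comNzRingType) n (P : {mpoly A[n]} -> Prop) :
  (forall a, P a%:MP) -> (forall i, P 'X_i) ->
  (forall p q, P p -> P q -> P (p + q)) ->
  (forall p q, P p -> P q -> P (p * q)) -> forall p, P p.
Proof.
move=> PC PX PD PM; apply: mpolyind => [|a m p _ _ Pp].
  by rewrite -mpolyC0; exact: PC.
apply: (PD) Pp; rewrite -mul_mpolyC; apply: (PM) => //; rewrite mpolyXE_id.
apply: (big_ind P); [by rewrite -mpolyC1; exact: PC | exact: PM | move=> i _].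
elim: (m i) => [|k IH]; first by rewrite expr0 -mpolyC1; exact: PC.
by rewrite exprS; apply: (PM).
Qed.

Section Eval.
Context (A : comNzRingType) (S : comPzRingType) (r : nat).
Local Notation n := (r * r + 1)%N.

Definition glvar (g : GL S r) (i : 'I_n) : S :=
  row_mx (mxvec g) (\det (glinv g))%:M 0 i.

Lemma glvar_entry g i j : glvar g (lshift 1 (mxvec_index i j)) = g i j.
Proof. by rewrite /glvar row_mxEl mxvecE. Qed.
Lemma glvar_det g i : glvar g (rshift (r * r) i) = \det (glinv g).
Proof. by rewrite /glvar row_mxEr mxE !ord1. Qed.

Variant glvar_spec : 'I_n -> Type :=
| GlvarEntry i j : glvar_spec (lshift 1 (mxvec_index i j))
| GlvarDet i : glvar_spec (rshift (r * r) i).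

Lemma glvarP i : glvar_spec i.
Proof.
case: (split_ordP i) => k ->; last exact: GlvarDet.
by case/mxvec_indexP: k => i' j'; exact: GlvarEntry.
Qed.

Context (f : {rmorphism A -> S}).

Lemma evalGLE h (g : GL S r) :
  evalGL f h g = \sum_(m <- msupp h) f h@_m * \prod_i glvar g i ^+ m i.
Proof. by []. Qed.

(* [mmap] only evaluates in nonzero rings; in the zero ring all values agree. *)
Lemma evalGL_mor (g : GL S r) :
  nmod_morphism (fun h => evalGL f h g) /\ monoid_morphism (fun h => evalGL f h g).
Proof.
have [S0|S1] := eqVneq (1 : S) 0.
  have triv (x y : S) : x = y by rewrite -[x]mulr1 -[y]mulr1 S0 !mulr0.
  by split; split=> [|x y]; exact: triv.
pose S' : comNzRingType := HB.pack (GRing.ComPzRing.sort S)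
  (GRing.PzSemiRing_isNonZero.Build (GRing.ComPzRing.sort S) S1).
pose f' : {rmorphism A -> S'} := HB.pack (f : A -> S')
  (GRing.isNmodMorphism.Build A S' f (raddf0 f, raddfD f))
  (GRing.isMonoidMorphism.Build A S' f (rmorph1 f, rmorphM f)).
have e h : evalGL f h g = mmap f' (glvar g : _ -> S') h by [].
by split; split=> [|p q]; rewrite !e ?rmorph0 ?rmorphD ?rmorph1 ?rmorphM.
Qed.

Definition evalm (g : GL S r) (h : {mpoly A[n]}) : S := evalGL f h g.
HB.instance Definition _ g :=
  GRing.isNmodMorphism.Build {mpoly A[n]} S (evalm g) (evalGL_mor g).1.
HB.instance Definition _ g :=
  GRing.isMonoidMorphism.Build {mpoly A[n]} S (evalm g) (evalGL_mor g).2.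

Lemma evalGL0 (g : GL S r) : evalGL f 0 g = 0.
Proof. exact: (rmorph0 (evalm g)). Qed.
Lemma evalGL1 (g : GL S r) : evalGL f 1 g = 1.
Proof. exact: (rmorph1 (evalm g)). Qed.
Lemma evalGLD (g : GL S r) p q : evalGL f (p + q) g = evalGL f p g + evalGL f q g.
Proof. exact: (rmorphD (evalm g)). Qed.
Lemma evalGLN (g : GL S r) p : evalGL f (- p) g = - evalGL f p g.
Proof. exact: (rmorphN (evalm g)). Qed.
Lemma evalGLM (g : GL S r) p q : evalGL f (p * q) g = evalGL f p g * evalGL f q g.
Proof. exact: (rmorphM (evalm g)). Qed.
Lemma evalGL_sum (g : GL S r) I (s : seq I) (P : pred I) (p : I -> {mpoly A[n]}) :
  evalGL f (\sum_(i <- s | P i) p i) g = \sum_(i <- s | P i) evalGL f (p i) g.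
Proof. exact: (rmorph_sum (evalm g)). Qed.
Lemma evalGLC (g : GL S r) c : evalGL f c%:MP g = f c.
Proof.
rewrite evalGLE msuppC; case: eqVneq => [->|_]; first by rewrite big_nil rmorph0.
rewrite big_seq1 mcoeffC eqxx mulr1 big1 ?mulr1 // => i _.
by rewrite mnm0E expr0.
Qed.
Lemma evalGLX (g : GL S r) i : evalGL f 'X_i g = glvar g i.
Proof.
rewrite evalGLE msuppX big_seq1 mcoeffX eqxx rmorph1 mul1r (bigD1 i) //=.
rewrite mnm1E eqxx expr1 big1 ?mulr1 // => k ki.
by rewrite mnm1E eq_sym (negbTE ki) expr0.
Qed.

End Eval.

Lemma glinv_uniq (S : comPzRingType) r (g g' : GL S r) :
  g = g' :> 'M_r -> glinv g = glinv g'.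
Proof.
by move=> e; rewrite -[glinv g]mulmx1 -(glmxV g') mulmxA -e glVmx mul1mx.
Qed.

Lemma GL_eq (S : comPzRingType) r (g g' : GL S r) : g = g' :> 'M_r -> g = g'.
Proof.
move=> e; have := glinv_uniq e; case: g g' e => [g gi p p'] [h hi q q'] /= e e'.
by subst; congr GLMk; exact: Prop_irrelevance.
Qed.

Section EvalFunctor.
Context (A : comNzRingType) (S S' : comPzRingType) (r : nat).

Lemma evalGL_map (f : A -> S) (u : {rmorphism S -> S'}) h (g : GL S r) :
  evalGL (u \o f) h (glmap u g) = u (evalGL f h g).
Proof.
rewrite /evalGL; cbv zeta; rewrite [RHS]rmorph_sum; apply: eq_bigr => m _.
rewrite [RHS]rmorphM [X in _ = _ * X]rmorph_prod; congr (_ * _); apply: eq_bigr => i _.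
rewrite [RHS]rmorphXn; congr (_ ^+ _).
case: (glvarP i) => [k l|k].
  by rewrite !row_mxEl !mxvecE mxE.
by rewrite !row_mxEr !mxE /= det_map_mx rmorphMn.
Qed.

Lemma eq_evalGL (f f' : A -> S) h (g g' : GL S r) :
  f =1 f' -> g = g' :> 'M_r -> evalGL f h g = evalGL f' h g'.
Proof.
move=> ff' /GL_eq ->; rewrite /evalGL; cbv zeta; apply: eq_bigr => m _.
by rewrite ff'.
Qed.
End EvalFunctor.

(* Functions on a family of rings [S c] of the form
   [c |-> sum_k w_c(b_k) p_k(g'_c)], with [b_k], [p_k] independent of [c]. *)
Section Representable.
Context (A A' : comNzRingType) (B : comPzRingType) (r : nat) (Ctx : Type).
Context (S : Ctx -> comPzRingType).
Context (u : forall c, {rmorphism A -> S c}) (u' : forall c, {rmorphism A' -> S c}).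
Context (w : forall c, {rmorphism B -> S c}).
Context (g g' : forall c, GL (S c) r).
Local Notation n := (r * r + 1)%N.

Definition rep (t : forall c, S c) : Prop :=
  exists s : seq (B * {mpoly A'[n]}),
  forall c, t c = \sum_(p <- s) w c p.1 * evalGL (u' c) p.2 (g' c).

Lemma eq_rep t t' : (forall c, t c = t' c) -> rep t -> rep t'.
Proof. by move=> e [s sE]; exists s => c; rewrite -e. Qed.

Lemma repD t t' : rep t -> rep t' -> rep (fun c => t c + t' c).
Proof.
by move=> [s sE] [s' s'E]; exists (s ++ s') => c; rewrite sE s'E big_cat.
Qed.

Lemma repM t t' : rep t -> rep t' -> rep (fun c => t c * t' c).
Proof.
move=> [s sE] [s' s'E].
exists [seq (p.1 * p'.1, p.2 * p'.2) | p <- s, p' <- s'] => c.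
rewrite sE s'E big_allpairs_dep mulr_suml; apply: eq_bigr => p _.
rewrite mulr_sumr; apply: eq_bigr => p' _.
by rewrite rmorphM evalGLM mulrACA.
Qed.

Lemma rep_scalar b : rep (fun c => w c b).
Proof. by exists [:: (b, 1)] => c; rewrite big_seq1 evalGL1 mulr1. Qed.

Lemma rep_eval p : rep (fun c => evalGL (u' c) p (g' c)).
Proof. by exists [:: (1, p)] => c; rewrite big_seq1 rmorph1 mul1r. Qed.

Lemma rep0 : rep (fun c => 0).
Proof. by exists [::] => c; rewrite big_nil. Qed.
Lemma rep1 : rep (fun c => 1).
Proof. by apply: eq_rep (rep_scalar 1) => c; rewrite rmorph1. Qed.

Lemma rep_sum I (s : seq I) (t : I -> forall c, S c) :
  (forall i, rep (t i)) -> rep (fun c => \sum_(i <- s) t i c).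
Proof.
move=> rt; elim: s => [|i s IH]; first by apply: eq_rep rep0 => c; rewrite big_nil.
by apply: eq_rep (repD (rt i) IH) => c; rewrite big_cons.
Qed.

Lemma rep_prod I (s : seq I) (t : I -> forall c, S c) :
  (forall i, rep (t i)) -> rep (fun c => \prod_(i <- s) t i c).
Proof.
move=> rt; elim: s => [|i s IH]; first by apply: eq_rep rep1 => c; rewrite big_nil.
by apply: eq_rep (repM (rt i) IH) => c; rewrite big_cons.
Qed.

Lemma rep_sign k : rep (fun c => (-1) ^+ k).
Proof.
by apply: eq_rep (rep_scalar ((-1) ^+ k)) => c; rewrite rmorphXn rmorphN1.
Qed.

Lemma rep_det k (M : forall c, 'M[S c]_k) :
  (forall i j, rep (fun c => M c i j)) -> rep (fun c => \det (M c)).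
Proof.
move=> rM; apply: rep_sum => s; apply: repM; first exact: rep_sign.
by apply: rep_prod => i; exact: rM.
Qed.

(** Representable functions form a ring, so it is enough to treat the generators: constants, entries
    and the inverse determinant. *)
Lemma rep_poly : (forall a, rep (fun c => u c a)) ->
  (forall i j, rep (fun c => g c i j)) -> rep (fun c => \det (glinv (g c))) ->
  forall p, rep (fun c => evalGL (u c) p (g c)).
Proof.
move=> ra rg rd; apply: mpoly_alg_ind => [a|i|p q rp rq|p q rp rq].
- by apply: eq_rep (ra a) => c; rewrite evalGLC.
- case: (glvarP i) => [k l|k].
    by apply: eq_rep (rg k l) => c; rewrite evalGLX glvar_entry.
  by apply: eq_rep rd => c; rewrite evalGLX glvar_det.
- by apply: eq_rep (repD rp rq) => c; rewrite evalGLD.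
- by apply: eq_rep (repM rp rq) => c; rewrite evalGLM.
Qed.

Lemma rep_entry i j : rep (fun c => g' c i j).
Proof.
by apply: eq_rep (rep_eval 'X_(lshift 1 (mxvec_index i j))) => c;
  rewrite evalGLX glvar_entry.
Qed.
Lemma rep_detinv : rep (fun c => \det (glinv (g' c))).
Proof.
by apply: eq_rep (rep_eval 'X_(rshift (r * r) ord0)) => c;
  rewrite evalGLX glvar_det.
Qed.
End Representable.

Section Comultiplication.
Context (A A' : comNzRingType) (B : comPzRingType) (r : nat).
Local Notation n := (r * r + 1)%N.

(** A point of GL_r in an arbitrary ring under [A] and [B]. Taking all such points as the index set
    [Ctx] makes the expansion found below uniform in the ring. *)
Record mulr_ctx : Type := MulrCtx {
  mc_ring : comPzRingType;
  mc_w : {rmorphism B -> mc_ring};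
  mc_u : {rmorphism A -> mc_ring};
  mc_g : GL mc_ring r }.

(** The comultiplication of GL_r with the right factor specialised to [h]. The expansion [s]
    precedes the choice of the ring and of [g], because its values at two different points are
    compared later. *)
Lemma evalGL_mulr (p : {mpoly A[n]}) (h : GL B r) :
  exists s : seq (B * {mpoly A[n]}),
  forall (S : comPzRingType) (w : {rmorphism B -> S}) (u : {rmorphism A -> S})
    (g : GL S r),
  evalGL u p (glM g (glmap w h)) = \sum_(x <- s) w x.1 * evalGL u x.2 g.
Proof.
have [|i j||s sE] := @rep_poly A A B r mulr_ctx mc_ring mc_u mc_u mc_w
    (fun c => glM (mc_g c) (glmap (mc_w c) h)) mc_g _ _ _ p.
- move=> a; apply: eq_rep (rep_eval mc_u mc_w mc_g a%:MP) => c.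
  by rewrite evalGLC.
- apply: (@eq_rep _ _ _ _ _ _ _ _ (fun c => \sum_k mc_g c i k * mc_w c (h k j))).
    by move=> c; rewrite !mxE; apply: eq_bigr => k _; rewrite mxE.
  apply: rep_sum => k; apply: repM; first exact: rep_entry.
  exact: rep_scalar.
- apply: (@eq_rep _ _ _ _ _ _ _ _
      (fun c => mc_w c (\det (glinv h)) * \det (glinv (mc_g c)))).
    by move=> c; rewrite /= det_mulmx det_map_mx.
  by apply: repM; [exact: rep_scalar | exact: rep_detinv].
- by exists s => S w u g; exact: (sE (MulrCtx w u g)).
Qed.

Record mull_ctx : Type := MullCtx {
  mlc_ring : comPzRingType;
  mlc_w : {rmorphism B -> mlc_ring};
  mlc_u : {rmorphism A' -> mlc_ring};
  mlc_g : GL mlc_ring r }.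

(** The coefficients of [p] are carried along [k], which will be the inclusion of [E] or of [F] in
    [L], or the Frobenius of [E]. *)
Lemma evalGL_mull (k : {rmorphism A -> B}) (p : {mpoly A[n]}) (h : GL B r) :
  exists s : seq (B * {mpoly A'[n]}),
  forall (S : comPzRingType) (w : {rmorphism B -> S}) (u : {rmorphism A' -> S})
    (g : GL S r),
  evalGL (w \o k) p (glM (glmap w h) g) = \sum_(x <- s) w x.1 * evalGL u x.2 g.
Proof.
have [|i j||s sE] := @rep_poly A A' B r mull_ctx mlc_ring
    (fun c => mlc_w c \o k) mlc_u mlc_w
    (fun c => glM (glmap (mlc_w c) h) (mlc_g c)) mlc_g _ _ _ p.
- by move=> a; apply: eq_rep (rep_scalar mlc_u mlc_w mlc_g (k a)).
- apply: (@eq_rep _ _ _ _ _ _ _ _ (fun c => \sum_k mlc_w c (h i k) * mlc_g c k j)).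
    by move=> c; rewrite !mxE; apply: eq_bigr => l _; rewrite mxE.
  apply: rep_sum => l; apply: repM; last exact: rep_entry.
  exact: rep_scalar.
- apply: (@eq_rep _ _ _ _ _ _ _ _
      (fun c => \det (glinv (mlc_g c)) * mlc_w c (\det (glinv h)))).
    by move=> c; rewrite /= det_mulmx det_map_mx.
  by apply: repM; [exact: rep_detinv | exact: rep_scalar].
- by exists s => S w u g; exact: (sE (MullCtx w u g)).
Qed.
End Comultiplication.

Section Antipode.
Context (A : comNzRingType) (r : nat).
Local Notation n := (r * r + 1)%N.

Record invctx : Type := InvCtx {
  ic_ring : comPzRingType;
  ic_u : {rmorphism A -> ic_ring};
  ic_g : GL ic_ring r }.

(** Cramer's rule, with the inverse of the determinant given by the last coordinate; it makes the
    inverse matrix polynomial in the coordinates. *)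
Lemma glinvE (S : comPzRingType) (g : GL S r) :
  glinv g = \det (glinv g) *: \adj g.
Proof.
rewrite -[RHS]mulmx1 -(glmxV g) mulmxA -scalemxAl mul_adj_mx scale_scalar_mx.
by rewrite -det_mulmx glVmx det1 mul1mx.
Qed.

Lemma evalGL_inv (p : {mpoly A[n]}) :
  exists q : {mpoly A[n]},
  forall (S : comPzRingType) (u : {rmorphism A -> S}) (g : GL S r),
  evalGL u q g = evalGL u p (glV g).
Proof.
have [|i j||s sE] := @rep_poly A A A r invctx ic_ring ic_u ic_u ic_u
    (fun c => glV (ic_g c)) ic_g _ _ _ p.
- by move=> a; apply: eq_rep (rep_scalar ic_u ic_u ic_g a).
- apply: (@eq_rep _ _ _ _ _ _ _ _
      (fun c => \det (glinv (ic_g c)) * cofactor (ic_g c) j i)).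
    by move=> c; rewrite /= [in RHS]glinvE !mxE.
  apply: repM; first exact: rep_detinv.
  apply: repM; first exact: rep_sign.
  by apply: rep_det => k l; apply: eq_rep (rep_entry ic_u ic_u ic_g (lift j k) (lift i l)) => c; rewrite !mxE.
- by apply: rep_det => k l; exact: rep_entry.
- exists (\sum_(x <- s) x.1%:MP * x.2) => S u g.
  rewrite (sE (InvCtx u g)) evalGL_sum; apply: eq_bigr => x _.
  by rewrite evalGLM evalGLC.
Qed.
End Antipode.


(** * The group scheme Gamma *)

Record simple_tower (T : frobTower) : Prop := SimpleTower {
  st_F : fieldlike (tF T);
  st_E : fieldlike (tE T);
  st_fix : forall x, tsL T x = x -> exists a, tFL T a = x;
  st_simple : forall x, x != 0 -> exists m (a : 'I_m -> tL T),
    \sum_i a i * iter i (tsL T) x = 1 }.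

Lemma fieldlike_inj (R : comNzRingType) (S : comNzRingType) (f : {rmorphism R -> S}) :
  fieldlike R -> injective f.
Proof.
move=> Rf x y e; apply/eqP; rewrite -subr_eq0; apply: contrapT => /negP/Rf[z zE].
have := congr1 f zE; rewrite rmorphM rmorphB e subrr mulr0 rmorph1.
by move/eqP; rewrite eq_sym oner_eq0.
Qed.

Lemma sum_seq_ord (V : nmodType) I (d : I) (s : seq I) (G : I -> V) :
  \sum_(p <- s) G p = \sum_(i < size s) G (nth d s i).
Proof. by rewrite (big_nth d) big_mkord. Qed.

Lemma glKmx (S : comPzRingType) r m (g : GL S r) :
  cancel (mulmx (g : 'M_(r, r)) : 'M_(r, m) -> 'M_(r, m)) (mulmx (glinv g)).
Proof. by move=> X; rewrite mulmxA glVmx mul1mx. Qed.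

Lemma glVKmx (S : comPzRingType) r m (g : GL S r) :
  cancel (mulmx (glinv g) : 'M_(r, m) -> 'M_(r, m)) (mulmx (g : 'M_(r, r))).
Proof. by move=> X; rewrite mulmxA glmxV mul1mx. Qed.

Section TowerAlgebra.
Context (T : frobTower) (gT : simple_tower T).
Local Notation F := (tF T).
Local Notation E := (tE T).
Local Notation L := (tL T).
Local Notation EL := (tEL T).
Local Notation FL := (tFL T).
Local Notation LL := (tensR EL EL).

Lemma vL_linear (N : phiMod T) a (x y : VM N) : vL (a *: x + y) = FL a *: vL x + vL y.
Proof. by []. Qed.
Lemma vLD (N : phiMod T) : {morph @vL T N : x y / x + y}. Proof. by []. Qed.
Lemma vLZ (N : phiMod T) a (x : VM N) : vL (a *: x) = FL a *: vL x. Proof. by []. Qed.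
Lemma vL0 (N : phiMod T) : vL (0 : VM N) = 0. Proof. by []. Qed.
Lemma vL_inj (N : phiMod T) : injective (@vL T N). Proof. exact: val_inj. Qed.
Lemma vL_sum (N : phiMod T) I (s : seq I) (P : pred I) (f : I -> VM N) :
  vL (\sum_(i <- s | P i) f i) = \sum_(i <- s | P i) vL (f i).
Proof. exact: (big_morph (@vL T N) (@vLD N) (vL0 N)). Qed.

(** Equivalently, L (x)_F V(N) -> L (x)_E N is injective, for every phi-module [N]. *)
Lemma vL_lfree (N : phiMod T) n (w : 'I_n -> VM N) : lfree w -> lfree (fun i => vL (w i)).
Proof.
move=> fw; apply: (fixed_lfree (st_fix gT) (st_simple gT) (@phiLD T N) (@phiLZ T N)).
- by move=> i; exact: vLP.
- exact: rmorph0.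
- by move=> c e; apply: fw; apply: vL_inj; rewrite vL_sum.
Qed.

(** Along an [F]-independent subfamily the coefficients over [L] are unique. Both [v] and the family
    are fixed by phi, so the coefficients are fixed by sigma and come from [F]. *)
Lemma vL_span (N : phiMod T) n (u : 'I_n -> VM N) (v : VM N) :
  lspan (fun i => vL (u i)) (vL v) -> lspan u v.
Proof.
move=> [l vE]; have [m [f [fr sp]]] := basis_extract (st_F gT) u.
have : lspan (fun k => vL ((u \o f) k)) (vL v).
  rewrite vE; apply: lspan_sum => i; have [c ->] := sp i.
  by exists (fun k => FL (c k)); rewrite vL_sum.
move=> [c {l}vE].
have : \sum_k tsL T (c k) *: vL ((u \o f) k) = \sum_k c k *: vL ((u \o f) k).
  rewrite -vE -[RHS]vLP vE (big_morph _ (@phiLD T N) (@phiL0 T N)).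
  by apply: eq_bigr => k _; rewrite phiLZ vLP.
move=> /(lfree_eq (vL_lfree fr)) cs.
have /choice[d dE] k := st_fix gT (cs k).
have -> : v = \sum_k d k *: (u \o f) k.
  by apply: vL_inj; rewrite vE vL_sum; apply: eq_bigr => k _; rewrite -dE.
by apply: lspan_sum => k; exact: lspan_mem.
Qed.

Definition sLL_l : {rmorphism L -> LL} := inl_t EL EL \o tsL T.
Definition sLL_r : {rmorphism L -> LL} := inr_t EL EL \o tsL T.
Fact sLL_compat x : sLL_l (EL x) = sLL_r (EL x).
Proof. by rewrite /= tsEL inlr_t. Qed.
Definition sLL : {rmorphism LL -> LL} := tensR_desc sLL_compat.

Lemma sLL_inl l : sLL (inl_t EL EL l) = inl_t EL EL (tsL T l).
Proof. by rewrite /sLL /= tensR_desc_mk /= rmorph1 mulr1. Qed.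
Lemma sLL_inr l : sLL (inr_t EL EL l) = inr_t EL EL (tsL T l).
Proof. by rewrite /sLL /= tensR_desc_mk /= rmorph1 mul1r. Qed.

Section Group.
Context (r : nat) (Phi : GL E r) (Psi : GL L r).
Context (Psi_Phi : map_mx (tsL T) Psi = map_mx EL Phi *m Psi).
Local Notation n := (r * r + 1)%N.
Local Notation inl_LL := (inl_t EL EL).
Local Notation inr_LL := (inr_t EL EL).

(** Frobenius multiplies [Psi] by [Phi] in both factors, and the two copies of [Phi] agree in L
    (x)_E L because its entries are in [E]; hence they cancel. *)
Lemma sLL_PsiPsi i j : sLL (PsiPsi Psi i j) = PsiPsi Psi i j.
Proof.
suff {i j} : map_mx sLL (PsiPsi Psi) = PsiPsi Psi by move/matrixP => /(_ i j); rewrite mxE.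
have el : map_mx sLL (map_mx inl_LL Psi) = map_mx (inl_LL \o EL) Phi *m map_mx inl_LL Psi.
  rewrite map_mx_comp -map_mxM -Psi_Phi -!map_mx_comp; apply/matrixP => k l.
  by rewrite !mxE /= sLL_inl.
have er : map_mx sLL (map_mx inr_LL Psi) = map_mx (inl_LL \o EL) Phi *m map_mx inr_LL Psi.
  have -> : map_mx (inl_LL \o EL) Phi = map_mx (inr_LL \o EL) Phi.
    by apply/matrixP => k l; rewrite !mxE /= inlr_t.
  rewrite map_mx_comp -map_mxM -Psi_Phi -!map_mx_comp; apply/matrixP => k l.
  by rewrite !mxE /= sLL_inr.
have eP : map_mx inl_LL Psi *m PsiPsi Psi = map_mx inr_LL Psi.
  exact: (glVKmx (glmap inl_LL Psi)).
pose G := glM (glmap (inl_LL \o EL) Phi) (glmap inl_LL Psi).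
apply: (can_inj (glKmx G)) => /=.
by rewrite -[in LHS]el -map_mxM eP er -mulmxA eP.
Qed.

(** The same matrix as [Psi_act], but for any point of GL_r, so that stability can be stated before
    [g] is known to be in Gamma. *)
Definition actGL (R : comPzRingType) (a : {rmorphism F -> R}) (g : GL R r) : GL (RL a) r :=
  glM (glmap (inr_t a FL) Psi) (glmap (inl_t a FL) g).

Lemma evalGL_fixed (p : {mpoly F[n]}) :
  sLL (evalGL (inl_LL \o FL) p (PsiPsi Psi)) = evalGL (inl_LL \o FL) p (PsiPsi Psi).
Proof.
rewrite -evalGL_map; apply: eq_evalGL => [x|].
  by rewrite /= sLL_inl; congr (inl_LL _); rewrite tsEL tsFE.
by apply/matrixP => i j; rewrite mxE sLL_PsiPsi.
Qed.

(* The entries of [Psi^-1 (x) 1 * 1 (x) Psi] are fixed by [sigma (x) sigma]; hence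
   the [L]-linear relations between polynomials in them are spanned by the
   [F]-linear ones, which [g] satisfies. *)
Lemma Gamma_relation (R : comPzRingType) (a : {rmorphism F -> R}) (g : Gamma Psi a)
    k (l : 'I_k -> L) (p : 'I_k -> {mpoly F[n]}) :
  \sum_i inl_LL (l i) * evalGL (inl_LL \o FL) (p i) (PsiPsi Psi) = 0 ->
  \sum_i inr_t a FL (l i) * inl_t a FL (evalGL a (p i) g) = 0.
Proof.
move=> e.
pose W := restr LL^o (inl_LL \o FL).
pose u i : W := evalGL (inl_LL \o FL) (p i) (PsiPsi Psi).
have [m [f [fr /choice[c cE]]]] := basis_extract (st_F gT) u.
pose A := restr LL^o inl_LL.
have frL : lfree (fun j => u (f j) : A).
  apply: (fixed_lfree (st_fix gT) (st_simple gT) (phi := sLL : A -> A)).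
  - exact: rmorphD.
  - by move=> x y; rewrite /= !restr_scaleE [LHS]rmorphM /= sLL_inl.
  - by move=> i; exact: evalGL_fixed.
  - exact: rmorph0.
  - move=> d de; apply: fr; rewrite -[RHS]de.
    by apply: eq_bigr => i _; rewrite !restr_scaleE.
have qP i : in_q Psi (p i - \sum_j (c i j)%:MP * p (f j)).
  rewrite /in_q evalGLD evalGLN evalGL_sum; apply/eqP; rewrite subr_eq0; apply/eqP.
  rewrite -[LHS]/(u i) cE; apply: eq_bigr => j _.
  by rewrite evalGLM evalGLC restr_scaleE.
have pE i : evalGL a (p i) g = \sum_j a (c i j) * evalGL a (p (f j)) g.
  have := gamP g (qP i); rewrite evalGLD evalGLN evalGL_sum => /eqP.
  rewrite subr_eq0 => /eqP ->; apply: eq_bigr => j _.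
  by rewrite evalGLM evalGLC.
have z j : \sum_i l i * FL (c i j) = 0.
  move: j; apply: frL; rewrite -[RHS]e.
  under eq_bigr do rewrite scaler_suml.
  rewrite exchange_big; apply: eq_bigr => i _ /=.
  rewrite -[evalGL _ _ _]/(u i) cE [RHS]mulr_sumr; apply: eq_bigr => j _.
  rewrite !restr_scaleE /= -[_ *: _]/(_ * _) -[X in _ = _ * X]/(_ * _).
  by rewrite rmorphM mulrA.
under eq_bigr => i _ do rewrite pE rmorph_sum mulr_sumr.
rewrite exchange_big big1 //= => j _.
transitivity (inr_t a FL (\sum_i l i * FL (c i j)) * inl_t a FL (evalGL a (p (f j)) g)).
  rewrite rmorph_sum mulr_suml; apply: eq_bigr => i _.
  rewrite [in LHS]rmorphM [in RHS]rmorphM mulrA; congr (_ * _ * _).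
  exact: inlr_t.
by rewrite z rmorph0 mul0r.
Qed.

(** From 1 (x) Psi = (Psi (x) 1) Z, the equation h(1 (x) Psi) = 0 expands into an [L]-linear
    relation between polynomials in Z. By [Gamma_relation] it persists when Z is replaced by [g],
    and then it reads h(Psi g) = 0. *)
Lemma Gamma_stable (R : comPzRingType) (a : {rmorphism F -> R}) (g : Gamma Psi a)
    (h : {mpoly E[n]}) :
  evalGL EL h Psi = 0 -> evalGL (E_RL a) h (actGL a g) = 0.
Proof.
move=> h0; have [s sE] := @evalGL_mull E F L r EL h Psi.
have e1 := sE LL inl_LL (inl_LL \o FL) (PsiPsi Psi).
have e2 := sE (RL a) (inr_t a FL) (inr_t a FL \o FL) (glmap (inl_t a FL) g).
rewrite [LHS]e2 (sum_seq_ord (0, 0)).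
rewrite -[RHS](@Gamma_relation R a g (size s) (fun i => (nth (0, 0) s i).1)
  (fun i => (nth (0, 0) s i).2)).
  apply: eq_bigr => i _; congr (_ * _).
  by rewrite -evalGL_map; apply: eq_evalGL => // x; rewrite /= inlr_t.
rewrite -(sum_seq_ord (0, 0) s (fun p => inl_LL p.1 * evalGL (inl_LL \o FL) p.2 (PsiPsi Psi))).
rewrite -e1 -[RHS](rmorph0 inr_LL) -h0 -evalGL_map; apply: eq_evalGL.
  by move=> x; rewrite /= inlr_t.
exact: (glVKmx (glmap inl_LL Psi)).
Qed.

Definition stable (R : comPzRingType) (a : {rmorphism F -> R}) (g : GL R r) :=
  forall h : {mpoly E[n]}, evalGL EL h Psi = 0 -> evalGL (E_RL a) h (actGL a g) = 0.

(** Stability concerns relations inside Sigma; this extends it to relations with coefficients in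
    [Y]. Once the [l i] are written in a basis over the field [B'], each coordinate of the relation
    is the vanishing of one polynomial over [E] at [Psi]. It is applied with [Y] over [B'] being [L]
    over [E] and [R] over [F]. *)
Lemma stable_tensor (R : comPzRingType) (a : {rmorphism F -> R}) (g : GL R r)
    (Y : comPzRingType) (B' : comNzRingType) (B'f : fieldlike B')
    (k : {rmorphism B' -> E}) (y : {rmorphism B' -> Y}) (z : {rmorphism B' -> L})
    (psi : {rmorphism Y -> RL a}) : stable a g ->
  (forall b, z b = EL (k b)) -> (forall b, psi (y b) = E_RL a (k b)) ->
  forall m (l : 'I_m -> Y) (h : 'I_m -> {mpoly E[n]}),
  \sum_i tmk y z (l i) (evalGL EL (h i) Psi) = 0 ->
  \sum_i psi (l i) * evalGL (E_RL a) (h i) (actGL a g) = 0.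
Proof.
move=> stg zk psik m l h e.
have [m' [f [fr /choice[c cE]]]] := basis_extract B'f (l : _ -> restr Y^o y).
have lE i : l i = \sum_j y (c i j) * l (f j).
  by rewrite -[LHS]/(l i : restr Y^o y) cE.
have e' : \sum_j @tpure _ (restr Y^o y) (restr L^o z) (l (f j))
    (\sum_i z (c i j) * evalGL EL (h i) Psi) = 0.
  rewrite -[RHS]e.
  under eq_bigr => j _ do rewrite (@tpure_sumr _ (restr Y^o y) (restr L^o z)).
  rewrite exchange_big; apply: eq_bigr => i _ /=.
  rewrite [in RHS]cE [RHS](@tpure_suml _ (restr Y^o y) (restr L^o z)).
  by apply: eq_bigr => j _; rewrite tpureZ.
have {}e' j := tens_freel B'f fr e' j.
have {}e' j : \sum_i E_RL a (k (c i j)) * evalGL (E_RL a) (h i) (actGL a g) = 0.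
  have h0 : evalGL (E_RL a) (\sum_i (k (c i j))%:MP * h i) (actGL a g) = 0.
    apply: stg; rewrite evalGL_sum -[RHS](e' j); apply: eq_bigr => i _.
    by rewrite evalGLM evalGLC zk.
  rewrite -[RHS]h0 evalGL_sum; apply: eq_bigr => i _.
  by rewrite evalGLM evalGLC.
under eq_bigr => i _ do rewrite lE rmorph_sum mulr_suml.
rewrite exchange_big big1 //= => j _.
transitivity (psi (l (f j)) *
    \sum_i E_RL a (k (c i j)) * evalGL (E_RL a) (h i) (actGL a g)); last first.
  by rewrite e' mulr0.
rewrite mulr_sumr; apply: eq_bigr => i _.
by rewrite rmorphM psik mulrA [psi _ * _]mulrC.
Qed.

End Group.
End TowerAlgebra.

Section GroupScheme.
Context (T : frobTower) (gT : simple_tower T).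
Local Notation F := (tF T).
Local Notation E := (tE T).
Local Notation L := (tL T).
Local Notation EL := (tEL T).
Local Notation FL := (tFL T).
Local Notation LL := (tensR EL EL).

Section ScalarExtension.
Context (R : comPzRingType) (a : {rmorphism F -> R}).
Local Notation inl_RL := (inl_t a FL).
Local Notation inr_RL := (inr_t a FL).

Lemma FL_inj : injective FL.
Proof. exact: fieldlike_inj (st_F gT). Qed.

Lemma inl_RL_inj (x : R) : inl_RL x = 0 -> x = 0.
Proof.
move=> e; have fr : @lfree F (restr L^o FL) 1 (fun=> 1).
  move=> c; rewrite big_ord1 => c0 i; rewrite ord1; apply: FL_inj.
  by rewrite rmorph0 -[RHS]c0 restr_scaleE -[RHS]/(_ * _) mulr1.
apply: (@tens_freer _ (st_F gT) (restr R^o a) (restr L^o FL) 1 (fun=> x) _ fr _ ord0).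
by rewrite big_ord1.
Qed.

Definition sRL_r : {rmorphism L -> RL a} := inr_RL \o tsL T.
Fact sRL_compat x : inl_RL (a x) = sRL_r (FL x).
Proof. by rewrite inlr_t /= tsEL tsFE. Qed.
Definition sRL : {rmorphism RL a -> RL a} := tensR_desc sRL_compat.

Lemma sRL_mk x l : sRL (tmk a FL x l) = tmk a FL x (tsL T l).
Proof. by rewrite /sRL /= tensR_desc_mk /= tmkM mulr1 mul1r. Qed.
Lemma sRL_inl x : sRL (inl_RL x) = inl_RL x.
Proof. by rewrite sRL_mk rmorph1. Qed.
Lemma sRL_inr l : sRL (inr_RL l) = inr_RL (tsL T l).
Proof. exact: sRL_mk. Qed.

(** With [F]-independent entries on the left, a fixed tensor has every right entry fixed by sigma,
    hence in [F], and these scalars move to the left. *)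
Lemma sRL_fixed x : sRL x = x -> exists y, inl_RL y = x.
Proof.
have [n [b [l [fb ->]]]] := tens_reprl (st_F gT) (x : tensor (restr R^o a) (restr L^o FL)).
move=> e.
have {}e : \sum_i @tpure _ (restr R^o a) (restr L^o FL) (b i) (tsL T (l i) - l i) = 0.
  under eq_bigr => i _ do rewrite tpureDr -[- l i]scaleN1r tpureZr scaleN1r.
  rewrite sumrB; apply/eqP; rewrite subr_eq0; apply/eqP.
  rewrite -[RHS]e [RHS](rmorph_sum sRL); apply: eq_bigr => i _.
  by rewrite [RHS]sRL_mk.
have lf i : tsL T (l i) = l i.
  by apply/eqP; rewrite -subr_eq0; apply/eqP; exact: (tens_freel (st_F gT) fb e).
have /choice[d dE] i := st_fix gT (lf i).
exists (\sum_i a (d i) * b i); rewrite rmorph_sum; apply: eq_bigr => i _.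
apply: etrans (tmkZ a FL (d i) (b i) 1) _.
by rewrite mulr1 dE.
Qed.

End ScalarExtension.

Context (r : nat) (Phi : GL E r) (Psi : GL L r).
Context (Psi_Phi : map_mx (tsL T) Psi = map_mx EL Phi *m Psi).
Local Notation n := (r * r + 1)%N.

Lemma evalGL_inr (R : comPzRingType) (a : {rmorphism F -> R}) (h : {mpoly E[n]}) :
  evalGL (E_RL a) h (glmap (inr_t a FL) Psi) = inr_t a FL (evalGL EL h Psi).
Proof. exact: evalGL_map. Qed.

(** The converse of [Gamma_stable], from g = Psi^-1 (Psi g). Expanding p(Psi^-1 U) gives terms l_i
    h_i(U); p(Z) = 0 is the vanishing of the sum of the l_i (x) h_i(Psi) in L (x)_E L, and stability
    turns it into the vanishing of p(g). *)
Lemma stable_Gamma (R : comPzRingType) (a : {rmorphism F -> R}) (g : GL R r) :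
  stable Psi a g -> forall p : {mpoly F[n]}, in_q Psi p -> evalGL a p g = 0.
Proof.
move=> stg p qp; have [s sE] := @evalGL_mull F E L r FL p (glV Psi).
have e1 := sE LL (inl_t EL EL) (inr_t EL EL \o EL) (glmap (inr_t EL EL) Psi).
have e2 := sE (RL a) (inr_t a FL) (E_RL a) (actGL Psi a g).
apply: (@inl_RL_inj _ a); rewrite -evalGL_map.
transitivity (evalGL (inr_t a FL \o FL) p
    (glM (glmap (inr_t a FL) (glV Psi)) (actGL Psi a g))).
  apply: eq_evalGL => [x|]; first by rewrite /= inlr_t.
  exact/esym/(glKmx (glmap (inr_t a FL) Psi)).
rewrite e2 (sum_seq_ord (0, 0)).
apply: (@stable_tensor T r Psi R a g L E (st_E gT) idfun EL EL (inr_t a FL)) => //.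
rewrite -[RHS]qp.
transitivity (evalGL (inl_t EL EL \o FL) p
    (glM (glmap (inl_t EL EL) (glV Psi)) (glmap (inr_t EL EL) Psi))).
  rewrite e1 (sum_seq_ord (0, 0)); apply: eq_bigr => i _.
  by rewrite evalGL_map tmkM mulr1 mul1r.
exact: eq_evalGL.
Qed.

Lemma Gamma_of_stable (R : comPzRingType) (a : {rmorphism F -> R}) (g : GL R r) :
  stable Psi a g -> exists g' : Gamma Psi a, g' = g :> GL R r.
Proof. by move=> st; exists (GammaMk (stable_Gamma st)). Qed.

Definition gl1 (S : comPzRingType) : GL S r :=
  GLMk (mulmx1 1%:M : (1%:M : 'M[S]_r) *m 1%:M = 1%:M) (mulmx1 1%:M).

(** The unit and products are obtained from the criterion [stable], which is visibly multiplicative;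
    inverses come from a symmetry of L (x)_E L instead. *)
Lemma Gamma_subgroupP : Gamma_subgroup Psi.
Proof.
move=> R a; split.
- suff st : stable Psi a (gl1 R).
    by have [g gE] := Gamma_of_stable st; exists g; rewrite gE.
  move=> h h0; transitivity (inr_t a FL (evalGL EL h Psi)); last by rewrite h0 rmorph0.
  rewrite -evalGL_inr.
  by apply: eq_evalGL => //=; rewrite map_mx1 mulmx1.
- move=> g h; suff st : stable Psi a (glM g h).
    by have [gh e] := Gamma_of_stable st; exists gh; rewrite e.
  move=> p p0; have [s sE] := evalGL_mulr p h.
  have e1 := sE (RL a) (inl_t a FL) (E_RL a) (glmap (inr_t a FL) Psi).
  have e2 := sE (RL a) (inl_t a FL) (E_RL a) (actGL Psi a g).
  transitivity (evalGL (E_RL a) p (glM (actGL Psi a g) (glmap (inl_t a FL) h))).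
    by apply: eq_evalGL => //=; rewrite map_mxM mulmxA.
  rewrite e2 (sum_seq_ord (0, 0)).
  (* Stability under [h] gives p(Psi h) = 0, a relation between elements of Sigma with coefficients
     in [R]; stability under [g] then replaces [Psi] by Psi g in it. *)
  apply: (@stable_tensor T r Psi R a g R F (st_F gT) (tFE T) a FL (inl_t a FL)).
  + exact: (Gamma_stable gT Psi_Phi).
  + by [].
  + by move=> b; exact: inlr_t.
  + rewrite -[RHS](Gamma_stable gT Psi_Phi h p0) [RHS]e1 (sum_seq_ord (0, 0)).
    apply: eq_bigr => i _.
    by rewrite evalGL_inr tmkM mulr1 mul1r.
- move=> g; suff gP p : in_q Psi p -> evalGL a p (glV g) = 0.
    by exists (GammaMk gP).
  move=> qp; have [q qE] := evalGL_inv p.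
  rewrite -qE; apply: gamP; rewrite /in_q qE.
  have swc x : inr_t EL EL (EL x) = inl_t EL EL (EL x) by rewrite inlr_t.
  (* The flip of the two factors exchanges Z and Z^-1, so the ideal q is preserved by the
     antipode. *)
  pose sw : {rmorphism LL -> LL} := tensR_desc swc.
  have swl x : sw (inl_t EL EL x) = inr_t EL EL x.
    by rewrite /sw /= tensR_desc_mk rmorph1 mulr1.
  have swr x : sw (inr_t EL EL x) = inl_t EL EL x.
    by rewrite /sw /= tensR_desc_mk rmorph1 mul1r.
  rewrite -[RHS](rmorph0 sw) -[in RHS]qp -evalGL_map; apply: eq_evalGL.
    by move=> x; rewrite /= swl inlr_t.
  rewrite /= map_mxM /= -!map_mx_comp.
  by congr (_ *m _); apply/matrixP => i j; rewrite !mxE /= ?swl ?swr.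
Qed.
End GroupScheme.


(** * Phi-modules and their solutions *)

Lemma basis_coord (R : comNzRingType) (V : lmodType R) m (b : 'I_m -> V) :
  lfree b -> (forall x, lspan b x) ->
  exists d : 'I_m -> {linear V -> R^o},
    (forall x, x = \sum_i (d i x : R) *: b i) /\ forall i k, d i (b k) = (k == i)%:R.
Proof.
move=> fb /choice[c cE].
have /choice[d dE] i : exists d : {linear V -> R^o}, forall x, d x = c x i.
  have [|d dE] := @linear_pack R V (fun x => c x i); last by exists d.
  move=> a x y; apply: (lfree_eq (c := c (a *: x + y))
    (c' := fun i => a * c x i + c y i) fb).
  rewrite -cE; under eq_bigr do rewrite scalerDl -scalerA.
  by rewrite big_split -scaler_sumr -!cE.
have e x : x = \sum_i (d i x : R) *: b i.
  by rewrite {1}[x]cE; apply: eq_bigr => i _; rewrite dE.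
exists d; split=> // i k.
have := lfree_eq (c := fun j => d j (b k)) (c' := fun j => (k == j)%:R) fb.
apply; rewrite -e (bigD1 k) //= eqxx scale1r big1 ?addr0 // => j.
by rewrite eq_sym => /negbTE ->; rewrite scale0r.
Qed.

Lemma lspan_union (R : pzRingType) (V : lmodType R) (I : Type) (u : I -> V)
    k (x : 'I_k -> V) :
  (forall i, exists m (w : 'I_m -> I), lspan (fun j => u (w j)) (x i)) ->
  exists m (w : 'I_m -> I), forall i, lspan (fun j => u (w j)) (x i).
Proof.
move=> h; have /choice[p pE] i : exists p : {m & 'I_m -> I},
    lspan (fun j => u (projT2 p j)) (x i).
  by have [m [w wE]] := h i; exists (existT _ m w).
pose J : finType := {i : 'I_k & 'I_(projT1 (p i))}.
pose w (t : J) := projT2 (p (tag t)) (tagged t).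
exists #|J|, (fun l : 'I_#|J| => w (enum_val l)) => i.
have [c ->] := pE i; apply: lspan_sum => j.
pose t : J := Tagged (fun i => 'I_(projT1 (p i))) j.
have := lspan_mem (fun l : 'I_#|J| => u (w (enum_val l))) (enum_rank t).
by rewrite enum_rankK.
Qed.

Lemma lspanD (R : pzRingType) (V : lmodType R) n (b : 'I_n -> V) x y :
  lspan b x -> lspan b y -> lspan b (x + y).
Proof.
move=> [c ->] [d ->]; exists (fun i => c i + d i).
by under [RHS]eq_bigr do rewrite scalerDl; rewrite big_split.
Qed.
Lemma lspanZ (R : pzRingType) (V : lmodType R) n (b : 'I_n -> V) a x :
  lspan b x -> lspan b (a *: x).
Proof.
move=> [c ->]; exists (fun i => a * c i).
by rewrite scaler_sumr; apply: eq_bigr => i _; rewrite scalerA.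
Qed.
Lemma lspan0 (R : pzRingType) (V : lmodType R) n (b : 'I_n -> V) : lspan b 0.
Proof. by exists (fun=> 0); rewrite big1 // => i _; rewrite scale0r. Qed.

Lemma blift_sum (R A : comPzRingType) (f : {rmorphism R -> A}) (V : lmodType R)
    (Z : zmodType) (h : A -> V -> Z) (bh : bbalanced f h) I (s : seq I)
    (x : I -> baseChange f V) :
  blift f h (\sum_(i <- s) x i) = \sum_(i <- s) blift f h (x i).
Proof. exact: (big_morph (blift f h) (bliftD bh) (blift0 bh)). Qed.

Lemma is_basis_span (R : nzRingType) (V : lmodType R) n (e : 'I_n -> V) :
  is_basis e -> forall x, lspan e x.
Proof. by move=> eB x; have [c [-> _]] := eB x; exists (fun i => c 0 i). Qed.

Lemma is_basis_free (R : nzRingType) (V : lmodType R) n (e : 'I_n -> V) :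
  is_basis e -> lfree e.
Proof.
move=> eB c c0 i; have [d [_ du]] := eB 0.
have h1 : d = \row_i c i.
  by apply: du; rewrite -[LHS]c0; apply: eq_bigr => j _; rewrite mxE.
have h2 : d = 0 by apply: du; rewrite big1 // => j _; rewrite mxE scale0r.
have : \row_i c i = 0 :> 'rV_n by rewrite -h1.
by move/rowP/(_ i); rewrite !mxE.
Qed.

Section PhiMaps.
Context (T : frobTower).
Local Notation F := (tF T).
Local Notation E := (tE T).
Local Notation L := (tL T).
Local Notation EL := (tEL T).
Local Notation FL := (tFL T).

Definition mkLin (R : pzRingType) (V W : lmodType R) (f : V -> W)
    (fl : forall a x y, f (a *: x + y) = a *: f x + f y) : {linear V -> W} :=
  HB.pack f (GRing.isLinear.Build R V W *:%R f (fun a x y => fl a x y)).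

Definition mkHom (N N' : phiMod T) (f : N -> N')
    (fl : forall a x y, f (a *: x + y) = a *: f x + f y)
    (fp : forall x, f (pphi N x) = pphi N' (f x)) : phiHom N N' :=
  @PhiHom T N N' (mkLin fl) fp.

Definition one_t (N : phiMod T) (x : N) : LM N := bmk EL 1 x.

Lemma bmk_one (N : phiMod T) l (x : N) : bmk EL l x = l *: one_t x.
Proof. by rewrite /one_t bmkZl mulr1. Qed.
Lemma one_tD (N : phiMod T) (x y : N) : one_t (x + y) = one_t x + one_t y.
Proof. exact: bmkDr. Qed.
Lemma one_tZ (N : phiMod T) a (x : N) : one_t (a *: x) = EL a *: one_t x.
Proof. by rewrite /one_t -bmkZ bmkZl. Qed.
Lemma one_t0 (N : phiMod T) : one_t (0 : N) = 0.
Proof. by rewrite -[0 in LHS](scale0r (0 : N)) one_tZ rmorph0 scale0r. Qed.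
Lemma one_t_sum (N : phiMod T) I (s : seq I) (P : pred I) (f : I -> N) :
  one_t (\sum_(i <- s | P i) f i) = \sum_(i <- s | P i) one_t (f i).
Proof. exact: (big_morph (@one_t N) (@one_tD N) (one_t0 N)). Qed.

Lemma phiL_one (N : phiMod T) (x : N) : phiL (one_t x) = one_t (pphi N x).
Proof. by rewrite phiL_mk rmorph1. Qed.

Lemma LM_ind (N : phiMod T) (P : LM N -> Prop) :
  P 0 -> (forall x y, P x -> P y -> P (x + y)) ->
  (forall l x, P x -> P (l *: x)) -> (forall x, P (one_t x)) -> forall x, P x.
Proof.
move=> P0 PD PZ P1; apply: (@baseChange_ind _ _ EL N) => // l x.
by rewrite bmk_one; exact: PZ.
Qed.

Section Functoriality.
Context (N N' : phiMod T) (f : phiHom N N').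

Lemma LMmap_one x : LMmap f (one_t x) = one_t (f x).
Proof. exact: (blift_mk (LMmap_bal f)). Qed.
Lemma LMmapD : {morph LMmap f : x y / x + y}.
Proof. exact: (bliftD (LMmap_bal f)). Qed.
Lemma LMmap0 : LMmap f 0 = 0.
Proof. exact: (blift0 (LMmap_bal f)). Qed.
Lemma LMmapZ l x : LMmap f (l *: x) = l *: LMmap f x.
Proof.
elim/(@baseChange_ind _ _ EL N): x => [|l' x|x y IHx IHy].
- by rewrite !(scaler0, LMmap0).
- by rewrite bmkZl /LMmap !(blift_mk (LMmap_bal f)) bmkZl.
- by rewrite scalerDr !LMmapD IHx IHy scalerDr.
Qed.
Lemma vL_Vmap v : vL (Vmap f v) = LMmap f (vL v). Proof. by []. Qed.
Lemma Vmap_linear a x y : Vmap f (a *: x + y) = a *: Vmap f x + Vmap f y.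
Proof. by apply: vL_inj; rewrite !(vL_Vmap, vL_linear) LMmapD LMmapZ. Qed.
End Functoriality.

Section Pairing.
Context (N N' : phiMod T).

Lemma muLDl (x x' : LM N) (y : LM N') : muL (x + x') y = muL x y + muL x' y.
Proof. exact: (bliftD (@muL_bal1 T N N' y)). Qed.
Lemma muL0l (y : LM N') : muL (0 : LM N) y = 0.
Proof. exact: (blift0 (@muL_bal1 T N N' y)). Qed.
Lemma muL_mk l (m : N) y :
  muL (bmk EL l m) y = blift EL (fun l' n =>
    @bmk _ _ EL (tensMod N N') (l * l') (tpure m n)) y.
Proof. exact: (blift_mk (@muL_bal1 T N N' y)). Qed.
Lemma muL_mk2 l (m : N) l' (n : N') :
  muL (bmk EL l m) (bmk EL l' n) = @bmk _ _ EL (tensMod N N') (l * l') (tpure m n).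
Proof. by rewrite muL_mk (blift_mk (@muL_bal2 T N N' l m)). Qed.
Lemma muL_one (m : N) (n : N') :
  muL (one_t m) (one_t n) = @one_t (tensMod N N') (tpure m n).
Proof. by rewrite muL_mk2 mulr1. Qed.
Lemma muLDr (x : LM N) (y y' : LM N') : muL x (y + y') = muL x y + muL x y'.
Proof.
elim/(@baseChange_ind _ _ EL N): x => [|l m|x x' IH IH'].
- by rewrite !muL0l addr0.
- by rewrite !muL_mk (bliftD (@muL_bal2 T N N' l m)).
- by rewrite !muLDl IH IH' addrACA.
Qed.
Lemma muL0r (x : LM N) : muL x (0 : LM N') = 0.
Proof. by apply: (@addrI _ (muL x 0)); rewrite -muLDr !addr0. Qed.
Lemma muLZr l (x : LM N) (y : LM N') : muL x (l *: y) = l *: muL x y.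
Proof.
elim/(@baseChange_ind _ _ EL N): x => [|k m|x x' IH IH'].
- by rewrite !muL0l scaler0.
- elim/(@baseChange_ind _ _ EL N'): y => [|k' n|y y' IH IH'].
  + by rewrite scaler0 muL0r scaler0.
  + by rewrite bmkZl !muL_mk2 mulrCA bmkZl.
  + by rewrite scalerDr !muLDr IH IH' scalerDr.
- by rewrite !muLDl IH IH' scalerDr.
Qed.
Lemma muLZl l (x : LM N) (y : LM N') : muL (l *: x) y = l *: muL x y.
Proof.
elim/(@baseChange_ind _ _ EL N'): y => [|k' n|y y' IH IH'].
- by rewrite !muL0r scaler0.
- elim/(@baseChange_ind _ _ EL N): x => [|k m|x x' IH IH'].
  + by rewrite scaler0 !muL0l scaler0.
  + by rewrite bmkZl !muL_mk2 -mulrA bmkZl.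
  + by rewrite scalerDr !muLDl IH IH' scalerDr.
- by rewrite !muLDr IH IH' scalerDr.
Qed.
Lemma muL_suml I (s : seq I) (x : I -> LM N) (y : LM N') :
  muL (\sum_(i <- s) x i) y = \sum_(i <- s) muL (x i) y.
Proof. exact: (big_morph (fun x => muL x y) (fun x x' => muLDl x x' y) (muL0l y)). Qed.
Lemma muL_sumr I (s : seq I) (x : LM N) (y : I -> LM N') :
  muL x (\sum_(i <- s) y i) = \sum_(i <- s) muL x (y i).
Proof. exact: (big_morph (muL x) (muLDr x) (muL0r x)). Qed.
End Pairing.

(* [L (x)_E E = L] *)
Definition uval : LM (unitMod T) -> L := blift EL (fun l (e : E^o) => l * EL e).

Lemma uval_bal : bbalanced EL (fun l (e : E^o) => l * EL e).
Proof.
split=> [l l' e|l e e'|a l e]; first by rewrite mulrDl.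
  by rewrite rmorphD mulrDr.
by rewrite rmorphM mulrCA mulrA.
Qed.
Lemma uval_one (e : E^o) : uval (@one_t (unitMod T) e) = EL e.
Proof. by rewrite /uval (blift_mk uval_bal) mul1r. Qed.
Lemma uvalD x y : uval (x + y) = uval x + uval y.
Proof. exact: (bliftD uval_bal). Qed.
Lemma uval0 : uval 0 = 0. Proof. exact: (blift0 uval_bal). Qed.
Lemma uvalZ l x : uval (l *: x) = l * uval x.
Proof.
elim/(@baseChange_ind _ _ EL (unitMod T)): x => [|k e|x y IHx IHy].
- by rewrite scaler0 uval0 mulr0.
- by rewrite bmkZl /uval !(blift_mk uval_bal) mulrA.
- by rewrite scalerDr !uvalD IHx IHy mulrDr.
Qed.
Lemma uval_phi x : uval (phiL x) = tsL T (uval x).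
Proof.
elim/(@baseChange_ind _ _ EL (unitMod T)): x => [|k e|x y IHx IHy].
- by rewrite phiL0 uval0 rmorph0.
- by rewrite phiL_mk /uval !(blift_mk uval_bal) rmorphM tsEL.
- by rewrite phiLD !uvalD IHx IHy rmorphD.
Qed.
Lemma uvalE x : x = uval x *: @one_t (unitMod T) (1 : E^o).
Proof.
elim/LM_ind: x => [|x y IHx IHy|l x IHx|e].
- by rewrite uval0 scale0r.
- by rewrite uvalD scalerDl -IHx -IHy.
- by rewrite uvalZ -scalerA -IHx.
- by rewrite uval_one -one_tZ; congr one_t; rewrite /GRing.scale /= mulr1.
Qed.

Fact unitV_subproof : phiL (@one_t (unitMod T) (1 : E^o)) = @one_t (unitMod T) (1 : E^o).
Proof. by rewrite phiL_one; congr one_t; exact: (rmorph1 (tsE T)). Qed.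
Definition unitV : VM (unitMod T) := mkVM unitV_subproof.

End PhiMaps.

(** * Generation of N and V(N) by each other over Sigma *)

Section Good.
Context (T : frobTower) (gT : simple_tower T).
Local Notation F := (tF T).
Local Notation E := (tE T).
Local Notation L := (tL T).
Local Notation EL := (tEL T).
Local Notation FL := (tFL T).

(** Surjectivity of L (x)_F V(N) -> L (x)_E N, tested on N, with a finite family of solutions that
    may depend on [x]. *)
Definition lincomb (N : phiMod T) : Prop :=
  forall x : N, exists m (w : 'I_m -> VM N), lspan (fun j => vL (w j)) (one_t x).

(** Independence is asked over [F] and generation over [L]. By descent such a family is both an
    [F]-basis of V(N) ([solbasis_V]) and an [L]-basis of L (x)_E N ([vL_lfree]). *)
Definition solbasis (N : phiMod T) m (w : 'I_m -> VM N) : Prop :=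
  lfree w /\ forall x : LM N, lspan (fun j => vL (w j)) x.

Lemma solbasis_V (N : phiMod T) m (w : 'I_m -> VM N) v : solbasis w -> lspan w v.
Proof. by move=> [_ wL]; apply: (vL_span gT). Qed.

Lemma lspan_one (N : phiMod T) k (e : 'I_k -> N) m (b : 'I_m -> LM N) :
  (forall x, lspan e x) -> (forall i, lspan b (one_t (e i))) ->
  forall x, lspan b x.
Proof.
move=> eN be; elim/LM_ind => [|x y|l x|x]; [exact: lspan0 | exact: lspanD | exact: lspanZ |].
have [c ->] := eN x; rewrite one_t_sum.
under eq_bigr do rewrite one_tZ; apply: (@lspan_sum _ _ _ _ _ (fun i => EL (c i))) => i.
exact: be.
Qed.

Lemma lincomb_solbasis (N : phiMod T) : (exists k (e : 'I_k -> N), forall x, lspan e x) ->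
  lincomb N -> exists m (w : 'I_m -> VM N), solbasis w.
Proof.
move=> [k [e eN]] lc.
have [m [w wE]] := lspan_union (fun i => lc (e i)).
have [m' [f [fr sp]]] := basis_extract (st_F gT) w.
exists m', (w \o f); split=> //; apply: (lspan_one eN) => i.
have [c ->] := wE i; apply: lspan_sum => j; have [d ->] := sp j.
by exists (fun l => FL (d l)); rewrite vL_sum.
Qed.

Lemma LV_bal (N : phiMod T) : bbalanced FL (fun l (x : VM N) => l *: vL x).
Proof.
split=> [l l' x|l x x'|a l x]; first by rewrite scalerDl.
  by rewrite vLD scalerDr.
by rewrite vLZ scalerA mulrC.
Qed.

Lemma L_trivial_lincomb (N : phiMod T) : L_trivial N -> lincomb N.
Proof.
move=> [_ [h _ hK]] x; rewrite -[one_t x]hK; move: (h _) => y {h hK}.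
have [n [l [v ->]]] := @tens_sum F (restr L^o FL) (VM N) y.
exists n, v; rewrite /LV_to_LM [X in lspan _ X](blift_sum (LV_bal N)).
exists l; apply: eq_bigr => i _; exact: (blift_mk (LV_bal N)).
Qed.

Lemma L_trivial_fin (N : phiMod T) : L_trivial N ->
  exists k (e : 'I_k -> N), lfree e /\ forall x, lspan e x.
Proof.
move=> [[n [e eB]] _]; exists n, e.
by split; [exact: is_basis_free | exact: is_basis_span].
Qed.

Lemma L_trivial_solbasis (N : phiMod T) : L_trivial N -> exists m (w : 'I_m -> VM N), solbasis w.
Proof.
move=> tN; apply: lincomb_solbasis; last exact: L_trivial_lincomb.
by have [k [e [_ eN]]] := L_trivial_fin tN; exists k, e.
Qed.

Lemma solbasis_coord (N : phiMod T) m (w : 'I_m -> VM N) : solbasis w ->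
  exists d : 'I_m -> {linear LM N -> L^o},
    (forall x, x = \sum_i (d i x : L) *: vL (w i)) /\
    forall i k, d i (vL (w k)) = (k == i)%:R.
Proof. by move=> [fw sw]; apply: basis_coord => //; exact: (vL_lfree gT). Qed.

(** The inverse map takes coordinates along a solution basis. This is how images in [L] are later
    seen to be objects of T_M. *)
Lemma lincomb_L_trivial (N : phiMod T) : (exists k (e : 'I_k -> N), forall x, lspan e x) ->
  lincomb N -> L_trivial N.
Proof.
move=> fN lc; have [m [w wB]] := lincomb_solbasis fN lc.
have [d [dE dd]] := solbasis_coord wB.
split.
  have [k [e eN]] := fN; have [n [f [fr sp]]] := basis_extract (st_E gT) e.
  exists n, (e \o f) => x.
  have [c xE] : lspan (e \o f) x by have [c ->] := eN x; apply: lspan_sum.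
  exists (\row_i c i); split.
    by rewrite xE; apply: eq_bigr => i _; rewrite mxE.
  move=> c' xE'; apply/rowP => i; rewrite mxE.
  by apply: (lfree_eq (c := c) (c' := fun i => c' 0 i) fr); rewrite -xE.
exists (fun x => \sum_i bmk FL (d i x : L) (w i)) => x; last first.
  rewrite [RHS]dE [LHS](blift_sum (LV_bal N)); apply: eq_bigr => i _.
  exact: (blift_mk (LV_bal N)).
have [c ->] : exists c : 'I_m -> L, x = \sum_i bmk FL (c i) (w i).
  elim/(@baseChange_ind _ _ FL (VM N)): x => [|l v|x y [c ->] [c' ->]].
  - exists (fun=> 0); rewrite big1 // => i _.
    by apply: (@addrI _ (bmk FL 0 (w i))); rewrite -bmkDl !addr0.
  - have [c ->] := solbasis_V v wB; exists (fun i => FL (c i) * l).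
    rewrite [LHS](@tpure_sumr _ (restr L^o FL) (VM N)).
    by apply: eq_bigr => i _; rewrite bmkZ.
  - exists (fun i => c i + c' i).
    by under [RHS]eq_bigr do rewrite bmkDl; rewrite big_split.
apply: eq_bigr => i _; congr bmk.
have -> : LV_to_LM (\sum_i bmk FL (c i) (w i)) = \sum_i c i *: vL (w i).
  rewrite [LHS](blift_sum (LV_bal N)); apply: eq_bigr => k _.
  exact: (blift_mk (LV_bal N)).
rewrite linear_sum (bigD1 i) //= linearZ /= dd eqxx [_ *: _]mulr1 big1 ?addr0 // => k /negbTE ki.
by rewrite linearZ /= dd ki [_ *: _]mulr0.
Qed.

Section SigmaSpan.
Context (r : nat) (Psi : GL L r).
Local Notation n := (r * r + 1)%N.
Local Notation ev h := (evalGL EL h Psi).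

(** The Sigma-submodule generated by a possibly infinite family. Sigma is never made into a ring of
    its own: its elements appear as values of polynomials at [Psi]. *)
Inductive sspan (V : lmodType L) (I : Type) (u : I -> V) : V -> Prop :=
| sspan_0 : sspan u 0
| sspan_S h i x : sspan u x -> sspan u (ev h *: u i + x).

Section Span.
Context (V : lmodType L) (I : Type) (u : I -> V).

Lemma sspan_mem i : sspan u (u i).
Proof.
have := sspan_S 1 i (sspan_0 u).
by rewrite addr0 evalGL1 scale1r.
Qed.
Lemma sspanD x y : sspan u x -> sspan u y -> sspan u (x + y).
Proof.
elim=> {x} [|h i x _ IH] sy; first by rewrite add0r.
by rewrite -addrA; apply: sspan_S; exact: IH.
Qed.
Lemma sspanZ h x : sspan u x -> sspan u (ev h *: x).
Proof.
elim=> {x} [|h' i x _ IH]; first by rewrite scaler0; exact: sspan_0.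
by rewrite scalerDr scalerA -evalGLM; exact: sspan_S.
Qed.
Lemma sspan_sum J (s : seq J) (x : J -> V) :
  (forall j, sspan u (x j)) -> sspan u (\sum_(j <- s) x j).
Proof.
move=> sx; elim: s => [|j s IH]; first by rewrite big_nil; exact: sspan_0.
by rewrite big_cons; apply: sspanD.
Qed.
Lemma sspan_seq x : sspan u x ->
  exists s : seq ({mpoly E[n]} * I), x = \sum_(p <- s) ev p.1 *: u p.2.
Proof.
elim=> {x} [|h i x _ [s ->]]; first by exists [::]; rewrite big_nil.
by exists ((h, i) :: s); rewrite big_cons.
Qed.
Lemma sspan_lspan x : sspan u x -> exists m (w : 'I_m -> I), lspan (fun j => u (w j)) x.
Proof.
move=> /sspan_seq[s ->]; rewrite big_tnth.
exists (size s), (fun i => (tnth (in_tuple s) i).2).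
by exists (fun i => ev (tnth (in_tuple s) i).1).
Qed.
End Span.

Lemma sspan_map (V W : lmodType L) I J (u : I -> V) (w : J -> W) (f : V -> W) x :
  {morph f : x y / x + y} -> (forall l x, f (l *: x) = l *: f x) ->
  (forall i, sspan w (f (u i))) -> sspan u x -> sspan w (f x).
Proof.
move=> fD fZ fu; elim=> {x} [|h i x _ IH].
  have -> : f 0 = 0 by rewrite -(scale0r (0 : V)) fZ scale0r.
  exact: sspan_0.
by rewrite fD fZ; apply: sspanD => //; apply: sspanZ.
Qed.

Lemma sspan_scalar (u : F -> L^o) l : (forall c, u c = FL c) -> sspan u l ->
  exists h, ev h = l.
Proof.
move=> uE; elim=> {l} [|h c l _ [h' <-]]; first by exists 0; exact: evalGL0.
by exists (h * (tFE T c)%:MP + h'); rewrite evalGLD evalGLM evalGLC uE.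
Qed.

Lemma ev_entry i j : exists h, ev h = Psi i j.
Proof. by exists 'X_(lshift 1 (mxvec_index i j)); rewrite evalGLX glvar_entry. Qed.
Lemma ev_inv i j : exists h, ev h = glinv Psi i j.
Proof.
have [h e] := evalGL_inv ('X_(lshift 1 (mxvec_index i j)) : {mpoly E[n]}).
by exists h; rewrite e evalGLX glvar_entry.
Qed.

(** Inside L (x)_E N, the last two fields say that [N] and V(N) have the same Sigma-span. Both
    inclusions are carried through the induction because duality exchanges them. *)
Record good (N : phiMod T) : Prop := Good {
  good_fin : exists k (e : 'I_k -> N), forall x, lspan e x;
  good_A : forall v : VM N, sspan (@one_t T N) (vL v);
  good_B : forall x : N, sspan (@vL T N) (one_t x) }.

Lemma good_lincomb N : good N -> lincomb N.
Proof. by move=> gN x; apply: sspan_lspan; exact: good_B. Qed.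

Lemma good_solbasis N : good N -> exists m (w : 'I_m -> VM N), solbasis w.
Proof. by move=> gN; apply: lincomb_solbasis; [exact: good_fin | exact: good_lincomb]. Qed.

Lemma LMmap_A N N' (f : phiHom N N') x :
  sspan (@one_t T N) x -> sspan (@one_t T N') (LMmap f x).
Proof.
apply: sspan_map; [exact: LMmapD | exact: LMmapZ | move=> y].
by rewrite LMmap_one; exact: sspan_mem.
Qed.
Lemma LMmap_B N N' (f : phiHom N N') x :
  sspan (@vL T N) x -> sspan (@vL T N') (LMmap f x).
Proof.
apply: sspan_map; [exact: LMmapD | exact: LMmapZ | move=> y].
by rewrite -vL_Vmap; exact: sspan_mem.
Qed.

Lemma good_unit : good (unitMod T).
Proof.
split.
- exists 1%N, (fun=> 1 : E^o) => x; exists (fun=> x).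
  by rewrite big_ord1 /GRing.scale /= mulr1.
- move=> v; rewrite [vL v]uvalE.
  have [c <-] : exists c, FL c = uval (vL v).
    by apply: (st_fix gT); rewrite -uval_phi vLP.
  have := sspanZ (tFE T c)%:MP (sspan_mem (@one_t T (unitMod T)) (1 : E^o)).
  by rewrite evalGLC.
- move=> x; rewrite [one_t x]uvalE uval_one.
  have := sspanZ x%:MP (sspan_mem (@vL T (unitMod T)) (unitV T)).
  by rewrite evalGLC.
Qed.

Section Sum.
Context (N N' : phiMod T).
Fact sum_i1_lin a (x y : N) : (a *: x + y, 0) = a *: (x, 0) + (y, 0) :> sumMod N N'.
Proof. by congr (_, _); rewrite /= scaler0 addr0. Qed.
Fact sum_i1_phi (x : N) : (pphi N x, 0) = pphi (sumMod N N') (x, 0).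
Proof. by congr (_, _); rewrite /= raddf0. Qed.
Definition sum_i1 : phiHom N (sumMod N N') := mkHom sum_i1_lin sum_i1_phi.
Fact sum_i2_lin a (x y : N') : (0, a *: x + y) = a *: (0, x) + (0, y) :> sumMod N N'.
Proof. by congr (_, _); rewrite /= scaler0 addr0. Qed.
Fact sum_i2_phi (x : N') : (0, pphi N' x) = pphi (sumMod N N') (0, x).
Proof. by congr (_, _); rewrite /= raddf0. Qed.
Definition sum_i2 : phiHom N' (sumMod N N') := mkHom sum_i2_lin sum_i2_phi.
Definition sum_p1 : phiHom (sumMod N N') N :=
  @mkHom T (sumMod N N') N fst (fun _ _ _ => erefl) (fun _ => erefl).
Definition sum_p2 : phiHom (sumMod N N') N' :=
  @mkHom T (sumMod N N') N' snd (fun _ _ _ => erefl) (fun _ => erefl).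

Lemma sum_split (x : sumMod N N') : x = sum_i1 x.1 + sum_i2 x.2.
Proof. by case: x => x y; congr (_, _); rewrite /= ?addr0 ?add0r. Qed.

Lemma LM_sum_split (x : LM (sumMod N N')) :
  x = LMmap sum_i1 (LMmap sum_p1 x) + LMmap sum_i2 (LMmap sum_p2 x).
Proof.
elim/LM_ind: x => [|x y IHx IHy|l x IHx|x].
- by rewrite !LMmap0 addr0.
- by rewrite !LMmapD addrACA -IHx -IHy.
- by rewrite !LMmapZ -scalerDr -IHx.
- by rewrite !LMmap_one -one_tD -sum_split.
Qed.

Lemma good_sum : good N -> good N' -> good (sumMod N N').
Proof.
move=> gN gN'; split.
- have [k [e eE]] := good_fin gN; have [k' [e' e'E]] := good_fin gN'.
  exists (k + k')%N, (fun i => match split i with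
    | inl i => sum_i1 (e i) | inr i => sum_i2 (e' i) end) => x.
  have [c xE] := eE x.1; have [c' x'E] := e'E x.2.
  exists (fun i => match split i with inl i => c i | inr i => c' i end).
  rewrite big_split_ord [LHS]sum_split xE x'E !linear_sum; congr (_ + _).
    apply: eq_bigr => i _; rewrite (_ : split _ = inl i) ?linearZ //.
    exact: (unsplitK (inl i)).
  apply: eq_bigr => i _; rewrite (_ : split _ = inr i) ?linearZ //.
  exact: (unsplitK (inr i)).
- move=> v; rewrite [vL v]LM_sum_split -!vL_Vmap !vL_Vmap.
  by apply: sspanD; apply: LMmap_A; rewrite -vL_Vmap; exact: good_A.
- move=> x; rewrite [x]sum_split one_tD -!LMmap_one.
  by apply: sspanD; apply: LMmap_B; exact: good_B.
Qed.
End Sum.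

End SigmaSpan.
End Good.

(** * Perfect pairings and dual objects *)

Section GoodTannakian.
Context (T : frobTower) (gT : simple_tower T).
Local Notation F := (tF T).
Local Notation E := (tE T).
Local Notation L := (tL T).
Local Notation EL := (tEL T).
Local Notation FL := (tFL T).

Section PairingHom.
Context (N N' : phiMod T) (b : N -> N' -> E).
Context (bl : forall a x x' y, b (a *: x + x') y = a * b x y + b x' y).
Context (br : forall a x y y', b x (a *: y + y') = a * b x y + b x y').
Context (bphi : forall x y, b (pphi N x) (pphi N' y) = tsE T (b x y)).

Lemma pair_bal : balanced (b : N -> N' -> E^o).
Proof.
have b0l y : b 0 y = 0.
  by have := bl (-1) 0 0 y; rewrite scaler0 addr0 mulN1r addNr.
have b0r x : b x 0 = 0.
  by have := br (-1) x 0 0; rewrite scaler0 addr0 mulN1r addNr.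
split=> [x x' y|x y y'|a x y].
- by rewrite -[x in LHS]scale1r bl mul1r.
- by rewrite -[y in LHS]scale1r br mul1r.
- by rewrite -[a *: x]addr0 -[a *: y]addr0 bl br b0l b0r.
Qed.

Lemma pair_linear a x y :
  tlift (b : N -> N' -> E^o) (a *: x + y) =
  a *: tlift (b : N -> N' -> E^o) x + tlift (b : N -> N' -> E^o) y.
Proof.
rewrite (tliftD pair_bal); congr (_ + _).
elim/tensor_ind: x => [|m m'|x x' IH IH'].
- by rewrite scaler0 (tlift0 pair_bal) scaler0.
- rewrite -tpureZl !(tlift_pure pair_bal) -[a *: m]addr0 bl.
  have := bl (-1) 0 0 m'; rewrite scaler0 addr0 mulN1r addNr => ->.
  by rewrite addr0.
- by rewrite scalerDr !(tliftD pair_bal) IH IH' scalerDr.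
Qed.

Lemma pair_phi (x : tensMod N N') :
  tlift (b : N -> N' -> E^o) (pphi (tensMod N N') x) =
  pphi (unitMod T) (tlift (b : N -> N' -> E^o) x).
Proof.
elim/tensor_ind: x => [|m m'|x x' IH IH'].
- by rewrite !(raddf0, tlift0 pair_bal).
- rewrite /= /phi_tens (tlift_pure (phi_tens_bal N N')) !(tlift_pure pair_bal).
  exact: bphi.
- by rewrite raddfD !(tliftD pair_bal) IH IH' [RHS]raddfD.
Qed.

Definition pair_hom : phiHom (tensMod N N') (unitMod T) :=
  @mkHom T (tensMod N N') (unitMod T) _ pair_linear pair_phi.

Definition bL (x : LM N) (y : LM N') : L := uval (LMmap pair_hom (muL x y)).

Lemma bL_one x y : bL (one_t x) (one_t y) = EL (b x y).
Proof. by rewrite /bL muL_one LMmap_one uval_one /= (tlift_pure pair_bal). Qed.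
Lemma bL_phi x y : bL (phiL x) (phiL y) = tsL T (bL x y).
Proof. by rewrite /bL -muL_phi -LMmap_phi uval_phi. Qed.
Lemma bLDl x x' y : bL (x + x') y = bL x y + bL x' y.
Proof. by rewrite /bL muLDl LMmapD uvalD. Qed.
Lemma bLDr x y y' : bL x (y + y') = bL x y + bL x y'.
Proof. by rewrite /bL muLDr LMmapD uvalD. Qed.
Lemma bLZl l x y : bL (l *: x) y = l * bL x y.
Proof. by rewrite /bL muLZl LMmapZ uvalZ. Qed.
Lemma bLZr l x y : bL x (l *: y) = l * bL x y.
Proof. by rewrite /bL muLZr LMmapZ uvalZ. Qed.
Lemma bL0l y : bL 0 y = 0.
Proof. by rewrite -(scale0r (0 : LM N)) bLZl mul0r. Qed.
Lemma bL0r x : bL x 0 = 0.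
Proof. by rewrite -(scale0r (0 : LM N')) bLZr mul0r. Qed.
Lemma bL_suml I (s : seq I) (x : I -> LM N) y :
  bL (\sum_(i <- s) x i) y = \sum_(i <- s) bL (x i) y.
Proof. exact: (big_morph (fun x => bL x y) (fun x x' => bLDl x x' y) (bL0l y)). Qed.
Lemma bL_sumr I (s : seq I) x (y : I -> LM N') :
  bL x (\sum_(i <- s) y i) = \sum_(i <- s) bL x (y i).
Proof. exact: (big_morph (bL x) (bLDr x) (bL0r x)). Qed.

Lemma bL_VV (x : VM N) (y : VM N') : exists c, FL c = bL (vL x) (vL y).
Proof. by apply: (st_fix gT); rewrite -bL_phi !vLP. Qed.

Context (bperf : forall f : {linear N -> E^o}, exists! y, forall x, b x y = f x).

Lemma dual_basis k (e : 'I_k -> N) : lfree e -> (forall x, lspan e x) ->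
  exists e' : 'I_k -> N',
  (forall x : LM N, x = \sum_i bL x (one_t (e' i)) *: one_t (e i)) /\
  (forall y : LM N', y = \sum_i bL (one_t (e i)) y *: one_t (e' i)).
Proof.
move=> fe se; have [d [dE dd]] := basis_coord fe se.
have /choice[e' e'E] i : exists y, forall x, b x y = d i x.
  by have [y [yE _]] := bperf (d i); exists y.
exists e'; split; elim/LM_ind => [|x y IHx IHy|l x IHx|x].
- by rewrite big1 // => i _; rewrite bL0l scale0r.
- by under eq_bigr do rewrite bLDl scalerDl; rewrite big_split -IHx -IHy.
- by under eq_bigr do rewrite bLZl -scalerA; rewrite -scaler_sumr -IHx.
- rewrite {1}[x]dE one_t_sum; apply: eq_bigr => i _.
  by rewrite one_tZ bL_one e'E.
- by rewrite big1 // => i _; rewrite bL0r scale0r.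
- by under eq_bigr do rewrite bLDr scalerDl; rewrite big_split -IHx -IHy.
- by under eq_bigr do rewrite bLZr -scalerA; rewrite -scaler_sumr -IHx.
(* The two sides have the same pairing with every vector of [N], so the uniqueness half of [bperf]
   identifies them. *)
- have e1 : one_t x = one_t (\sum_i b (e i) x *: e' i).
    congr one_t; pose f := tlift (b : N -> N' -> E^o).
    have fl a z z' : f (tpure (a *: z + z') x) = a *: f (tpure z x) + f (tpure z' x).
      by rewrite /f !(tlift_pure pair_bal) bl.
    have [y [yE yu]] := bperf (mkLin fl).
    rewrite -[LHS](yu x) -?[RHS](yu _) // => z /=.
      rewrite /f (tlift_pure pair_bal).
      have bZr u c v : b u (c *: v) = c * b u v.
        rewrite -[c *: v]addr0 br.
        have := br (-1) u 0 0; rewrite scaler0 addr0 mulN1r addNr => ->.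
        by rewrite addr0.
      have b_sum u J (s : seq J) (v : J -> N') : b u (\sum_(j <- s) v j) = \sum_(j <- s) b u (v j).
        apply: (big_morph (b u)) => [v1 v2|].
          by rewrite -[v1 in LHS]scale1r br mul1r.
        by have := br (-1) u 0 0; rewrite scaler0 addr0 mulN1r addNr.
      have b_suml u J (s : seq J) (c : J -> E) (v : J -> N) :
          b (\sum_(j <- s) c j *: v j) u = \sum_(j <- s) c j * b (v j) u.
        elim: s => [|j s IH]; last by rewrite !big_cons bl IH.
        rewrite !big_nil; have := bl (-1) 0 0 u.
        by rewrite scaler0 addr0 mulN1r addNr.
      rewrite b_sum [z in RHS]dE b_suml; apply: eq_bigr => i _.
      by rewrite bZr e'E mulrC.
    by rewrite /f (tlift_pure pair_bal).
  rewrite {1}e1 one_t_sum; apply: eq_bigr => i _.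
  by rewrite one_tZ bL_one.
Qed.

(** The vector representing the [j]-th coordinate along [w] pairs with the [w i] to 0 or 1, values
    fixed by sigma. As the pairing is nondegenerate and the [w i] are fixed by phi, this vector is
    fixed too, hence a solution. *)
Lemma dual_solbasis m (w : 'I_m -> VM N) :
  (exists k (e : 'I_k -> N), lfree e /\ forall x, lspan e x) -> solbasis w ->
  exists w' : 'I_m -> VM N',
  (forall i j, bL (vL (w i)) (vL (w' j)) = (i == j)%:R) /\
  (forall y : LM N', y = \sum_i bL (vL (w i)) y *: vL (w' i)).
Proof.
move=> [k [e [fe se]]] wB; have [e' [xE yE]] := dual_basis fe se.
have [d [dE dd]] := solbasis_coord gT wB.
pose z j := \sum_i (d j (one_t (e i)) : L) *: one_t (e' i).
have zE x j : bL x (z j) = d j x.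
  rewrite bL_sumr {2}[x]xE linear_sum; apply: eq_bigr => i _.
  by rewrite bLZr linearZ mulrC.
have nd y y' : (forall i, bL (vL (w i)) y = bL (vL (w i)) y') -> y = y'.
  move=> h; rewrite [y]yE [y']yE; apply: eq_bigr => i _; congr (_ *: _).
  rewrite [one_t (e i)]dE !bL_suml; apply: eq_bigr => j _.
  by rewrite !bLZl h.
have zphi j : phiL (z j) = z j.
  apply: nd => i; rewrite -{1}[vL (w i)]vLP bL_phi zE dd.
  by case: eqP => _; rewrite ?rmorph1 ?rmorph0.
exists (fun j => mkVM (zphi j)); split=> [i j|y]; first by rewrite zE dd.
apply: nd => i; rewrite bL_sumr (bigD1 i) //= bLZr zE dd eqxx mulr1.
by rewrite big1 ?addr0 // => j /negbTE ji; rewrite bLZr zE dd eq_sym ji mulr0.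
Qed.

Context (r : nat) (Psi : GL L r).

(** Coordinates along a dual basis are pairings. A solution of [N'] is paired with [e i], which is
    in the Sigma-span of V(N), and solutions pair into [F]; an element of [N'] is paired with [w i],
    which is in the Sigma-span of [N], and [N] and [N'] pair into [E]. Either way the coordinates
    lie in Sigma. *)
Lemma good_dual : good Psi N -> L_trivial N' -> good Psi N'.
Proof.
move=> gN tN'.
have fN : exists k (e : 'I_k -> N), lfree e /\ forall x, lspan e x.
  have [k [e se]] := good_fin gN; have [n [f [fr sp]]] := basis_extract (st_E gT) e.
  exists n, (e \o f); split=> // x.
  by have [c ->] := se x; apply: lspan_sum.
have [m [w wB]] := good_solbasis gT gN.
have [w' [ww' yE]] := dual_solbasis fN wB.
have [k [e [fe se]]] := fN; have [e' [_ y'E]] := dual_basis fe se.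
split.
- by have [k' [e1 [_ h]]] := L_trivial_fin tN'; exists k', e1.
- move=> v; rewrite [vL v]y'E; apply: sspan_sum => i.
  have [h <-] : exists h, evalGL EL h Psi = bL (one_t (e i)) (vL v).
    apply: (@sspan_scalar _ _ _ (FL : F -> L^o)) => //.
    apply: (@sspan_map _ _ Psi _ L^o _ _ (@vL T N) (FL : F -> L^o) (fun x => bL x (vL v))) (good_B gN (e i)).
    + by move=> x y; exact: bLDl.
    + by move=> l x; exact: bLZl.
    + by move=> x; have [c <-] := bL_VV x v; exact: sspan_mem.
  by apply: sspanZ; exact: sspan_mem.
- move=> x; rewrite [one_t x]yE; apply: sspan_sum => i.
  have [h <-] : exists h, evalGL EL h Psi = bL (vL (w i)) (one_t x).
    have : @sspan _ _ Psi L^o _ (EL : E -> L^o) (bL (vL (w i)) (one_t x)).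
      apply: (@sspan_map _ _ Psi _ L^o _ _ (@one_t T N) (EL : E -> L^o) (fun y => bL y (one_t x))) (good_A gN (w i)).
      + by move=> y y'; exact: bLDl.
      + by move=> l y; exact: bLZl.
      + by move=> y; rewrite bL_one; exact: sspan_mem.
    elim=> [|h c l _ [h' <-]]; first by exists 0; exact: evalGL0.
    by exists (h * c%:MP + h'); rewrite evalGLD evalGLM evalGLC.
  by apply: sspanZ; exact: sspan_mem.
Qed.

End PairingHom.

End GoodTannakian.

(** * Tensor products, subobjects, quotients, and the module M itself *)

Section GoodAll.
Context (T : frobTower) (gT : simple_tower T).
Local Notation F := (tF T).
Local Notation E := (tE T).
Local Notation L := (tL T).
Local Notation EL := (tEL T).
Local Notation FL := (tFL T).

Lemma vL_muV (N N' : phiMod T) (v : VM N) (v' : VM N') :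
  vL (muV v v') = muL (vL v) (vL v').
Proof. by []. Qed.

Section Tensor.
Context (N N' : phiMod T).

Lemma tens_lspan m (w : 'I_m -> VM N) m' (w' : 'I_m' -> VM N') :
  solbasis w -> solbasis w' -> forall x : LM (tensMod N N'),
  lspan (fun k : 'I_#|{: 'I_m * 'I_m'}| =>
    vL (muV (w (enum_val k).1) (w' (enum_val k).2))) x.
Proof.
move=> [_ sw] [_ sw'].
elim/LM_ind => [|x y|l x|x]; [exact: lspan0 | exact: lspanD | exact: lspanZ |].
elim/tensor_ind: x => [|a b|x y IHx IHy].
- by rewrite one_t0; exact: lspan0.
- have [c cE] := sw (one_t a); have [c' c'E] := sw' (one_t b).
  rewrite -muL_one cE c'E muL_suml; apply: (big_ind (lspan _)).
  + exact: lspan0.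
  + by move=> *; exact: lspanD.
  move=> i _; rewrite muL_sumr; apply: (big_ind (lspan _)).
  + exact: lspan0.
  + by move=> *; exact: lspanD.
  move=> j _; rewrite muLZl muLZr; do 2! apply: lspanZ.
  have := lspan_mem (fun k : 'I_#|{: 'I_m * 'I_m'}| =>
    vL (muV (w (enum_val k).1) (w' (enum_val k).2))) (enum_rank (i, j)).
  by rewrite enum_rankK.
- by rewrite one_tD; exact: lspanD.
Qed.

Lemma V_tens_span m (w : 'I_m -> VM N) m' (w' : 'I_m' -> VM N') :
  solbasis w -> solbasis w' -> forall v : VM (tensMod N N'),
  lspan (fun k : 'I_#|{: 'I_m * 'I_m'}| =>
    muV (w (enum_val k).1) (w' (enum_val k).2)) v.
Proof. by move=> wB wB' v; apply: (vL_span gT); exact: tens_lspan. Qed.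

End Tensor.

Lemma LMmap_inj (N N' : phiMod T) (f : phiHom N N') :
  injective f -> injective (LMmap f).
Proof.
move=> fi x y e; apply/eqP; rewrite -subr_eq0; apply/eqP.
apply: (@tens_inj _ (st_E gT) (restr L^o EL) N N' f fi).
rewrite -[LHS]/(LMmap f (x - y)) -scaleN1r LMmapD LMmapZ e scaleN1r.
exact: subrr.
Qed.

Lemma Vmap_inj (N N' : phiMod T) (f : phiHom N N') :
  injective f -> injective (Vmap f).
Proof.
move=> /LMmap_inj fi x y e; apply: vL_inj; apply: fi.
by rewrite -!vL_Vmap e.
Qed.

Definition Vlin (N N' : phiMod T) (f : phiHom N N') : {linear VM N -> VM N'} :=
  mkLin (Vmap_linear f).

Lemma LMmap_lspan (N N' : phiMod T) (f : phiHom N N') m (w : 'I_m -> VM N) :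
  (forall y, exists x, f x = y) -> solbasis w ->
  forall x, lspan (fun i => vL (Vmap f (w i))) x.
Proof.
move=> fs [_ sw].
elim/LM_ind => [|x y|l x|y]; [exact: lspan0 | exact: lspanD | exact: lspanZ |].
have [x <-] := fs y; have [c cE] := sw (one_t x); exists c.
rewrite -LMmap_one cE (big_morph (LMmap f) (LMmapD f) (LMmap0 f)).
by apply: eq_bigr => i _; rewrite LMmapZ.
Qed.

(** The images of a solution basis generate L (x)_E N' over [L], hence V(N') over [F] by descent. *)
Lemma Vmap_surj (N N' : phiMod T) (f : phiHom N N') m (w : 'I_m -> VM N) :
  (forall y, exists x, f x = y) -> solbasis w ->
  forall v', exists v, Vmap f v = v'.
Proof.
move=> fs wB v'; have [c ->] := vL_span gT (LMmap_lspan fs wB (vL v')).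
exists (\sum_i c i *: w i); rewrite -[LHS]/(Vlin f _) linear_sum.
by apply: eq_bigr => i _; rewrite linearZ.
Qed.

Section SigmaTrivial.
Context (r : nat) (Psi : GL L r).

Lemma good_tens N N' : good Psi N -> good Psi N' -> good Psi (tensMod N N').
Proof.
move=> gN gN'.
have muL_sspan I I' J (u : I -> LM N) (u' : I' -> LM N') (t : J -> LM (tensMod N N')) x x' :
    (forall i i', sspan Psi t (muL (u i) (u' i'))) ->
    sspan Psi u x -> sspan Psi u' x' -> sspan Psi t (muL x x').
  move=> ut ux ux'.
  apply: (sspan_map (f := fun x => muL x x') _ _ _ ux) => [y y'|l y|i].
  - exact: muLDl.
  - exact: muLZl.
  apply: (sspan_map (f := fun x => muL (u i) x) _ _ _ ux') => [y y'|l y|i'].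
  - exact: muLDr.
  - exact: muLZr.
  - exact: ut.
split.
- have [k [e eE]] := good_fin gN; have [k' [e' e'E]] := good_fin gN'.
  exists #|{: 'I_k * 'I_k'}|, (fun i => tpure (e (enum_val i).1) (e' (enum_val i).2)).
  elim/tensor_ind => [|a b|x y]; [exact: lspan0 | | exact: lspanD].
  have [c ->] := eE a; have [c' ->] := e'E b.
  rewrite tpure_suml; apply: (big_ind (lspan _)).
  + exact: lspan0.
  + by move=> *; exact: lspanD.
  move=> i _; rewrite tpure_sumr; apply: (big_ind (lspan _)).
  + exact: lspan0.
  + by move=> *; exact: lspanD.
  move=> j _; rewrite tpureZl tpureZr; do 2! apply: lspanZ.
  have := lspan_mem (fun i : 'I_#|{: 'I_k * 'I_k'}| =>
    tpure (e (enum_val i).1) (e' (enum_val i).2) : tensMod N N') (enum_rank (i, j)).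
  by rewrite enum_rankK.
- move=> v; have [m [w wB]] := good_solbasis gT gN.
  have [m' [w' wB']] := good_solbasis gT gN'.
  have [c ->] := V_tens_span wB wB' v; rewrite vL_sum; apply: sspan_sum => k.
  rewrite vLZ -[FL (c k)]/(EL (tFE T (c k))) -(evalGLC EL Psi); apply: sspanZ; rewrite vL_muV.
  apply: muL_sspan (good_A gN _) (good_A gN' _) => i i'.
  by rewrite muL_one; exact: sspan_mem.
- elim/tensor_ind => [|a b|x y].
  + by rewrite one_t0; exact: sspan_0.
  + rewrite -muL_one; apply: muL_sspan (good_B gN _) (good_B gN' _) => i i'.
    by rewrite -vL_muV; exact: sspan_mem.
  + by rewrite one_tD; exact: sspanD.
Qed.

Lemma good_quo N N' (f : phiHom N N') : good Psi N -> L_trivial N' ->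
  (forall y, exists x, f x = y) -> good Psi N'.
Proof.
move=> gN tN' fs; split.
- by have [k' [e1 [_ h]]] := L_trivial_fin tN'; exists k', e1.
- move=> v'; have [m [w wB]] := good_solbasis gT gN.
  have [v <-] := Vmap_surj fs wB v'.
  by rewrite vL_Vmap; apply: LMmap_A; exact: good_A.
- move=> y; have [x <-] := fs y; rewrite -LMmap_one.
  by apply: LMmap_B; exact: good_B.
Qed.

(** Two different [L]-linear retractions of the inclusion are used: one extends an [E]-linear
    retraction of [N] onto [N'] and respects the Sigma-spans of modules, the other extends an
    [F]-linear retraction of V(N) onto V(N') and respects the Sigma-spans of solutions.
    Compatibility with phi is not asked of the first retraction. *)
Lemma good_sub N N' (f : phiHom N' N) : good Psi N -> L_trivial N' ->
  injective f -> good Psi N'.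
Proof.
move=> gN tN' fi.
have [k [e [fe se]]] := L_trivial_fin tN'.
have [m' [w' wB']] := L_trivial_solbasis gT tN'.
split; first by exists k, e.
- move=> v'.
  have [d dd] := dual_family (st_E gT) (lfree_inj fi fe).
  pose rho x : LM N' := \sum_i EL (d i x : E) *: one_t (e i).
  have rho_bal : bbalanced EL (fun l (x : N) => l *: rho x).
    split=> [l l' x|l x x'|a l x]; first by rewrite scalerDl.
      rewrite -scalerDr; congr (_ *: _); rewrite -big_split; apply: eq_bigr => i _.
      by rewrite linearD [EL _]rmorphD scalerDl.
    rewrite /rho !scaler_sumr; apply: eq_bigr => i _.
    have -> : (d i (a *: x) : E) = a * d i x by exact: (linearZ_LR (d i) a x).
    by rewrite !scalerA rmorphM; congr (_ *: _); rewrite -mulrA mulrCA.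
  pose rL : LM N -> LM N' := blift EL (fun l (x : N) => l *: rho x).
  have rLD : {morph rL : x y / x + y} by exact: (bliftD rho_bal).
  have rL0 : rL 0 = 0 by exact: (blift0 rho_bal).
  have rLmk l x : rL (bmk EL l x) = l *: rho x by exact: (blift_mk rho_bal).
  have rLZ l x : rL (l *: x) = l *: rL x.
    elim/(@baseChange_ind _ _ EL N): x => [|l' x|x y IHx IHy].
    - by rewrite scaler0 rL0 scaler0.
    - by rewrite bmkZl !rLmk scalerA.
    - by rewrite scalerDr !rLD IHx IHy scalerDr.
  have rK x : rL (LMmap f x) = x.
    elim/LM_ind: x => [|x y IHx IHy|l x IHx|x].
    - by rewrite LMmap0 rL0.
    - by rewrite LMmapD rLD IHx IHy.
    - by rewrite LMmapZ rLZ IHx.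
    - have [c ->] := se x; rewrite LMmap_one rLmk scale1r one_t_sum; apply: eq_bigr => i _.
      rewrite one_tZ; congr (EL _ *: _); rewrite linear_sum linear_sum (bigD1 i) //=.
      rewrite linearZ linearZ /= dd eqxx [_ *: _]mulr1 big1 ?addr0 // => j /negbTE ji.
      by rewrite linearZ linearZ /= dd ji [_ *: _]mulr0.
  rewrite -[vL v']rK -vL_Vmap.
  apply: (sspan_map rLD rLZ) (good_A gN (Vmap f v')) => x.
  rewrite rLmk scale1r; apply: sspan_sum => i.
  by rewrite -(evalGLC EL Psi); apply: sspanZ; exact: sspan_mem.
- move=> x.
  have [m [w wB]] := good_solbasis gT gN.
  have [d [dE dd]] := solbasis_coord gT wB.
  have [p pp] := dual_family (st_F gT) (lfree_inj (g := Vlin f) (Vmap_inj fi) (proj1 wB')).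
  pose P (v : VM N) : VM N' := \sum_j (p j v : F) *: w' j.
  pose PL (y : LM N) : LM N' := \sum_i (d i y : L) *: vL (P (w i)).
  have PLD : {morph PL : y z / y + z}.
    move=> y z; rewrite /PL -big_split; apply: eq_bigr => i _.
    by rewrite linearD scalerDl.
  have PLZ l y : PL (l *: y) = l *: PL y.
    rewrite /PL scaler_sumr; apply: eq_bigr => i _.
    have -> : (d i (l *: y) : L) = l * d i y by exact: (linearZ_LR (d i) l y).
    by rewrite scalerA.
  have PL0 : PL 0 = 0 by rewrite -(scale0r (0 : LM N)) PLZ scale0r.
  have Plin a v v' : P (a *: v + v') = a *: P v + P v'.
    rewrite /P scaler_sumr -big_split; apply: eq_bigr => i _.
    have -> : (p i (a *: v + v') : F) = a * p i v + p i v'.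
      by rewrite linearD; congr (_ + _); exact: (linearZ_LR (p i) a v).
    by rewrite scalerDl scalerA.
  have PLV v : PL (vL v) = vL (P v).
    have [c ->] := solbasis_V gT v wB.
    rewrite -[P _]/(mkLin Plin _) linear_sum !vL_sum (big_morph PL PLD PL0).
    apply: eq_bigr => i _; rewrite linearZ vLZ [X in _ = X]vLZ PLZ; congr (_ *: _).
    rewrite /PL (bigD1 i) //= dd eqxx scale1r big1 ?addr0 // => j /negbTE ji.
    by rewrite dd eq_sym ji scale0r.
  have PLK y : PL (LMmap f y) = y.
    have [_ sw'] := wB'; have [c ->] := sw' y.
    rewrite (big_morph (LMmap f) (LMmapD f) (LMmap0 f)) (big_morph PL PLD PL0).
    apply: eq_bigr => i _; rewrite LMmapZ PLZ -vL_Vmap PLV; congr (_ *: vL _).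
    rewrite /P (bigD1 i) //= pp eqxx scale1r big1 ?addr0 // => j /negbTE ji.
    by rewrite pp eq_sym ji scale0r.
  rewrite -[one_t x]PLK LMmap_one.
  apply: (sspan_map PLD PLZ) (good_B gN (f x)) => v.
  by rewrite PLV; exact: sspan_mem.
Qed.

Section Self.
Context (M : phiMod T) (m : 'I_r -> M) (m_basis : is_basis m).
Context (Phi : GL E r) (Phi_m : forall i, pphi M (m i) = \sum_l Phi i l *: m l).
Context (Psi_Phi : map_mx (tsL T) Psi = map_mx EL Phi *m Psi).

(** The entries of the column Psi^-1 m. They are fixed by phi because sigma(Psi)^-1 Phi = Psi^-1. *)
Definition sol_vec i : LM M := \sum_l glinv Psi i l *: one_t (m l).

Lemma Psi_inv_Phi : map_mx (tsL T) (glinv Psi) *m map_mx EL Phi = glinv Psi.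
Proof.
rewrite -[LHS]mulmx1 -(glmxV Psi) mulmxA -[X in X *m _]mulmxA -Psi_Phi.
by rewrite -map_mxM glVmx map_mx1 mul1mx.
Qed.

Fact sol_vec_phi i : phiL (sol_vec i) = sol_vec i.
Proof.
rewrite /sol_vec (big_morph _ (@phiLD T M) (@phiL0 T M)).
under eq_bigr => l _ do rewrite phiLZ phiL_one Phi_m one_t_sum scaler_sumr.
rewrite exchange_big; apply: eq_bigr => k _ /=.
rewrite -[in RHS]Psi_inv_Phi mxE scaler_suml; apply: eq_bigr => l _.
by rewrite !mxE one_tZ scalerA.
Qed.
Definition sol i : VM M := mkVM (sol_vec_phi i).

Lemma vL_sol i : vL (sol i) = \sum_l glinv Psi i l *: one_t (m l).
Proof. by []. Qed.

Lemma m_sol l : one_t (m l) = \sum_i Psi l i *: vL (sol i).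
Proof.
under [RHS]eq_bigr do rewrite vL_sol scaler_sumr.
have Psi_V k : \sum_i Psi l i * glinv Psi i k = (l == k)%:R.
  by have /matrixP/(_ l k) := glmxV Psi; rewrite !mxE.
have e k : \sum_i Psi l i *: (glinv Psi i k *: one_t (m k)) = (l == k)%:R *: one_t (m k).
  by rewrite -Psi_V scaler_suml; apply: eq_bigr => i _; rewrite scalerA.
rewrite exchange_big /=; under eq_bigr do rewrite e.
rewrite (bigD1 l) //= eqxx scale1r big1 ?addr0 // => k /negbTE kl.
by rewrite eq_sym kl scale0r.
Qed.

Lemma sol_lspan x : lspan (fun i => vL (sol i)) x.
Proof.
apply: (lspan_one (is_basis_span m_basis)) => i; rewrite m_sol.
by exists (fun l => Psi i l).
Qed.

Lemma sol_free : lfree sol.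
Proof.
move=> c c0 i; suff : FL (c i) = 0.
  by move=> e; apply: (FL_inj gT); rewrite e rmorph0.
have : \sum_l (\sum_i FL (c i) * glinv Psi i l) *: one_t (m l) = 0.
  rewrite -[RHS](vL0 M) -[in RHS]c0 vL_sum.
  under [RHS]eq_bigr do rewrite vLZ vL_sol scaler_sumr.
  rewrite exchange_big; apply: eq_bigr => l _ /=; rewrite scaler_suml.
  by apply: eq_bigr => k _; rewrite scalerA.
under eq_bigr do rewrite -bmk_one.
move=> /(@tens_freer _ (st_E gT) (restr L^o EL) M _ _ _ (is_basis_free m_basis)) h.
have {h} : \row_i FL (c i) *m glinv Psi = 0.
  apply/rowP => l; rewrite !mxE -[RHS](h l); apply: eq_bigr => k _.
  by rewrite mxE.
move=> /(congr1 (fun X => X *m Psi)); rewrite -mulmxA glVmx mulmx1 mul0mx.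
by move/rowP/(_ i); rewrite !mxE.
Qed.

Lemma sol_basis : solbasis sol.
Proof. by split; [exact: sol_free | exact: sol_lspan]. Qed.

Lemma good_self : good Psi M.
Proof.
split; first by exists r, m; exact: is_basis_span.
- move=> v; have [c ->] := solbasis_V gT v sol_basis; rewrite vL_sum.
  apply: sspan_sum => i; rewrite vLZ -[FL (c i)]/(EL (tFE T (c i))) -(evalGLC EL Psi); apply: sspanZ.
  rewrite vL_sol; apply: sspan_sum => l; have [h <-] := ev_inv Psi i l.
  by apply: sspanZ; exact: sspan_mem.
- move=> x; have [c ->] := is_basis_span m_basis x; rewrite one_t_sum; apply: sspan_sum => l.
  rewrite one_tZ -(evalGLC EL Psi); apply: sspanZ; rewrite m_sol.
  apply: sspan_sum => i; have [h <-] := ev_entry Psi l i.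
  by apply: sspanZ; exact: sspan_mem.
Qed.

Lemma good_gen N : tannakian_gen M N -> good Psi N.
Proof.
elim=> {N} [||N N' _ gN _ gN'|N N' _ gN _ gN'|N N' _ gN tN' [b [bl br bp bf]]
  |N N' f _ gN tN' fi|N N' f _ gN tN' fs].
- exact: good_self.
- exact: good_unit.
- exact: good_sum.
- exact: good_tens.
- exact: (good_dual gT bl br bp bf).
- exact: (good_sub gN tN' fi).
- exact: (good_quo gN tN' fs).
Qed.
End Self.
End SigmaTrivial.
End GoodAll.


(** * Points of Gamma acting on V(N) *)

Section PointsOfV.
Context (T : frobTower) (gT : simple_tower T).
Local Notation F := (tF T).
Local Notation E := (tE T).
Local Notation L := (tL T).
Local Notation EL := (tEL T).
Local Notation FL := (tFL T).
Context (R : comPzRingType) (a : {rmorphism F -> R}).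

Definition inlR : {rmorphism R -> RL a} := inl_t a FL.
Definition inrR : {rmorphism L -> RL a} := inr_t a FL.
Local Notation inl_RL := inlR.
Local Notation inr_RL := inrR.

Lemma inlrR c : inlR (a c) = inrR (FL c). Proof. exact: inlr_t. Qed.
Lemma inlrR_mk x l : inlR x * inrR l = tmk a FL x l.
Proof. by rewrite /= -[RHS]/(tmk a FL x l : tensR a FL) -[x in RHS]mulr1 -[l in RHS]mul1r -tmkM. Qed.
Lemma sRL_inlR x : sRL a (inlR x) = inlR x. Proof. exact: sRL_inl. Qed.
Lemma sRL_inrR l : sRL a (inrR l) = inrR (tsL T l). Proof. exact: sRL_inr. Qed.
Lemma inlR_inj x : inlR x = 0 -> x = 0. Proof. exact: inl_RL_inj. Qed.

Section Object.
Context (N : phiMod T).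
Local Notation RLN := (baseChange (E_RL a) N).

Definition LM_RLN : LM N -> RLN := blift EL (fun l n => bmk (E_RL a) (inr_RL l) n).

Lemma LM_RLN_bal : bbalanced EL (fun l n => bmk (E_RL a) (inr_RL l) n : RLN).
Proof.
split=> [l l' x|l x x'|c l x]; first by rewrite rmorphD bmkDl.
  by rewrite bmkDr.
by rewrite rmorphM -bmkZ.
Qed.
Lemma LM_RLN_mk l n : LM_RLN (bmk EL l n) = bmk (E_RL a) (inr_RL l) n.
Proof. exact: (blift_mk LM_RLN_bal). Qed.
Lemma LM_RLN_one n : LM_RLN (one_t n) = bmk (E_RL a) 1 n.
Proof. by rewrite LM_RLN_mk rmorph1. Qed.
Lemma LM_RLND : {morph LM_RLN : x y / x + y}.
Proof. exact: (bliftD LM_RLN_bal). Qed.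
Lemma LM_RLN0 : LM_RLN 0 = 0.
Proof. exact: (blift0 LM_RLN_bal). Qed.
Lemma LM_RLNZ l x : LM_RLN (l *: x) = inr_RL l *: LM_RLN x.
Proof.
elim/(@baseChange_ind _ _ EL N): x => [|l' x|x y IHx IHy].
- by rewrite scaler0 LM_RLN0 scaler0.
- by rewrite bmkZl !LM_RLN_mk bmkZl rmorphM.
- by rewrite scalerDr !LM_RLND IHx IHy scalerDr.
Qed.
Lemma LM_RLN_sum I (s : seq I) (x : I -> LM N) :
  LM_RLN (\sum_(i <- s) x i) = \sum_(i <- s) LM_RLN (x i).
Proof. exact: (big_morph LM_RLN LM_RLND LM_RLN0). Qed.

Lemma RV_inner_bal r : bbalanced EL (fun l n => bmk (E_RL a) (tmk a FL r l) n : RLN).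
Proof.
split=> [l l' x|l x x'|c l x]; first by rewrite tmkDr bmkDl.
  by rewrite bmkDr.
by rewrite -bmkZ -!inlrR_mk rmorphM mulrCA.
Qed.

Lemma RV_innerE r x :
  blift EL (fun l n => bmk (E_RL a) (tmk a FL r l) n : RLN) x = inl_RL r *: LM_RLN x.
Proof.
elim/(@baseChange_ind _ _ EL N): x => [|l x|x y IHx IHy].
- by rewrite (blift0 (RV_inner_bal r)) LM_RLN0 scaler0.
- by rewrite (blift_mk (RV_inner_bal r)) LM_RLN_mk bmkZl inlrR_mk.
- by rewrite (bliftD (RV_inner_bal r)) LM_RLND IHx IHy scalerDr.
Qed.

Lemma RV_to_RLN_bal : bbalanced a (fun r v =>
  blift EL (fun l n => bmk (E_RL a) (tmk a FL r l) n : RLN) (@vL T N v)).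
Proof.
split=> [r r' v|r v v'|c r v]; rewrite !RV_innerE.
- by rewrite rmorphD scalerDl.
- by rewrite vLD LM_RLND scalerDr.
- by rewrite vLZ LM_RLNZ scalerA rmorphM inlrR mulrC.
Qed.
Lemma RV_to_RLN_mk r v : RV_to_RLN (bmk a r v : RV a N) = inl_RL r *: LM_RLN (vL v).
Proof. by rewrite -RV_innerE; exact: (blift_mk RV_to_RLN_bal). Qed.
Lemma RV_to_RLND : {morph @RV_to_RLN T R a N : x y / x + y}.
Proof. exact: (bliftD RV_to_RLN_bal). Qed.
Lemma RV_to_RLN0 : RV_to_RLN (0 : RV a N) = 0.
Proof. exact: (blift0 RV_to_RLN_bal). Qed.
Lemma RV_to_RLNZ r (x : RV a N) : RV_to_RLN (r *: x) = inl_RL r *: RV_to_RLN x.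
Proof.
elim/(@baseChange_ind _ _ a (VM N)): x => [|l' x|x y IHx IHy].
- by rewrite scaler0 RV_to_RLN0 scaler0.
- by rewrite bmkZl !RV_to_RLN_mk scalerA rmorphM.
- by rewrite scalerDr !RV_to_RLND IHx IHy scalerDr.
Qed.
Lemma RV_to_RLN_sum I (s : seq I) (x : I -> RV a N) :
  RV_to_RLN (\sum_(i <- s) x i) = \sum_(i <- s) RV_to_RLN (x i).
Proof. exact: (big_morph _ RV_to_RLND RV_to_RLN0). Qed.

Lemma RLN_functional (d : {linear LM N -> L^o}) :
  exists D : {linear RLN -> (RL a)^o}, forall x, D (LM_RLN x) = inr_RL (d x).
Proof.
have bal : bbalanced (E_RL a) (fun (x : RL a) n => x * inr_RL (d (one_t n)) : RL a).
  split=> [l l' x|l x x'|c l x]; first by rewrite mulrDl.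
    by rewrite one_tD linearD rmorphD mulrDr.
  have -> : d (one_t (c *: x)) = EL c * d (one_t x) by rewrite one_tZ linearZ.
  by rewrite rmorphM mulrCA mulrA.
pose D := blift (E_RL a) (fun (x : RL a) n => x * inr_RL (d (one_t n)) : RL a).
have Dlin c x y : D (c *: x + y) = c * D x + D y.
  rewrite /D (bliftD bal); congr (_ + _).
  elim/baseChange_ind: x => [|l x|x x' IH IH'].
  - by rewrite scaler0 (blift0 bal) mulr0.
  - by rewrite bmkZl !(blift_mk bal) mulrA.
  - by rewrite scalerDr !(bliftD bal) IH IH' mulrDr.
exists (@mkLin (RL a) RLN (RL a)^o D Dlin) => x.
rewrite -[LHS]/(D (LM_RLN x)).
have D0 : D 0 = 0 by exact: (blift0 bal).
elim/LM_ind: x => [|x y IHx IHy|l x IHx|n].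
- by rewrite LM_RLN0 linear0 rmorph0.
- by rewrite LM_RLND linearD rmorphD -IHx -IHy /D (bliftD bal).
- rewrite LM_RLNZ -[_ *: _]addr0 Dlin D0 addr0 IHx.
  by have -> : d (l *: x) = l * d x; [rewrite linearZ | rewrite rmorphM].
- by rewrite LM_RLN_one /D (blift_mk bal) mul1r.
Qed.

Section Basis.
Context m (w : 'I_m -> VM N) (wB : solbasis w).

Lemma RV_repr (x : RV a N) : exists c : 'I_m -> R, x = \sum_i bmk a (c i) (w i).
Proof.
elim/(@baseChange_ind _ _ a (VM N)): x => [|r v|x y [c ->] [c' ->]].
- exists (fun=> 0); rewrite big1 // => i _.
  by apply: (@addrI _ (bmk a 0 (w i))); rewrite -bmkDl !addr0.
- have [c ->] := solbasis_V gT v wB; exists (fun i => a (c i) * r).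
  rewrite [LHS](@tpure_sumr _ (restr R^o a) (VM N)).
  by apply: eq_bigr => i _; rewrite bmkZ.
- exists (fun i => c i + c' i).
  by under [RHS]eq_bigr do rewrite bmkDl; rewrite big_split.
Qed.

Lemma RV_to_RLN_coord : exists D : 'I_m -> {linear RLN -> (RL a)^o},
  (forall z, z = \sum_i (D i z : RL a) *: LM_RLN (vL (w i))) /\
  forall i (c : 'I_m -> R), D i (RV_to_RLN (\sum_k bmk a (c k) (w k) : RV a N)) = inl_RL (c i).
Proof.
have [d [dE dd]] := solbasis_coord gT wB.
have /choice[D DE] i := RLN_functional (d i).
exists D; split=> [z|i c].
  elim/baseChange_ind: z => [|x n|x y IHx IHy].
  - by rewrite big1 // => i _; rewrite linear0 scale0r.
  - have xE : bmk (E_RL a) x n = x *: LM_RLN (one_t n).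
      by rewrite LM_RLN_one bmkZl mulr1.
    rewrite xE [in LHS](dE (one_t n)) LM_RLN_sum scaler_sumr; apply: eq_bigr => i _.
    by rewrite LM_RLNZ -DE scalerA linearZ.
  - rewrite {1}IHx {1}IHy -big_split; apply: eq_bigr => i _.
    by rewrite linearD scalerDl.
rewrite RV_to_RLN_sum linear_sum (bigD1 i) //=.
have h k : D i (RV_to_RLN (bmk a (c k) (w k) : RV a N)) = inl_RL (c k) * (i == k)%:R.
  rewrite RV_to_RLN_mk linearZ DE dd rmorph_nat [k == i]eq_sym.
  by [].
rewrite h eqxx mulr1 big1 ?addr0 // => k /negbTE ki.
by rewrite h eq_sym ki mulr0.
Qed.

Lemma RV_to_RLN_inj : injective (@RV_to_RLN T R a N).
Proof.
have [D [_ DE]] := RV_to_RLN_coord.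
move=> x y; have [c ->] := RV_repr x; have [c' ->] := RV_repr y => e.
apply: eq_bigr => i _; congr bmk; apply/eqP; rewrite -subr_eq0; apply/eqP.
by apply: inlR_inj; rewrite rmorphB -!DE e subrr.
Qed.

Lemma RV_coord_uniq (c c' : 'I_m -> R) :
  \sum_i bmk a (c i) (w i) = \sum_i bmk a (c' i) (w i) :> RV a N -> c =1 c'.
Proof.
have [D [_ DE]] := RV_to_RLN_coord.
move=> e i; apply/eqP; rewrite -subr_eq0; apply/eqP.
by apply: inlR_inj; rewrite rmorphB -!DE e subrr.
Qed.

End Basis.

Definition phiR : RLN -> RLN := blift (E_RL a) (fun x n => bmk (E_RL a) (sRL a x) (pphi N n)).

Lemma phiR_bal : bbalanced (E_RL a) (fun x n => bmk (E_RL a) (sRL a x) (pphi N n)).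
Proof.
split=> [x x' n|x n n'|c x n]; first by rewrite rmorphD bmkDl.
  by rewrite raddfD bmkDr.
rewrite rmorphM pphiZ -bmkZ; congr (bmk _ (_ * _) _).
by rewrite [LHS]sRL_inrR tsEL.
Qed.
Lemma phiR_mk x n : phiR (bmk (E_RL a) x n) = bmk (E_RL a) (sRL a x) (pphi N n).
Proof. exact: (blift_mk phiR_bal). Qed.
Lemma phiRD : {morph phiR : x y / x + y}.
Proof. exact: (bliftD phiR_bal). Qed.
Lemma phiR0 : phiR 0 = 0.
Proof. exact: (blift0 phiR_bal). Qed.
Lemma phiR_sum I (s : seq I) (x : I -> RLN) :
  phiR (\sum_(i <- s) x i) = \sum_(i <- s) phiR (x i).
Proof. exact: (big_morph phiR phiRD phiR0). Qed.
Lemma phiRZ c x : phiR (c *: x) = sRL a c *: phiR x.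
Proof.
elim/baseChange_ind: x => [|l n|x y IHx IHy].
- by rewrite scaler0 phiR0 scaler0.
- by rewrite bmkZl !phiR_mk bmkZl rmorphM.
- by rewrite scalerDr !phiRD IHx IHy scalerDr.
Qed.
Lemma phiR_LM x : phiR (LM_RLN x) = LM_RLN (phiL x).
Proof.
elim/LM_ind: x => [|x y IHx IHy|l x IHx|n].
- by rewrite phiL0 LM_RLN0 phiR0.
- by rewrite phiLD !LM_RLND phiRD IHx IHy.
- by rewrite phiLZ !LM_RLNZ phiRZ IHx sRL_inrR.
- by rewrite phiL_one !LM_RLN_one phiR_mk rmorph1.
Qed.
Lemma phiR_RV (x : RV a N) : phiR (RV_to_RLN x) = RV_to_RLN x.
Proof.
elim/(@baseChange_ind _ _ a (VM N)): x => [|r v|x y IHx IHy].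
- by rewrite RV_to_RLN0 phiR0.
- by rewrite RV_to_RLN_mk phiRZ sRL_inlR phiR_LM vLP.
- by rewrite RV_to_RLND phiRD IHx IHy.
Qed.

(** Along solutions, the coordinates of a fixed vector are fixed by id (x) sigma, so they are in [R]
    by [sRL_fixed]. *)
Lemma phiR_fixed m (w : 'I_m -> VM N) : solbasis w ->
  forall z : RLN, phiR z = z -> exists y : RV a N, RV_to_RLN y = z.
Proof.
move=> wB z; have [D [zE DE]] := RV_to_RLN_coord wB => pz.
have sD i : sRL a (D i z) = D i z.
  have [d [dE dd]] := solbasis_coord gT wB.
  have DW k : D i (LM_RLN (vL (w k))) = (k == i)%:R.
    have := DE i (fun j => (j == k)%:R).
    rewrite (bigD1 k) //= eqxx big1 => [|j /negbTE ->]; last first.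
      by apply: (@addrI _ (bmk a 0 (w j))); rewrite -bmkDl !addr0.
    by rewrite addr0 RV_to_RLN_mk rmorph1 scale1r rmorph_nat eq_sym.
  rewrite -[in RHS]pz [in RHS](zE z) phiR_sum linear_sum (bigD1 i) //=.
  rewrite phiRZ phiR_LM vLP linearZ /= DW eqxx [_ *: _]mulr1 big1 ?addr0 // => k /negbTE ki.
  by rewrite phiRZ phiR_LM vLP linearZ /= DW ki [_ *: _]mulr0.
have /choice[c cE] i : exists y, inlR y = D i z := sRL_fixed gT (sD i).
exists (\sum_i bmk a (c i) (w i)); rewrite RV_to_RLN_sum [RHS]zE.
by apply: eq_bigr => i _; rewrite RV_to_RLN_mk cE.
Qed.

End Object.
End PointsOfV.

(** * The action of Gamma through representatives over Sigma *)

Section Action.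
Context (T : frobTower) (gT : simple_tower T).
Local Notation F := (tF T).
Local Notation E := (tE T).
Local Notation L := (tL T).
Local Notation EL := (tEL T).
Local Notation FL := (tFL T).
Context (r : nat) (Phi : GL E r) (Psi : GL L r).
Context (Psi_Phi : map_mx (tsL T) Psi = map_mx EL Phi *m Psi).
Local Notation n := (r * r + 1)%N.
Local Notation sigma_seq R N := (seq (R * {mpoly E[n]} * N)).

Section FixedRing.
Context (R : comPzRingType) (a : {rmorphism F -> R}).

Lemma bmk_sum (R1 A1 : comPzRingType) (f1 : {rmorphism R1 -> A1}) (V1 : lmodType R1)
    I (s : seq I) (x : I -> A1) (v : V1) :
  bmk f1 (\sum_(i <- s) x i) v = \sum_(i <- s) bmk f1 (x i) v.
Proof.
apply: (big_morph (fun x => bmk f1 x v)) => [y y'|]; first exact: bmkDl.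
by apply: (@addrI _ (bmk f1 0 v)); rewrite -bmkDl !addr0.
Qed.

Lemma bmk_lincomb (R1 A1 : comPzRingType) (f1 : {rmorphism R1 -> A1}) (V1 : lmodType R1)
    (x : A1) m (c : 'I_m -> R1) (v : 'I_m -> V1) :
  bmk f1 x (\sum_i c i *: v i) = \sum_i bmk f1 (f1 (c i) * x) (v i).
Proof.
under [RHS]eq_bigr do rewrite bmkZ.
apply: (big_morph (bmk f1 x)) => [y y'|]; first exact: bmkDr.
by apply: (@addrI _ (bmk f1 x 0)); rewrite -bmkDr !addr0.
Qed.

Section Object.
Context (N : phiMod T) (gN : good Psi N).
Local Notation RLN := (baseChange (E_RL a) N).

Lemma sigma_elt_cat s t :
  sigma_elt Psi a (s ++ t : sigma_seq R N) = sigma_elt Psi a s + sigma_elt Psi a t.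
Proof. exact: big_cat. Qed.
Lemma sigma_act_cat (g : Gamma Psi a) s t :
  sigma_elt_act g (s ++ t : sigma_seq R N) = sigma_elt_act g s + sigma_elt_act g t.
Proof. exact: big_cat. Qed.

Definition sigma_scale (c : R) (s : sigma_seq R N) : sigma_seq R N :=
  [seq ((c * p.1.1, p.1.2), p.2) | p <- s].

Lemma sigma_elt_scale c s :
  sigma_elt Psi a (sigma_scale c s) = inlR a c *: sigma_elt Psi a s.
Proof.
rewrite /sigma_elt big_map scaler_sumr; apply: eq_bigr => p _ /=.
by rewrite bmkZl -!inlrR_mk rmorphM mulrA.
Qed.
Lemma sigma_act_scale (g : Gamma Psi a) c s :
  sigma_elt_act g (sigma_scale c s) = inlR a c *: sigma_elt_act g s.
Proof.
rewrite /sigma_elt_act big_map scaler_sumr; apply: eq_bigr => p _ /=.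
rewrite bmkZl; congr bmk; rewrite mulrA; congr (_ * _).
exact: (rmorphM (inlR a)).
Qed.

Lemma sigma_exists (x : RV a N) : exists s : sigma_seq R N, RV_to_RLN x = sigma_elt Psi a s.
Proof.
elim/(@baseChange_ind _ _ a (VM N)): x => [|c v|x y [s sE] [t tE]].
- by exists [::]; rewrite RV_to_RLN0 /sigma_elt big_nil.
- have [s sE] := sspan_seq (good_A gN v).
  exists [seq ((c, p.1), p.2) | p <- s]; rewrite RV_to_RLN_mk sE LM_RLN_sum.
  rewrite /sigma_elt big_map scaler_sumr; apply: eq_bigr => p _ /=.
  by rewrite LM_RLNZ LM_RLN_one scalerA bmkZl mulr1 inlrR_mk.
- by exists (s ++ t); rewrite RV_to_RLND sE tE sigma_elt_cat.
Qed.

Lemma E_functional (d : {linear N -> E^o}) :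
  bbalanced (E_RL a) (fun (x : RL a) (v : N) => x * E_RL a (d v) : RL a).
Proof.
split=> [x x' v|x v v'|c x v]; first by rewrite mulrDl.
  by rewrite linearD rmorphD mulrDr.
have -> : (d (c *: v) : E) = c * d v by exact: (linearZ_LR d c v).
by rewrite rmorphM mulrCA mulrA.
Qed.

(** Well-definedness of the action. Coordinates along an [E]-basis of [N] reduce it to relations in
    R (x)_F Sigma, where [stable_tensor] applies. *)
Lemma sigma_act_eq0 (g : Gamma Psi a) (s : sigma_seq R N) :
  sigma_elt Psi a s = 0 -> sigma_elt_act g s = 0.
Proof.
move=> s0; have [k [e se]] := good_fin gN.
have [m [f [fr sp]]] := basis_extract (st_E gT) e.
have se' x : lspan (e \o f) x by have [c ->] := se x; apply: lspan_sum.
have [d [dE _]] := basis_coord fr se'.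
have z j : \sum_(p <- s) inlR a p.1.1 *
    (evalGL (E_RL a) p.1.2 (Psi_act g) * E_RL a (d j p.2)) = 0.
  have := congr1 (blift (E_RL a) (fun (x : RL a) (v : N) => x * E_RL a (d j v) : RL a)) s0.
  rewrite (blift0 (E_functional (d j))) (blift_sum (E_functional (d j))).
  under eq_bigr do rewrite (blift_mk (E_functional (d j))).
  case: s {s0} => [|p0 s] h; first by rewrite big_nil.
  move: h; rewrite !(sum_seq_ord p0) => h.
  have H := @stable_tensor T r Psi R a g R F (st_F gT) (tFE T) a FL (inlR a)
    (Gamma_stable gT Psi_Phi g) (fun=> erefl) (inlrR a) _
    (fun i => (nth p0 (p0 :: s) i).1.1)
    (fun i : 'I_(size (p0 :: s)) => (nth p0 (p0 :: s) i).1.2 * (d j (nth p0 (p0 :: s) i).2)%:MP).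
  rewrite -[RHS]H; last first.
    rewrite -[RHS]h; apply: eq_bigr => i _.
    by rewrite evalGLM evalGLC -!inlrR_mk rmorphM mulrA.
  by apply: eq_bigr => i _; rewrite evalGLM evalGLC.
have bE (x : RL a) (v : N) : bmk (E_RL a) x v =
    \sum_j bmk (E_RL a) (E_RL a (d j v) * x) ((e \o f) j).
  by rewrite [v in LHS]dE bmk_lincomb.
rewrite /sigma_elt_act; under eq_bigr do rewrite bE.
rewrite exchange_big big1 //= => j _; rewrite -bmk_sum.
rewrite -[RHS](_ : bmk (E_RL a) (0 : RL a) ((e \o f) j) = 0); last first.
  by apply: (@addrI _ (bmk (E_RL a) 0 ((e \o f) j))); rewrite -bmkDl !addr0.
congr bmk; rewrite -[RHS](z j); apply: eq_bigr => p _.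
by rewrite mulrC -mulrA.
Qed.

Lemma sigma_act_eq (g : Gamma Psi a) (s s' : sigma_seq R N) :
  sigma_elt Psi a s = sigma_elt Psi a s' -> sigma_elt_act g s = sigma_elt_act g s'.
Proof.
move=> e; apply/eqP; rewrite -subr_eq0 -scaleN1r -[-1](rmorphN1 (inlR a)).
rewrite -sigma_act_scale -sigma_act_cat; apply/eqP; apply: sigma_act_eq0.
by rewrite sigma_elt_cat sigma_elt_scale rmorphN1 scaleN1r e subrr.
Qed.

(* The effect of [phi] on [Sigma (x)_E N], as [sigma Psi = Phi Psi]. *)
Lemma Phi_twist : exists tw : {mpoly E[n]} -> {mpoly E[n]},
  forall h (S : comPzRingType) (w : {rmorphism E -> S}) (U : GL S r),
  evalGL (w \o tsE T) h (glM (glmap w Phi) U) = evalGL w (tw h) U.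
Proof.
suff /choice[tw twE] : forall h, exists q : {mpoly E[n]},
    forall (S : comPzRingType) (w : {rmorphism E -> S}) (U : GL S r),
    evalGL (w \o tsE T) h (glM (glmap w Phi) U) = evalGL w q U by exists tw.
move=> h; have [s sE] := @evalGL_mull E E E r (tsE T) h Phi.
exists (\sum_(x <- s) x.1%:MP * x.2) => S w U.
rewrite (sE S w w U) evalGL_sum; apply: eq_bigr => x _.
by rewrite evalGLM evalGLC.
Qed.

(** The entries of [g] are fixed, so Frobenius sends Psi g to Phi Psi g just as it sends [Psi] to
    Phi Psi. One and the same twist of [s] therefore describes phi before and after the action. *)
Lemma sigma_act_phi (g : Gamma Psi a) (s : sigma_seq R N) :
  exists s' : sigma_seq R N, phiR (sigma_elt Psi a s) = sigma_elt Psi a s' /\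
    phiR (sigma_elt_act g s) = sigma_elt_act g s'.
Proof.
have [tw twE] := Phi_twist.
exists [seq ((p.1.1, tw p.1.2), pphi N p.2) | p <- s].
rewrite /sigma_elt /sigma_elt_act !big_map !phiR_sum; split; apply: eq_bigr => p _ /=.
  rewrite phiR_mk -!inlrR_mk rmorphM sRL_inlR sRL_inrR; congr (bmk _ (_ * inrR a _) _).
  rewrite -evalGL_map -twE; apply: eq_evalGL => [x|]; first exact: tsEL.
  exact: Psi_Phi.
rewrite phiR_mk; congr bmk; rewrite rmorphM; congr (_ * _); first exact: sRL_inl.
rewrite -evalGL_map -twE; apply: eq_evalGL => [x|].
  by rewrite /= [LHS]sRL_inrR tsEL.
rewrite /= map_mxM mulmxA; congr (_ *m _); last first.
  by apply/matrixP => i j; rewrite !mxE [LHS]sRL_inl.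
rewrite -[map_mx (E_RL a) Phi]/(map_mx (inrR a \o EL) Phi) map_mx_comp.
rewrite -[map_mx (inr_t a FL) Psi]/(map_mx (inrR a) Psi) -map_mxM -Psi_Phi.
by apply/matrixP => i j; rewrite !mxE [LHS]sRL_inrR.
Qed.

End Object.

(** A relation, since a representative over Sigma is not unique and its image under [g] must first
    be shown to return to R (x)_F V(N). Compatibilities of the action are then proved by exhibiting
    one representative. *)
Definition Act (g : Gamma Psi a) (N : phiMod T) (x y : RV a N) : Prop :=
  exists s : sigma_seq R N, RV_to_RLN x = sigma_elt Psi a s /\
    RV_to_RLN y = sigma_elt_act g s.

Lemma Act_all g N (gN : good Psi N) (x y : RV a N) : Act g x y ->
  forall s, RV_to_RLN x = sigma_elt Psi a s -> RV_to_RLN y = sigma_elt_act g s.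
Proof. by move=> [t [xt ->]] s xs; apply: (sigma_act_eq gN); rewrite -xt. Qed.

Lemma Act_fun g N (gN : good Psi N) (x y y' : RV a N) : Act g x y -> Act g x y' -> y = y'.
Proof.
move=> h [s [xs ys]]; have [m [w wB]] := good_solbasis gT gN.
by apply: (RV_to_RLN_inj gT wB); rewrite ys (Act_all gN h xs).
Qed.

(** As [x] is fixed by phi, the lists [s] and [s'] represent the same vector, and so do their images
    under [g]; hence the image of [s] is fixed and [phiR_fixed] provides [y]. *)
Lemma Act_total g N (gN : good Psi N) (x : RV a N) : exists y, Act g x y.
Proof.
have [s xs] := sigma_exists gN x.
have [s' [e1 e2]] := sigma_act_phi g s.
have [m [w wB]] := good_solbasis gT gN.
have [|y yE] := phiR_fixed gT wB (z := sigma_elt_act g s).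
  by rewrite e2; apply: (sigma_act_eq gN); rewrite -e1 -xs phiR_RV.
by exists y, s.
Qed.

Lemma Act_lin g N c (x x' y y' : RV a N) : Act g x y -> Act g x' y' ->
  Act g (c *: x + x') (c *: y + y').
Proof.
move=> [s [xs ys]] [s' [xs' ys']]; exists (sigma_scale c s ++ s').
rewrite !RV_to_RLND !RV_to_RLNZ sigma_elt_cat sigma_act_cat.
by rewrite sigma_elt_scale sigma_act_scale xs ys xs' ys'.
Qed.

Section Map.
Context (N N' : phiMod T) (f : phiHom N N').

Lemma RVmap_bal : bbalanced a (fun c x => bmk a c (Vmap f x)).
Proof.
split=> [c c' x|c x x'|d c x]; first by rewrite bmkDl.
  by rewrite -bmkDr -[Vmap f (x + x')]/(Vlin f (x + x')) linearD.
by rewrite bmkZ -[Vmap f (d *: x)]/(Vlin f (d *: x)) linearZ.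
Qed.
Lemma RVmap_mk c v : RVmap f (bmk a c v : RV a N) = bmk a c (Vmap f v).
Proof. exact: (blift_mk RVmap_bal). Qed.
Lemma RVmapD : {morph @RVmap T R a N N' f : x y / x + y}.
Proof. exact: (bliftD RVmap_bal). Qed.
Lemma RVmap0 : RVmap f (0 : RV a N) = 0.
Proof. exact: (blift0 RVmap_bal). Qed.
Lemma RVmapZ c (x : RV a N) : RVmap f (c *: x) = c *: RVmap f x.
Proof.
elim/(@baseChange_ind _ _ a (VM N)): x => [|l' x|x y IHx IHy].
- by rewrite scaler0 RVmap0 scaler0.
- by rewrite bmkZl !RVmap_mk bmkZl.
- by rewrite scalerDr !RVmapD IHx IHy scalerDr.
Qed.

Definition RLNmap : baseChange (E_RL a) N -> baseChange (E_RL a) N' :=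
  blift (E_RL a) (fun x v => bmk (E_RL a) x (f v)).
Lemma RLNmap_bal : bbalanced (E_RL a) (fun x v => bmk (E_RL a) x (f v)).
Proof.
split=> [c c' x|c x x'|d c x]; first by rewrite bmkDl.
  by rewrite linearD bmkDr.
by rewrite linearZ bmkZ.
Qed.
Lemma RLNmap_mk x v : RLNmap (bmk (E_RL a) x v) = bmk (E_RL a) x (f v).
Proof. exact: (blift_mk RLNmap_bal). Qed.
Lemma RLNmapD : {morph RLNmap : x y / x + y}.
Proof. exact: (bliftD RLNmap_bal). Qed.
Lemma RLNmap0 : RLNmap 0 = 0.
Proof. exact: (blift0 RLNmap_bal). Qed.
Lemma RLNmapZ c x : RLNmap (c *: x) = c *: RLNmap x.
Proof.
elim/(@baseChange_ind _ _ (E_RL a) N): x => [|l' x|x y IHx IHy].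
- by rewrite scaler0 RLNmap0 scaler0.
- by rewrite bmkZl !RLNmap_mk bmkZl.
- by rewrite scalerDr !RLNmapD IHx IHy scalerDr.
Qed.
Lemma RLNmap_LM x : RLNmap (LM_RLN a x) = LM_RLN a (LMmap f x).
Proof.
elim/LM_ind: x => [|x y IHx IHy|l x IHx|x].
- by rewrite LM_RLN0 RLNmap0 LMmap0 LM_RLN0.
- by rewrite LM_RLND RLNmapD LMmapD LM_RLND IHx IHy.
- by rewrite LM_RLNZ RLNmapZ LMmapZ LM_RLNZ IHx.
- by rewrite LMmap_one !LM_RLN_one RLNmap_mk.
Qed.
Lemma RV_to_RLN_map (x : RV a N) : RV_to_RLN (RVmap f x) = RLNmap (RV_to_RLN x).
Proof.
elim/(@baseChange_ind _ _ a (VM N)): x => [|c v|x y IHx IHy].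
- by rewrite RVmap0 !RV_to_RLN0 RLNmap0.
- by rewrite RVmap_mk !RV_to_RLN_mk RLNmapZ RLNmap_LM.
- by rewrite RVmapD !RV_to_RLND RLNmapD IHx IHy.
Qed.

Lemma Act_nat g (x y : RV a N) : Act g x y -> Act g (RVmap f x) (RVmap f y).
Proof.
move=> [s [xs ys]]; exists [seq (p.1, f p.2) | p <- s].
rewrite !RV_to_RLN_map xs ys /sigma_elt /sigma_elt_act !big_map.
rewrite !(big_morph RLNmap RLNmapD RLNmap0).
by split; apply: eq_bigr => p _; rewrite RLNmap_mk.
Qed.
End Map.
End FixedRing.
End Action.

(** * The action on tensor products, under multiplication of points and under change of R *)

Section ActionTensor.
Context (T : frobTower) (gT : simple_tower T).
Local Notation F := (tF T).
Local Notation E := (tE T).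
Local Notation L := (tL T).
Local Notation EL := (tEL T).
Local Notation FL := (tFL T).
Context (r : nat) (Phi : GL E r) (Psi : GL L r).
Context (Psi_Phi : map_mx (tsL T) Psi = map_mx EL Phi *m Psi).
Local Notation n := (r * r + 1)%N.
Local Notation sigma_seq R N := (seq (R * {mpoly E[n]} * N)).
Context (R : comPzRingType) (a : {rmorphism F -> R}).

Section Tensor.
Context (N N' : phiMod T).
Local Notation RLN := (baseChange (E_RL a) N).
Local Notation RLN' := (baseChange (E_RL a) N').
Local Notation RLNN' := (baseChange (E_RL a) (tensMod N N')).

Lemma muVDl (v1 v2 : VM N) (v' : VM N') : muV (v1 + v2) v' = muV v1 v' + muV v2 v'.
Proof. by apply: vL_inj; rewrite vLD !vL_muV vLD muLDl. Qed.
Lemma muVDr (v : VM N) (v1 v2 : VM N') : muV v (v1 + v2) = muV v v1 + muV v v2.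
Proof. by apply: vL_inj; rewrite vLD !vL_muV vLD muLDr. Qed.
Lemma muVZl c (v : VM N) (v' : VM N') : muV (c *: v) v' = c *: muV v v'.
Proof. by apply: vL_inj; rewrite vLZ !vL_muV vLZ muLZl. Qed.
Lemma muVZr c (v : VM N) (v' : VM N') : muV v (c *: v') = c *: muV v v'.
Proof. by apply: vL_inj; rewrite vLZ !vL_muV vLZ muLZr. Qed.

Lemma muRV_bal2 c v : bbalanced a (fun c' (v' : VM N') =>
  bmk a (c * c') (muV v v') : RV a (tensMod N N')).
Proof.
split=> [c1 c2 v'|c1 v1 v2|d c1 v']; first by rewrite mulrDr bmkDl.
  by rewrite muVDr bmkDr.
by rewrite muVZr mulrCA bmkZ.
Qed.
Lemma muRV_bal1 (y : RV a N') : bbalanced a (fun c (v : VM N) =>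
  blift a (fun c' (v' : VM N') => bmk a (c * c') (muV v v') : RV a (tensMod N N')) y).
Proof.
have b0 c v := blift0 (muRV_bal2 c v); have bD c v := bliftD (muRV_bal2 c v).
have bE c v := blift_mk (muRV_bal2 c v).
split=> [c c' v|c v v'|d c v]; elim/(@baseChange_ind _ _ a (VM N')): y => [|c2 v2|y y' IH IH'].
- by rewrite !b0 addr0.
- by rewrite !bE mulrDl bmkDl.
- by rewrite !bD IH IH' addrACA.
- by rewrite !b0 addr0.
- by rewrite !bE muVDl bmkDr.
- by rewrite !bD IH IH' addrACA.
- by rewrite !b0.
- by rewrite !bE muVZl -mulrA bmkZ.
- by rewrite !bD IH IH'.
Qed.
Lemma muRV_mk c v c' v' :
  muRV (bmk a c v : RV a N) (bmk a c' v' : RV a N') = bmk a (c * c') (muV v v').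
Proof. by rewrite /muRV (blift_mk (muRV_bal1 _)) (blift_mk (muRV_bal2 _ _)). Qed.
Lemma muRVDl x x' (y : RV a N') : muRV (x + x' : RV a N) y = muRV x y + muRV x' y.
Proof. exact: (bliftD (muRV_bal1 y)). Qed.
Lemma muRV0l (y : RV a N') : muRV (0 : RV a N) y = 0.
Proof. exact: (blift0 (muRV_bal1 y)). Qed.
Lemma muRVDr (x : RV a N) (y y' : RV a N') : muRV x (y + y') = muRV x y + muRV x y'.
Proof.
elim/(@baseChange_ind _ _ a (VM N)): x => [|c v|x x' IH IH'].
- by rewrite !muRV0l addr0.
- by rewrite /muRV !(blift_mk (muRV_bal1 _)) (bliftD (muRV_bal2 c v)).
- by rewrite !muRVDl IH IH' addrACA.
Qed.
Lemma muRV0r (x : RV a N) : muRV x (0 : RV a N') = 0.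
Proof. by apply: (@addrI _ (muRV x 0)); rewrite -muRVDr !addr0. Qed.

Definition muRLN (x : RLN) (y : RLN') : RLNN' :=
  blift (E_RL a) (fun c (v : N) => blift (E_RL a) (fun c' (v' : N') =>
    bmk (E_RL a) (c * c') (tpure v v' : tensMod N N')) y) x.
Lemma muRLN_bal2 c v : bbalanced (E_RL a) (fun c' (v' : N') =>
  bmk (E_RL a) (c * c') (tpure v v' : tensMod N N')).
Proof.
split=> [c1 c2 v'|c1 v1 v2|d c1 v']; first by rewrite mulrDr bmkDl.
  by rewrite tpureDr bmkDr.
by rewrite tpureZr mulrCA bmkZ.
Qed.
Lemma muRLN_bal1 (y : RLN') : bbalanced (E_RL a) (fun c (v : N) =>
  blift (E_RL a) (fun c' (v' : N') => bmk (E_RL a) (c * c') (tpure v v' : tensMod N N')) y).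
Proof.
have b0 c v := blift0 (muRLN_bal2 c v); have bD c v := bliftD (muRLN_bal2 c v).
have bE c v := blift_mk (muRLN_bal2 c v).
split=> [c c' v|c v v'|d c v]; elim/(@baseChange_ind _ _ (E_RL a) N'): y => [|c2 v2|y y' IH IH'].
- by rewrite !b0 addr0.
- by rewrite !bE mulrDl bmkDl.
- by rewrite !bD IH IH' addrACA.
- by rewrite !b0 addr0.
- by rewrite !bE tpureDl bmkDr.
- by rewrite !bD IH IH' addrACA.
- by rewrite !b0.
- by rewrite !bE tpureZl -mulrA bmkZ.
- by rewrite !bD IH IH'.
Qed.
Lemma muRLN_mk c (v : N) c' (v' : N') :
  muRLN (bmk (E_RL a) c v) (bmk (E_RL a) c' v') = bmk (E_RL a) (c * c') (tpure v v' : tensMod N N').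
Proof. by rewrite /muRLN (blift_mk (muRLN_bal1 _)) (blift_mk (muRLN_bal2 _ _)). Qed.
Lemma muRLNDl x x' y : muRLN (x + x') y = muRLN x y + muRLN x' y.
Proof. exact: (bliftD (muRLN_bal1 y)). Qed.
Lemma muRLN0l y : muRLN 0 y = 0.
Proof. exact: (blift0 (muRLN_bal1 y)). Qed.
Lemma muRLNDr x y y' : muRLN x (y + y') = muRLN x y + muRLN x y'.
Proof.
elim/(@baseChange_ind _ _ (E_RL a) N): x => [|c v|x x' IH IH'].
- by rewrite !muRLN0l addr0.
- by rewrite /muRLN !(blift_mk (muRLN_bal1 _)) (bliftD (muRLN_bal2 c v)).
- by rewrite !muRLNDl IH IH' addrACA.
Qed.
Lemma muRLN0r x : muRLN x 0 = 0.
Proof. by apply: (@addrI _ (muRLN x 0)); rewrite -muRLNDr !addr0. Qed.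
Lemma muRLNZ c c' x y : muRLN (c *: x) (c' *: y) = (c * c') *: muRLN x y.
Proof.
elim/(@baseChange_ind _ _ (E_RL a) N): x => [|d v|x x' IH IH'].
- by rewrite scaler0 !muRLN0l scaler0.
- elim/(@baseChange_ind _ _ (E_RL a) N'): y => [|d' v'|y y' IH IH'].
  + by rewrite scaler0 !muRLN0r scaler0.
  + by rewrite !bmkZl !muRLN_mk bmkZl mulrACA.
  + by rewrite scalerDr !muRLNDr IH IH' scalerDr.
- by rewrite scalerDr !muRLNDl IH IH' scalerDr.
Qed.
Lemma muRLN_LM x y : muRLN (LM_RLN a x) (LM_RLN a y) = LM_RLN a (muL x y).
Proof.
elim/(@baseChange_ind _ _ EL N): x => [|l v|x x' IH IH'].
- by rewrite muL0l !LM_RLN0 muRLN0l.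
- elim/(@baseChange_ind _ _ EL N'): y => [|l' v'|y y' IH IH'].
  + by rewrite muL0r !LM_RLN0 muRLN0r.
  + by rewrite muL_mk2 !LM_RLN_mk muRLN_mk rmorphM.
  + by rewrite muLDr !LM_RLND muRLNDr IH IH'.
- by rewrite muLDl !LM_RLND muRLNDl IH IH'.
Qed.
Lemma RV_to_RLN_mu (x : RV a N) (y : RV a N') :
  RV_to_RLN (muRV x y) = muRLN (RV_to_RLN x) (RV_to_RLN y).
Proof.
elim/(@baseChange_ind _ _ a (VM N)): x => [|c v|x x' IH IH'].
- by rewrite muRV0l !RV_to_RLN0 muRLN0l.
- elim/(@baseChange_ind _ _ a (VM N')): y => [|c' v'|y y' IH IH'].
  + by rewrite muRV0r !RV_to_RLN0 muRLN0r.
  + by rewrite muRV_mk !RV_to_RLN_mk muRLNZ muRLN_LM rmorphM.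
  + by rewrite muRVDr !RV_to_RLND muRLNDr IH IH'.
- by rewrite muRVDl !RV_to_RLND muRLNDl IH IH'.
Qed.
Lemma muRLN_sum I J (s : seq I) (t : seq J) x y :
  muRLN (\sum_(i <- s) x i) (\sum_(j <- t) y j) =
  \sum_(i <- s) \sum_(j <- t) muRLN (x i) (y j).
Proof.
rewrite (big_morph (fun z => muRLN z _) (fun z z' => muRLNDl z z' _) (muRLN0l _)).
by apply: eq_bigr => i _; rewrite (big_morph _ (muRLNDr (x i)) (muRLN0r (x i))).
Qed.

Lemma Act_tens (g : Gamma Psi a) (x x' : RV a N) (y y' : RV a N') :
  Act g x x' -> Act g y y' -> Act g (muRV x y) (muRV x' y').
Proof.
move=> [s [xs xs']] [t [yt yt']].
exists [seq ((p.1.1 * q.1.1, p.1.2 * q.1.2), tpure p.2 q.2 : tensMod N N') | p <- s, q <- t].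
rewrite !RV_to_RLN_mu xs xs' yt yt' /sigma_elt /sigma_elt_act !big_allpairs_dep !muRLN_sum.
split; apply: eq_bigr => p _; apply: eq_bigr => q _ /=; rewrite muRLN_mk; congr bmk.
  by rewrite evalGLM -!inlrR_mk !rmorphM mulrACA.
rewrite evalGLM mulrACA; congr (_ * _).
exact/esym/(rmorphM (inlR a)).
Qed.
End Tensor.

Lemma Act_unit (g : Gamma Psi a) (x : RV a (unitMod T)) : Act g x x.
Proof.
elim/(@baseChange_ind _ _ a (VM (unitMod T))): x => [|c v|x y IHx IHy].
- by exists [::]; rewrite RV_to_RLN0 /sigma_elt /sigma_elt_act !big_nil.
- have [d dE] : exists d, FL d = uval (vL v).
    by apply: (st_fix gT); rewrite -uval_phi vLP.
  exists [:: ((c, (tFE T d)%:MP), 1 : E^o)].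
  rewrite RV_to_RLN_mk [vL v]uvalE -dE LM_RLNZ LM_RLN_one.
  rewrite /sigma_elt /sigma_elt_act !big_seq1 /= !evalGLC scalerA bmkZl mulr1.
  by rewrite inlrR_mk.
- by have := Act_lin 1 IHx IHy; rewrite scale1r.
Qed.

(** A polynomial in U h is a combination of polynomials in U with coefficients in [R], with the same
    expansion for all U. At U = Psi it gives a representative of [y], and at U = Psi g the effect of
    [gh] on [x]. *)
Lemma Act_mul (g h gh : Gamma Psi a) N (x y z : RV a N) : gh = g *m h :> 'M_r ->
  good Psi N -> Act h x y -> Act g y z -> Act gh x z.
Proof.
move=> ghE gN [s [xs ys]] yz; exists s; split; first exact: xs.
have e1 q : evalGL (E_RL a) q (glM (actGL Psi a g) (glmap (inlR a) h)) =
    evalGL (E_RL a) q (Psi_act gh).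
  apply: eq_evalGL; first by move=> ?.
  rewrite -[RHS]/(map_mx (inrR a) Psi *m map_mx (inlR a) gh) ghE map_mxM.
  exact/esym/mulmxA.
have e2 q : evalGL (E_RL a) q (glmap (inrR a) Psi) = inrR a (evalGL EL q Psi).
  exact: evalGL_map.
suff /choice[t tE] : forall p : {mpoly E[n]}, exists t : seq (R * {mpoly E[n]}),
    forall U : GL (RL a) r, evalGL (E_RL a) p (glM U (glmap (inlR a) h)) =
      \sum_(x <- t) inlR a x.1 * evalGL (E_RL a) x.2 U.
  rewrite (Act_all gT Psi_Phi gN yz (s := flatten [seq [seq ((p.1.1 * q.1, q.2), p.2) | q <- t p.1.2] | p <- s])).
    rewrite /sigma_elt_act big_flatten big_map; apply: eq_bigr => p _.
    rewrite big_map -(bmk_sum (E_RL a)); congr bmk.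
    rewrite -e1 tE mulr_sumr; apply: eq_bigr => q _.
    rewrite mulrA; congr (_ * _); exact: (rmorphM (inlR a)).
  rewrite ys /sigma_elt /sigma_elt_act big_flatten big_map; apply: eq_bigr => p _.
  rewrite big_map -(bmk_sum (E_RL a)); congr bmk.
  transitivity (inlR a p.1.1 * evalGL (E_RL a) p.1.2 (glM (glmap (inrR a) Psi) (glmap (inlR a) h))).
    by congr (_ * _); apply: eq_evalGL.
  rewrite tE mulr_sumr; apply: eq_bigr => q _.
  by rewrite e2 mulrA -rmorphM inlrR_mk.
move=> p; have [t tE] := evalGL_mulr p h.
by exists t; exact: tE.
Qed.

Section BaseChange.
Context (R' : comPzRingType) (a' : {rmorphism F -> R'}) (u : {rmorphism R -> R'}).
Context (ua : forall c, u (a c) = a' c).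

Definition RLu_l : {rmorphism R -> RL a'} := inlR a' \o u.
Fact RLu_compat c : RLu_l (a c) = inrR a' (FL c).
Proof. by rewrite /RLu_l -inlrR /= ua. Qed.
Definition RLu : {rmorphism RL a -> RL a'} := tensR_desc RLu_compat.
Lemma RLu_inl c : RLu (inlR a c) = inlR a' (u c).
Proof.
apply: etrans (tensR_desc_mk RLu_compat c 1) _.
by rewrite (rmorph1 (inrR a')) mulr1.
Qed.
Lemma RLu_inr l : RLu (inrR a l) = inrR a' l.
Proof.
apply: etrans (tensR_desc_mk RLu_compat 1 l) _.
by rewrite (rmorph1 RLu_l) mul1r.
Qed.

Section Object.
Context (N : phiMod T).
Lemma RVbc_bal : bbalanced a (fun c (v : VM N) => bmk a' (u c) v).
Proof.
split=> [c c' v|c v v'|d c v]; first by rewrite rmorphD bmkDl.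
  by rewrite bmkDr.
by rewrite rmorphM ua bmkZ.
Qed.
Lemma RVbc_mk c v : RVbc a' u (bmk a c v : RV a N) = bmk a' (u c) v.
Proof. exact: (blift_mk RVbc_bal). Qed.
Lemma RVbcD : {morph @RVbc T R R' a a' u N : x y / x + y}.
Proof. exact: (bliftD RVbc_bal). Qed.
Lemma RVbc0 : RVbc a' u (0 : RV a N) = 0.
Proof. exact: (blift0 RVbc_bal). Qed.

Definition RLNu : baseChange (E_RL a) N -> baseChange (E_RL a') N :=
  blift (E_RL a) (fun x v => bmk (E_RL a') (RLu x) v).
Lemma RLNu_bal : bbalanced (E_RL a) (fun x (v : N) => bmk (E_RL a') (RLu x) v).
Proof.
split=> [c c' v|c v v'|d c v]; first by rewrite rmorphD bmkDl.
  by rewrite bmkDr.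
rewrite rmorphM -bmkZ; congr (bmk _ (_ * _) _).
exact: RLu_inr.
Qed.
Lemma RLNu_mk c v : RLNu (bmk (E_RL a) c v) = bmk (E_RL a') (RLu c) v.
Proof. exact: (blift_mk RLNu_bal). Qed.
Lemma RLNuD : {morph RLNu : x y / x + y}.
Proof. exact: (bliftD RLNu_bal). Qed.
Lemma RLNu0 : RLNu 0 = 0.
Proof. exact: (blift0 RLNu_bal). Qed.
Lemma RLNuZ c x : RLNu (c *: x) = RLu c *: RLNu x.
Proof.
elim/(@baseChange_ind _ _ (E_RL a) N): x => [|l' x|x y IHx IHy].
- by rewrite scaler0 RLNu0 scaler0.
- by rewrite bmkZl !RLNu_mk bmkZl rmorphM.
- by rewrite scalerDr !RLNuD IHx IHy scalerDr.
Qed.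
Lemma RLNu_LM x : RLNu (LM_RLN a x) = LM_RLN a' x.
Proof.
elim/LM_ind: x => [|x y IHx IHy|l x IHx|x].
- by rewrite !LM_RLN0 RLNu0.
- by rewrite !LM_RLND RLNuD IHx IHy.
- by rewrite !LM_RLNZ RLNuZ RLu_inr IHx.
- by rewrite !LM_RLN_one RLNu_mk rmorph1.
Qed.
Lemma RV_to_RLN_bc (x : RV a N) : RV_to_RLN (RVbc a' u x) = RLNu (RV_to_RLN x).
Proof.
elim/(@baseChange_ind _ _ a (VM N)): x => [|c v|x y IHx IHy].
- by rewrite RVbc0 !RV_to_RLN0 RLNu0.
- by rewrite RVbc_mk !RV_to_RLN_mk RLNuZ RLNu_LM RLu_inl.
- by rewrite RVbcD !RV_to_RLND RLNuD IHx IHy.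
Qed.

Lemma Act_bc (g : Gamma Psi a) (g' : Gamma Psi a') (x y : RV a N) :
  g' = map_mx u g :> 'M_r -> Act g x y -> Act g' (RVbc a' u x) (RVbc a' u y).
Proof.
move=> g'E [s [xs ys]]; exists [seq ((u p.1.1, p.1.2), p.2) | p <- s].
rewrite !RV_to_RLN_bc xs ys /sigma_elt /sigma_elt_act !big_map.
rewrite !(big_morph RLNu RLNuD RLNu0).
split; apply: eq_bigr => p _; rewrite RLNu_mk /=; congr bmk.
  by rewrite -!inlrR_mk rmorphM RLu_inl RLu_inr.
rewrite rmorphM; congr (_ * _); first exact: RLu_inl.
rewrite -evalGL_map; apply: eq_evalGL => [z|]; first exact: RLu_inr.
rewrite /= g'E map_mxM; congr (_ *m _); apply/matrixP => i j; rewrite !mxE.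
  exact: RLu_inr.
exact: RLu_inl.
Qed.
End Object.
End BaseChange.

Section Self.
Context (M : phiMod T) (m : 'I_r -> M) (m_basis : is_basis m).
Context (Phi_m : forall i, pphi M (m i) = \sum_l Phi i l *: m l).
Local Notation sol := (sol Phi_m Psi_Phi).

(** Replacing [Psi] by Psi g in Psi^-1 m gives g^-1 Psi^-1 m, whence the inverse of [g]. *)
Lemma Act_sol (g : Gamma Psi a) i :
  Act g (bmk a 1 (sol i) : RV a M) (\sum_k bmk a (glinv g i k) (sol k)).
Proof.
suff /choice[q qE] : forall l, exists q : {mpoly E[n]}, forall (S : comPzRingType)
    (u : {rmorphism E -> S}) (U : GL S r), evalGL u q U = glinv U i l.
  exists [seq ((1, q l), m l) | l <- index_enum 'I_r].
  rewrite RV_to_RLN_sum /sigma_elt /sigma_elt_act !big_map; split.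
    rewrite RV_to_RLN_mk rmorph1 scale1r vL_sol LM_RLN_sum; apply: eq_bigr => l _.
    by rewrite LM_RLNZ LM_RLN_one bmkZl mulr1 qE -inlrR_mk rmorph1 mul1r.
  transitivity (\sum_l (\sum_k inlR a (glinv g i k) * inrR a (glinv Psi k l)) *:
      LM_RLN a (one_t (m l))).
    under eq_bigr => k _ do rewrite RV_to_RLN_mk vL_sol LM_RLN_sum scaler_sumr.
    rewrite exchange_big; apply: eq_bigr => l _ /=; rewrite scaler_suml.
    by apply: eq_bigr => k _; rewrite LM_RLNZ scalerA.
  apply: eq_bigr => l _; rewrite LM_RLN_one bmkZl mulr1; congr bmk.
  rewrite -[inl_t a FL 1]/(inlR a 1) rmorph1 mul1r qE /= mxE.
  by apply: eq_bigr => k _; rewrite !mxE.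
move=> l; have [q qE] := evalGL_inv ('X_(lshift 1 (mxvec_index i l)) : {mpoly E[n]}).
by exists q => S u U; rewrite qE evalGLX glvar_entry.
Qed.
End Self.
End ActionTensor.


(** * Tensor automorphisms of V *)

Section TensorAutomorphisms.
Context (T : frobTower) (gT : simple_tower T).
Local Notation F := (tF T).
Local Notation E := (tE T).
Local Notation L := (tL T).
Local Notation EL := (tEL T).
Local Notation FL := (tFL T).
Context (r : nat) (Phi : GL E r) (Psi : GL L r).
Context (Psi_Phi : map_mx (tsL T) Psi = map_mx EL Phi *m Psi).
Context (M : phiMod T) (m : 'I_r -> M) (m_basis : is_basis m).
Context (Phi_m : forall i, pphi M (m i) = \sum_l Phi i l *: m l).
Local Notation n := (r * r + 1)%N.
Local Notation sigma_seq R N := (seq (R * {mpoly E[n]} * N)).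
Local Notation sol := (sol Phi_m Psi_Phi).

Let gd (N : tanObj M) : good Psi N := good_gen gT m_basis Phi_m Psi_Phi (tobjP N).

Section Points.
Context (R : comPzRingType) (a : {rmorphism F -> R}).

Lemma taut_ext (t t' : tensAut a M) : (forall N x, t N x = t' N x) -> t = t'.
Proof.
case: t t' => [t p1 p2 p3 p4 p5] [t' q1 q2 q3 q4 q5] /= e.
have {}e : t = t'.
  by apply: functional_extensionality_dep => N; apply/funext => x; exact: e.
by subst t'; congr TensAut; exact: Prop_irrelevance.
Qed.

Lemma tautD (t : tensAut a M) (N : tanObj M) : {morph t N : x y / x + y}.
Proof. by move=> x y; have := taut_lin t 1 x y; rewrite !scale1r. Qed.
Lemma taut0 (t : tensAut a M) (N : tanObj M) : t N 0 = 0.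
Proof. by apply: (@addrI _ (t N 0)); rewrite -tautD !addr0. Qed.
Lemma tautZ (t : tensAut a M) (N : tanObj M) c x : t N (c *: x) = c *: t N x.
Proof. by rewrite -[c *: x]addr0 taut_lin taut0 addr0. Qed.
Lemma taut_sum (t : tensAut a M) (N : tanObj M) I (s : seq I) (x : I -> RV a N) :
  t N (\sum_(i <- s) x i) = \sum_(i <- s) t N (x i).
Proof.
elim: s => [|i s IH]; first by rewrite !big_nil taut0.
by rewrite !big_cons tautD IH.
Qed.

Lemma Act_one (e : Gamma Psi a) N (x : RV a N) : e = 1%:M :> 'M_r ->
  good Psi N -> Act e x x.
Proof.
move=> e1 gN; have [s xs] := sigma_exists gN x; exists s; split; first exact: xs.
rewrite xs /sigma_elt /sigma_elt_act; apply: eq_bigr => p _; congr bmk.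
rewrite -inlrR_mk; congr (_ * _).
rewrite -[LHS](evalGL_map EL (inrR a)); apply: eq_evalGL; first by [].
rewrite -[RHS]/(map_mx (inrR a) Psi *m map_mx (inlR a) e) e1 map_mx1.
exact/esym/mulmx1.
Qed.

Section Element.
Context (g : Gamma Psi a).

Definition pi_fun (N : tanObj M) (x : RV a N) : RV a N :=
  projT1 (cid (Act_total gT Psi_Phi g (gd N) x)).
Lemma pi_funP (N : tanObj M) (x : RV a N) : Act g x (pi_fun x).
Proof. exact: (projT2 (cid (Act_total gT Psi_Phi g (gd N) x))). Qed.
Lemma pi_funE (N : tanObj M) (x y : RV a N) : Act g x y -> pi_fun x = y.
Proof. by move=> h; apply: (Act_fun gT Psi_Phi (gd N) (pi_funP x) h). Qed.

Lemma pi_fun_lin (N : tanObj M) c (x y : RV a N) :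
  pi_fun (c *: x + y : RV a N) = c *: pi_fun x + pi_fun y.
Proof. by apply: pi_funE; apply: Act_lin; exact: pi_funP. Qed.
Lemma pi_fun_nat (N N' : tanObj M) (f : phiHom N N') (x : RV a N) :
  @pi_fun N' (RVmap f x) = RVmap f (pi_fun x).
Proof. by apply: pi_funE; apply: Act_nat; exact: pi_funP. Qed.
Lemma pi_fun_tens (N N' : tanObj M) (x : RV a N) (y : RV a N') :
  @pi_fun (tanTens N N') (muRV x y) = muRV (pi_fun x) (pi_fun y).
Proof. by apply: pi_funE; apply: Act_tens; exact: pi_funP. Qed.
Lemma pi_fun_unit (x : RV a (tanUnit M)) : @pi_fun (tanUnit M) x = x.
Proof. by apply: pi_funE; exact: (Act_unit gT). Qed.
End Element.

Lemma pi_fun_mul (g h gh : Gamma Psi a) (N : tanObj M) (x : RV a N) :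
  gh = g *m h :> 'M_r -> pi_fun gh x = pi_fun g (pi_fun h x).
Proof.
move=> e; apply: pi_funE; apply: (Act_mul gT Psi_Phi e (gd N)); exact: pi_funP.
Qed.

(** The inverse is the action of the inverse point, so this rests on Gamma being a group. *)
Lemma pi_fun_bij (g : Gamma Psi a) (N : tanObj M) : bijective (@pi_fun g N).
Proof.
have [[e eE] _ /(_ g)[g' g'E]] := Gamma_subgroupP gT Psi_Phi a.
have pe x : @pi_fun e N x = x by apply: pi_funE; exact: Act_one (gd N).
exists (@pi_fun g' N) => x; rewrite -(@pi_fun_mul _ _ e) ?pe //.
  by rewrite eE g'E glVmx.
by rewrite eE g'E glmxV.
Qed.

Definition pi_aut (g : Gamma Psi a) : tensAut a M :=
  @TensAut T R a M (pi_fun g) (@pi_fun_lin g) (@pi_fun_bij g) (@pi_fun_nat g)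
    (@pi_fun_tens g) (@pi_fun_unit g).

Lemma pi_aut_inj : injective pi_aut.
Proof.
move=> g g' e.
have sB := sol_basis gT m_basis Phi_m Psi_Phi.
pose M' := TanObj (tg_self M).
have h i : glinv g i =1 glinv g' i.
  apply: (RV_coord_uniq gT sB (a := a)).
  rewrite -[LHS](@pi_funE g M' _ _ (Act_sol Psi_Phi Phi_m g i)).
  rewrite -[RHS](@pi_funE g' M' _ _ (Act_sol Psi_Phi Phi_m g' i)).
  by have := congr1 (fun t : tensAut a M => t M' (bmk a 1 (sol i))) e.
have gg' : gam g = gam g'.
  apply: GL_eq; apply: (glinv_uniq (g := glV g) (g' := glV g')).
  by apply/matrixP => i k; exact: h.
by case: g g' gg' {e h} => [g p] [g' p'] /= gg'; subst g'; congr GammaMk; exact: Prop_irrelevance.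
Qed.

Section Agree.
Context (t t' : tensAut a M).
Context (ttM : forall x, t (TanObj (tg_self M)) x = t' (TanObj (tg_self M)) x).

Let gdN N (p : tannakian_gen M N) : good Psi N := gd (TanObj p).

Lemma solbasis_unit : solbasis (fun _ : 'I_1 => unitV T).
Proof.
split.
  move=> c; rewrite big_ord1 => e i; rewrite ord1; apply: (FL_inj gT).
  have := congr1 (fun v => uval (vL v)) e.
  by rewrite vLZ uvalZ uval_one rmorph1 mulr1 vL0 uval0 rmorph0.
by move=> x; exists (fun=> uval x); rewrite big_ord1 [LHS]uvalE.
Qed.

(** The pairing is a morphism from N (x) N' to the unit, so a tensor automorphism preserves it.
    Being bijective on V(N), the automorphism is therefore determined on V(N') by its values on
    V(N). *)
Lemma agree_dual N N' (p : tannakian_gen M N) (pN' : tannakian_gen M N')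
    (b : N -> N' -> E)
    (bl : forall a x x' y, b (a *: x + x') y = a * b x y + b x' y)
    (br : forall a x y y', b x (a *: y + y') = a * b x y + b x y')
    (bp : forall x y, b (pphi N x) (pphi N' y) = tsE T (b x y))
    (bf : forall f : {linear N -> E^o}, exists! y, forall x, b x y = f x) :
  (forall x, t (TanObj p) x = t' (TanObj p) x) ->
  forall y, t (TanObj pN') y = t' (TanObj pN') y.
Proof.
move=> IH y.
pose beta := pair_hom bl br bp.
have [k [e se]] := good_fin (gdN p).
have [k' [f [fr sp]]] := basis_extract (st_E gT) e.
have [w0 [w wB]] := good_solbasis gT (gdN p).
have [|w' [ww' yE]] := dual_solbasis gT bl br bp bf _ wB.
  exists k', (e \o f); split=> // x.
  by have [c ->] := se x; apply: lspan_sum.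
have w'B : solbasis w'.
  split=> [c c0 i|z]; last by exists (fun i => bL bl br bp (vL (w i)) z).
  apply: (FL_inj gT).
  have := congr1 (fun v => bL bl br bp (vL (w i)) (vL v)) c0.
  rewrite vL_sum bL_sumr (bigD1 i) // vLZ bLZr ww' eqxx mulr1 big1 ?Monoid.mulm1.
    by rewrite vL0 bL0r => ->; rewrite rmorph0.
  by move=> j /negbTE ji; rewrite vLZ bLZr ww' eq_sym ji mulr0.
have pairE i (c : 'I_w0 -> R) :
    RVmap beta (muRV (bmk a 1 (w i) : RV a N) (\sum_j bmk a (c j) (w' j) : RV a N')) =
    bmk a (c i) (unitV T).
  rewrite (big_morph _ (muRVDr (bmk a 1 (w i) : RV a N)) (muRV0r N' _)).
  rewrite (big_morph (RVmap beta) (RVmapD beta) (RVmap0 a beta)).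
  have h j : RVmap beta (muRV (bmk a 1 (w i) : RV a N) (bmk a (c j) (w' j) : RV a N')) =
      bmk a (c j) ((i == j)%:R *: unitV T).
    rewrite muRV_mk RVmap_mk mul1r; congr bmk; apply: vL_inj.
    rewrite vL_Vmap vL_muV vLZ rmorph_nat -ww'; exact: uvalE.
  under eq_bigr do rewrite h.
  rewrite (bigD1 i) //= eqxx scale1r big1 ?addr0 // => j /negbTE ji.
  rewrite eq_sym ji scale0r; apply: (@addrI _ (bmk a (c j) 0)).
  by rewrite -bmkDr !addr0.
have pair_t (s : tensAut a M) x z :
    RVmap beta (muRV (s (TanObj p) x) (s (TanObj pN') z)) = RVmap beta (muRV x z).
  rewrite -(taut_tens s x z).
  have e1 := taut_nat s (N := tanTens (TanObj p) (TanObj pN')) (N' := tanUnit M) beta (muRV x z).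
  by apply: etrans (esym e1) _; exact: taut_unit.
have [c cE] := RV_repr gT w'B (t (TanObj pN') y).
have [c' c'E] := RV_repr gT w'B (t' (TanObj pN') y).
rewrite cE c'E; apply: eq_bigr => i _; congr bmk.
have [u _ uK] := taut_bij t (TanObj p).
apply: (RV_coord_uniq gT solbasis_unit (a := a) (c := fun=> c i) (c' := fun=> c' i) _ ord0).
(* With w_i written as t(u(w_i)), both coordinates become the pairing of u(w_i) with [y]; on the
   right [IH] first exchanges [t] for [t']. *)
rewrite !big_ord1 -!pairE -cE -c'E -[bmk a 1 (w i)]uK pair_t [in RHS]IH.
exact/esym/pair_t.
Qed.

(** Objects of T_M carry a derivation, so the induction on one derivation proves the claim for any
    other derivation [pf] of the same module. *)
Lemma agree N (p : tannakian_gen M N) x : t (TanObj p) x = t' (TanObj p) x.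
Proof.
move: (p) x; elim: {N} p => [||N N' p IH p' IH'|N N' p IH p' IH'|N N' p IH tN' [b [bl br bp bf]]
  |N N' f p IH tN' fi|N N' f p IH tN' fs] pf x.
- by rewrite (Prop_irrelevance pf (tg_self M)).
- rewrite (Prop_irrelevance pf (tg_unit M)).
  exact: etrans (taut_unit t x) (esym (taut_unit t' x)).
- have -> : x = RVmap (sum_i1 N N') (RVmap (sum_p1 N N') x) +
      RVmap (sum_i2 N N') (RVmap (sum_p2 N N') x).
    elim/(@baseChange_ind _ _ a (VM (sumMod N N'))): x => [|c v|x y IHx IHy].
    + by rewrite !RVmap0 addr0.
    + rewrite !RVmap_mk -bmkDr; congr bmk; apply: vL_inj.
      by rewrite vLD !vL_Vmap; exact: LM_sum_split.
    + by rewrite !RVmapD addrACA -IHx -IHy.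
  rewrite !tautD.
  have h1 (s : tensAut a M) z := taut_nat s (N := TanObj p) (N' := TanObj pf) (sum_i1 N N') z.
  have h2 (s : tensAut a M) z := taut_nat s (N := TanObj p') (N' := TanObj pf) (sum_i2 N N') z.
  by rewrite /= in h1 h2; rewrite !h1 !h2 IH IH'.
- rewrite (Prop_irrelevance pf (tg_tens p p')).
  have [k [w wB]] := good_solbasis gT (gdN p).
  have [k' [w' wB']] := good_solbasis gT (gdN p').
  elim/(@baseChange_ind _ _ a (VM (tensMod N N'))): x => [|c v|x y IHx IHy].
  + exact: etrans (taut0 t _) (esym (taut0 t' _)).
  + have [d ->] := V_tens_span gT wB wB' v.
    rewrite bmk_lincomb !taut_sum; apply: eq_bigr => j _.
    rewrite -[a (d j) * c]mulr1 -muRV_mk.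
    have h (s : tensAut a M) := taut_tens s (N := TanObj p) (N' := TanObj p').
    by rewrite /= in h; apply: etrans (h t _ _) _; rewrite IH IH'; exact/esym/h.
  + by rewrite !tautD IHx IHy.
- exact: (agree_dual bl br bp bf (IH p)).
- have inj : injective (RVmap f : RV a N' -> RV a N).
    move=> y z e; apply/eqP; rewrite -subr_eq0; apply/eqP.
    apply: (@tens_inj _ (st_F gT) (restr R^o a) (VM N') (VM N) (Vlin f) (Vmap_inj gT fi)).
    rewrite -[LHS]/(RVmap f (y - z : RV a N')) -scaleN1r RVmapD RVmapZ e scaleN1r.
    exact: subrr.
  apply: inj.
  have h (s : tensAut a M) := taut_nat s (N := TanObj pf) (N' := TanObj p) f x.
  by rewrite /= in h; rewrite -!h IH.
- have [k [w wB]] := good_solbasis gT (gdN p).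
  have [y <-] : exists y, RVmap f y = x.
    elim/(@baseChange_ind _ _ a (VM N')): x => [|c v|x x' [y <-] [y' <-]].
    + by exists 0; exact: RVmap0.
    + have [v0 <-] := Vmap_surj gT fs wB v.
      by exists (bmk a c v0); exact: RVmap_mk.
    + by exists (y + y'); exact: RVmapD.
  have h (s : tensAut a M) := taut_nat s (N := TanObj p) (N' := TanObj pf) f y.
  by rewrite /= in h; rewrite !h IH.
Qed.
End Agree.
End Points.
End TensorAutomorphisms.

(** * Morphisms from N to L and their images *)

Section PhiFunctionals.
Context (T : frobTower) (gT : simple_tower T).
Local Notation F := (tF T).
Local Notation E := (tE T).
Local Notation L := (tL T).
Local Notation EL := (tEL T).
Local Notation FL := (tFL T).
Local Notation LL := (tensR EL EL).

(** A morphism of phi-modules to [L]. The target is kept as the ring [L], since values of such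
    morphisms get multiplied. *)
Record phiFun (N : phiMod T) : Type := PhiFun {
  pfun :> N -> L;
  pfun_lin : forall c x y, pfun (c *: x + y) = EL c * pfun x + pfun y;
  pfun_phi : forall x, pfun (pphi N x) = tsL T (pfun x) }.

Section One.
Context (N : phiMod T) (f : phiFun N).

Lemma pfunD x y : f (x + y) = f x + f y.
Proof. by have := pfun_lin f 1 x y; rewrite scale1r rmorph1 mul1r. Qed.
Lemma pfun0 : f 0 = 0.
Proof. by apply: (@addrI _ (f 0)); rewrite -pfunD !addr0. Qed.
Lemma pfunZ c x : f (c *: x) = EL c * f x.
Proof. by rewrite -[c *: x]addr0 pfun_lin pfun0 addr0. Qed.
Definition fstar : LM N -> LL := blift EL (fun l x => tmk EL EL l (f x)).
Lemma fstar_bal : bbalanced EL (fun l x => tmk EL EL l (f x)).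
Proof.
split=> [l l' x|l x x'|c l x]; first by rewrite tmkDl.
  by rewrite pfunD tmkDr.
by rewrite pfunZ tmkZ.
Qed.
Lemma fstar_mk l x : fstar (bmk EL l x) = tmk EL EL l (f x).
Proof. exact: (blift_mk fstar_bal). Qed.
Lemma fstarD : {morph fstar : x y / x + y}.
Proof. exact: (bliftD fstar_bal). Qed.
Lemma fstar0 : fstar 0 = 0.
Proof. exact: (blift0 fstar_bal). Qed.
Lemma fstarZ l x : fstar (l *: x) = inl_t EL EL l * fstar x.
Proof.
elim/(@baseChange_ind _ _ EL N): x => [|l' x|x y IHx IHy].
- by rewrite scaler0 fstar0 mulr0.
- by rewrite bmkZl !fstar_mk tmkM mul1r.
- by rewrite scalerDr !fstarD IHx IHy mulrDr.
Qed.

Context (R : comPzRingType) (a : {rmorphism F -> R}).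

(* On [R (x)_F V(N)] the values lie in [R (x)_F L^sigma = R]; keeping them in
   [R (x)_F L] avoids choosing the preimages. *)
Definition feval0 : baseChange (E_RL a) N -> RL a :=
  blift (E_RL a) (fun (x : RL a) n => x * inrR a (f n)).
Lemma feval0_bal : bbalanced (E_RL a) (fun (x : RL a) n => x * inrR a (f n)).
Proof.
split=> [l l' x|l x x'|c l x]; first by rewrite mulrDl.
  by rewrite pfunD rmorphD mulrDr.
by rewrite pfunZ rmorphM mulrCA mulrA.
Qed.
Lemma feval0_mk x n : feval0 (bmk (E_RL a) x n) = x * inrR a (f n).
Proof. exact: (blift_mk feval0_bal). Qed.
Lemma feval0D : {morph feval0 : x y / x + y}.
Proof. exact: (bliftD feval0_bal). Qed.
Lemma feval00 : feval0 0 = 0.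
Proof. exact: (blift0 feval0_bal). Qed.
Lemma feval0Z c x : feval0 (c *: x) = c * feval0 x.
Proof.
elim/(@baseChange_ind _ _ (E_RL a) N): x => [|l' x|x y IHx IHy].
- by rewrite scaler0 feval00 mulr0.
- by rewrite bmkZl !feval0_mk mulrA.
- by rewrite scalerDr !feval0D IHx IHy mulrDr.
Qed.

Definition feval (x : RV a N) : RL a := feval0 (RV_to_RLN x).
Lemma fevalD : {morph feval : x y / x + y}.
Proof. by move=> x y; rewrite /feval RV_to_RLND feval0D. Qed.
Lemma feval_0 : feval 0 = 0.
Proof. by rewrite /feval RV_to_RLN0 feval00. Qed.
Lemma feval_mk c v : feval (bmk a c v : RV a N) = inlR a c * feval0 (LM_RLN a (vL v)).
Proof. by rewrite /feval RV_to_RLN_mk feval0Z. Qed.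

End One.

Section Composition.
Context (N N' : phiMod T) (h : phiHom N N') (f' : phiFun N').
Context (f : phiFun N) (fE : forall x, f x = f' (h x)).

Lemma fstar_map x : fstar f' (LMmap h x) = fstar f x.
Proof.
elim/(@baseChange_ind _ _ EL N): x => [|l x|x y IHx IHy].
- by rewrite LMmap0 !fstar0.
- by rewrite bmk_one LMmapZ LMmap_one !fstarZ /one_t !fstar_mk fE.
- by rewrite LMmapD !fstarD IHx IHy.
Qed.
Lemma feval_map (R : comPzRingType) (a : {rmorphism F -> R}) (x : RV a N) :
  feval f' (RVmap h x) = feval f x.
Proof.
rewrite /feval RV_to_RLN_map.
elim/(@baseChange_ind _ _ (E_RL a) N): (RV_to_RLN x) => [|c v|y z IHy IHz].
- by rewrite RLNmap0 !feval00.
- by rewrite RLNmap_mk !feval0_mk fE.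
- by rewrite RLNmapD !feval0D IHy IHz.
Qed.
End Composition.

Section Sum.
Context (N N' : phiMod T) (f : phiFun N) (f' : phiFun N').
Fact pfun_sumMod_lin c (x y : sumMod N N') :
  f (c *: x + y).1 + f' (c *: x + y).2 = EL c * (f x.1 + f' x.2) + (f y.1 + f' y.2).
Proof. by rewrite /= !pfun_lin mulrDr addrACA. Qed.
Fact pfun_sumMod_phi (x : sumMod N N') :
  f (pphi (sumMod N N') x).1 + f' (pphi (sumMod N N') x).2 = tsL T (f x.1 + f' x.2).
Proof. by rewrite /= !pfun_phi rmorphD. Qed.
Definition pfun_sumMod : phiFun (sumMod N N') := PhiFun pfun_sumMod_lin pfun_sumMod_phi.
End Sum.

Section Tens.
Context (N N' : phiMod T) (f : phiFun N) (f' : phiFun N').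
Lemma pfun_tens_bal : balanced (fun x y => f x * f' y).
Proof.
split=> [x x' y|x y y'|c x y]; first by rewrite pfunD mulrDl.
  by rewrite pfunD mulrDr.
by rewrite !pfunZ mulrCA mulrA.
Qed.
Fact pfun_tens_lin c (x y : tensMod N N') :
  tlift (fun x y => f x * f' y) (c *: x + y) =
  EL c * tlift (fun x y => f x * f' y) x + tlift (fun x y => f x * f' y) y.
Proof.
rewrite (tliftD pfun_tens_bal); congr (_ + _).
elim/tensor_ind: x => [|u v|x x' IH IH'].
- by rewrite scaler0 (tlift0 pfun_tens_bal) mulr0.
- by rewrite -tpureZl !(tlift_pure pfun_tens_bal) pfunZ mulrA.
- by rewrite scalerDr !(tliftD pfun_tens_bal) IH IH' mulrDr.
Qed.
Fact pfun_tens_phi (x : tensMod N N') :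
  tlift (fun x y => f x * f' y) (pphi (tensMod N N') x) =
  tsL T (tlift (fun x y => f x * f' y) x).
Proof.
elim/tensor_ind: x => [|u v|x x' IH IH'].
- by rewrite raddf0 (tlift0 pfun_tens_bal) rmorph0.
- rewrite /= /phi_tens (tlift_pure (phi_tens_bal N N')) !(tlift_pure pfun_tens_bal).
  by rewrite !pfun_phi rmorphM.
- by rewrite raddfD !(tliftD pfun_tens_bal) IH IH' rmorphD.
Qed.
Definition pfun_tens : phiFun (tensMod N N') := PhiFun pfun_tens_lin pfun_tens_phi.

Lemma pfun_tensE x y : pfun_tens (tpure x y) = f x * f' y.
Proof. exact: (tlift_pure pfun_tens_bal). Qed.

Lemma fstar_mu x y : fstar pfun_tens (muL x y) = fstar f x * fstar f' y.
Proof.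
elim/(@baseChange_ind _ _ EL N): x => [|l v|x x' IH IH'].
- by rewrite muL0l !fstar0 mul0r.
- elim/(@baseChange_ind _ _ EL N'): y => [|l' v'|y y' IH IH'].
  + by rewrite muL0r !fstar0 mulr0.
  + by rewrite muL_mk2 !fstar_mk tmkM pfun_tensE.
  + by rewrite muLDr !fstarD IH IH' mulrDr.
- by rewrite muLDl !fstarD IH IH' mulrDl.
Qed.
Lemma feval_mu (R : comPzRingType) (a : {rmorphism F -> R}) (x : RV a N) (y : RV a N') :
  feval pfun_tens (muRV x y) = feval f x * feval f' y.
Proof.
rewrite /feval RV_to_RLN_mu.
elim/(@baseChange_ind _ _ (E_RL a) N): (RV_to_RLN x) => [|l v|z x' IH IH'].
- by rewrite muRLN0l !feval00 mul0r.
- elim/(@baseChange_ind _ _ (E_RL a) N'): (RV_to_RLN y) => [|l' v'|z y' IH IH'].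
  + by rewrite muRLN0r !feval00 mulr0.
  + by rewrite muRLN_mk !feval0_mk pfun_tensE rmorphM mulrACA.
  + by rewrite muRLNDr !feval0D IH IH' mulrDr.
- by rewrite muRLNDl !feval0D IH IH' mulrDl.
Qed.
End Tens.

Fact pfun_unit_lin c (x y : unitMod T) : EL (c *: x + y) = EL c * EL x + EL y.
Proof. by rewrite -rmorphM -rmorphD. Qed.
Fact pfun_unit_phi (x : unitMod T) : EL (pphi (unitMod T) x) = tsL T (EL x).
Proof. by rewrite tsEL. Qed.
Definition pfun_unit : phiFun (unitMod T) :=
  @PhiFun (unitMod T) EL pfun_unit_lin pfun_unit_phi.

Section Image.
Context (N : phiMod T) (f : phiFun N).

Definition im_pred : {pred restr L^o EL} := fun x => `[< exists y, f y = x >].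
Fact im_closed : submod_closed im_pred.
Proof.
split=> [|c x y]; first by apply/asboolP; exists 0; exact: pfun0.
move=> /asboolP[x' <-] /asboolP[y' <-]; apply/asboolP; exists (c *: x' + y').
exact: pfun_lin.
Qed.
HB.instance Definition _ := GRing.isSubmodClosed.Build E (restr L^o EL) im_pred im_closed.

Record imT : Type := ImT { im_val : restr L^o EL; _ : im_pred im_val }.
HB.instance Definition _ := [isSub for im_val].
HB.instance Definition _ := [Choice of imT by <:].
HB.instance Definition _ := [SubChoice_isSubLmodule of imT by <:].

Lemma im_valP (x : imT) : exists y, f y = im_val x.
Proof. by case: x => x /= /asboolP. Qed.
Definition im_mk (y : N) : imT := @ImT (f y) (introT (asboolP _) (ex_intro _ y erefl)).

Fact im_phi_subproof (x : imT) : im_pred (tsL T (im_val x)).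
Proof.
by have [y <-] := im_valP x; apply/asboolP; exists (pphi N y); rewrite pfun_phi.
Qed.
Definition im_phi (x : imT) : imT := ImT (im_phi_subproof x).
Fact im_phi_nmod : nmod_morphism im_phi.
Proof.
split=> [|x y]; apply: val_inj; first exact: (rmorph0 (tsL T)).
exact: (rmorphD (tsL T)).
Qed.
HB.instance Definition _ := GRing.isNmodMorphism.Build imT imT im_phi im_phi_nmod.
Fact im_phiZ c (x : imT) : im_phi (c *: x) = tsE T c *: im_phi x.
Proof.
apply: val_inj; apply: etrans (rmorphM (tsL T) (EL c) (im_val x)) _.
by rewrite tsEL.
Qed.
Definition imMod : phiMod T := @PhiMod T imT im_phi im_phiZ.

Fact im_hom_lin c (x y : N) : im_mk (c *: x + y) = c *: im_mk x + im_mk y :> imMod.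
Proof. by apply: val_inj; exact: pfun_lin. Qed.
Fact im_hom_phi x : im_mk (pphi N x) = pphi imMod (im_mk x).
Proof. by apply: val_inj; exact: pfun_phi. Qed.
Definition im_hom : phiHom N imMod := mkHom im_hom_lin im_hom_phi.

Lemma im_hom_surj (y : imMod) : exists x, im_hom x = y.
Proof. by have [x xE] := im_valP y; exists x; apply: val_inj. Qed.

Definition im_incl : phiFun imMod :=
  @PhiFun imMod im_val (fun _ _ _ => erefl) (fun _ => erefl).

(** The image f(N) is an [E]-subspace of [L], and tensoring its inclusion with [L] over the field
    [E] keeps it injective. *)
Lemma im_fstar_inj (z : LM imMod) : fstar im_incl z = 0 -> z = 0.
Proof.
apply: (@tens_inj _ (st_E gT) (restr L^o EL) imMod (restr L^o EL)
  (mkLin (f := im_val : imMod -> restr L^o EL) (fun _ _ _ => erefl))).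
by move=> x y; exact: val_inj.
Qed.

(** A quotient enters T_M only with its [L]-triviality; here the images of a solution basis of [N]
    generate L (x)_E f(N). *)
Lemma im_L_trivial (r : nat) (Psi : GL L r) : good Psi N -> L_trivial imMod.
Proof.
move=> gN; apply: (lincomb_L_trivial gT).
  have [k [e se]] := good_fin gN; exists k, (im_hom \o e) => y.
  have [x <-] := im_hom_surj y; have [c ->] := se x; exists c.
  by rewrite linear_sum; apply: eq_bigr => i _; rewrite linearZ.
move=> y; have [m [w wB]] := good_solbasis gT gN.
exists m, (fun i => Vmap im_hom (w i)).
exact: (LMmap_lspan im_hom_surj wB).
Qed.
End Image.
End PhiFunctionals.

(** * Matrix coefficients and surjectivity *)

Section Surjectivity.
Context (T : frobTower) (gT : simple_tower T).
Local Notation F := (tF T).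
Local Notation E := (tE T).
Local Notation L := (tL T).
Local Notation EL := (tEL T).
Local Notation FL := (tFL T).
Local Notation LL := (tensR EL EL).
Context (r : nat) (Phi : GL E r) (Psi : GL L r).
Context (Psi_Phi : map_mx (tsL T) Psi = map_mx EL Phi *m Psi).
Context (M : phiMod T) (m : 'I_r -> M) (m_basis : is_basis m).
Context (Phi_m : forall i, pphi M (m i) = \sum_l Phi i l *: m l).
Local Notation n := (r * r + 1)%N.
Local Notation sol := (sol Phi_m Psi_Phi).
Context (R : comPzRingType) (a : {rmorphism F -> R}) (t : tensAut a M).
Let M' := TanObj (tg_self M).

(* The matrix coefficients [(f_*(v), f(t v))], for [N] in [T_M], [v] in [V(N)] and
   [f : N -> L]; they form an [F]-algebra, on which the first component determines
   the second. *)
Definition matcoef (x : LL) (y : RL a) : Prop :=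
  exists (N : tanObj M) (f : phiFun N) (v : VM N),
    fstar f (vL v) = x /\ feval f (t N (bmk a 1 v)) = y.

Lemma matcoef_eq0 y : matcoef 0 y -> y = 0.
Proof.
move=> [N [f [v [fv <-]]]].
have gN : good Psi N by exact: (good_gen gT m_basis Phi_m Psi_Phi (tobjP N)).
have tQ := tg_quo (tobjP N) (im_L_trivial gT f gN) (@im_hom_surj T N f).
have z : Vmap (im_hom f) v = 0.
  apply: vL_inj; rewrite vL_Vmap vL0; apply: (im_fstar_inj gT).
  by rewrite (@fstar_map T N (imMod f) (im_hom f) (im_incl f) f).
rewrite -(@feval_map T N (imMod f) (im_hom f) (im_incl f) f) //.
rewrite -(taut_nat t (N' := TanObj tQ) (im_hom f)) RVmap_mk z.
have -> : bmk a 1 (0 : VM (imMod f)) = 0 :> RV a (imMod f).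
  by apply: (@addrI _ (bmk a 1 (0 : VM (imMod f)))); rewrite -bmkDr !addr0.
by rewrite (taut0 t (TanObj tQ)) feval_0.
Qed.

Lemma matcoefD x y x' y' : matcoef x y -> matcoef x' y' -> matcoef (x + x') (y + y').
Proof.
move=> [N [f [v [<- <-]]]] [N' [f' [v' [<- <-]]]].
exists (TanObj (tg_sum (tobjP N) (tobjP N'))), (pfun_sumMod f f').
exists (Vmap (sum_i1 N N') v + Vmap (sum_i2 N N') v').
have e1 z : f z = pfun_sumMod f f' (sum_i1 N N' z) by rewrite /= pfun0 addr0.
have e2 z : f' z = pfun_sumMod f f' (sum_i2 N N' z) by rewrite /= pfun0 add0r.
split.
  by rewrite vLD !vL_Vmap fstarD (fstar_map e1) (fstar_map e2).
rewrite bmkDr tautD fevalD -!RVmap_mk.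
rewrite (taut_nat t (N' := TanObj (tg_sum (tobjP N) (tobjP N'))) (sum_i1 N N')).
rewrite (taut_nat t (N' := TanObj (tg_sum (tobjP N) (tobjP N'))) (sum_i2 N N')).
by rewrite (feval_map e1) (feval_map e2).
Qed.

Lemma matcoefM x y x' y' : matcoef x y -> matcoef x' y' -> matcoef (x * x') (y * y').
Proof.
move=> [N [f [v [<- <-]]]] [N' [f' [v' [<- <-]]]].
exists (tanTens N N'), (pfun_tens f f'), (muV v v'); split.
  by rewrite vL_muV fstar_mu.
have -> : bmk a 1 (muV v v') = muRV (bmk a 1 v : RV a N) (bmk a 1 v' : RV a N').
  by rewrite muRV_mk mulr1.
rewrite (taut_tens t (N := N) (N' := N')).
exact: feval_mu.
Qed.

Lemma matcoefC c : matcoef (inl_t EL EL (FL c)) (inlR a (a c)).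
Proof.
exists (tanUnit M), (pfun_unit T), (c *: unitV T); split.
  by rewrite vLZ fstarZ fstar_mk /= rmorph1 mulr1.
rewrite (taut_unit t) feval_mk vLZ LM_RLNZ LM_RLN_one feval0Z feval0_mk.
have -> : pfun_unit T (1 : E^o) = 1 by exact: (rmorph1 EL).
by rewrite (rmorph1 (inrR a)) (rmorph1 (inlR a)) !mul1r mulr1 inlrR.
Qed.

Lemma matcoef_0 : matcoef 0 0.
Proof. by have := matcoefC 0; rewrite !rmorph0. Qed.
Lemma matcoef_1 : matcoef 1 1.
Proof. by have := matcoefC 1; rewrite !rmorph1. Qed.

Section Matrix.
Context (C : 'M[R]_r).
Context (CE : forall i, t M' (bmk a 1 (sol i)) = \sum_k bmk a (C i k) (sol k)).

(** The morphism sends m_l to Psi_lj, which is compatible with phi because sigma(Psi) = Phi Psi; the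
    vector is [sol i], the [i]-th entry of Psi^-1 m. *)
Lemma matcoef_entry i j : matcoef (PsiPsi Psi i j) (inlR a (C i j)).
Proof.
have [d [dE dd]] := basis_coord (is_basis_free m_basis) (is_basis_span m_basis).
pose f x := \sum_l EL (d l x : E) * Psi l j.
have f_lin c x y : f (c *: x + y) = EL c * f x + f y.
  rewrite /f mulr_sumr -big_split; apply: eq_bigr => l _.
  have -> : (d l (c *: x + y) : E) = c * d l x + d l y.
    by rewrite linearD; congr (_ + _); exact: (linearZ_LR (d l) c x).
  by rewrite rmorphD rmorphM mulrDl mulrA.
have f_m l : f (m l) = Psi l j.
  rewrite /f (bigD1 l) //= dd eqxx rmorph1 mul1r big1 ?addr0 // => k /negbTE kl.
  by rewrite dd eq_sym kl rmorph0 mul0r.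
have f_sum k (c : 'I_k -> E) (x : 'I_k -> M) :
    f (\sum_i c i *: x i) = \sum_i EL (c i) * f (x i).
  have f0 : f 0 = 0 by have := f_lin (-1) 0 0; rewrite scaler0 addr0 rmorphN1 mulN1r addNr.
  elim: k c x => [|k IH] c x; first by rewrite !big_ord0 f0.
  by rewrite !big_ord_recl f_lin IH.
have f_phi x : f (pphi M x) = tsL T (f x).
  rewrite {1}[x]dE raddf_sum /=.
  have -> : \sum_i pphi M ((d i x : E) *: m i) = \sum_i tsE T (d i x) *: pphi M (m i).
    by apply: eq_bigr => i' _; rewrite pphiZ.
  rewrite f_sum [in RHS]/f rmorph_sum; apply: eq_bigr => l _.
  rewrite rmorphM tsEL; congr (_ * _); rewrite Phi_m f_sum.
  have /matrixP/(_ l j) := Psi_Phi; rewrite !mxE => ->.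
  by apply: eq_bigr => k _; rewrite f_m mxE.
pose pf := PhiFun f_lin f_phi.
exists M', pf, (sol i); split.
  rewrite vL_sol (big_morph _ (fstarD pf) (fstar0 pf)).
  rewrite /PsiPsi /= mxE; apply: eq_bigr => l _.
  by rewrite fstarZ fstar_mk /= f_m !mxE.
rewrite CE (big_morph _ (fevalD pf (a:=a)) (feval_0 pf a)).
(* On [sol k] the morphism takes as value the entry (k, j) of Psi^-1 Psi, so only [C i j] survives
   in the sum. *)
have h k : feval pf (bmk a (C i k) (sol k)) = inlR a (C i k) * (k == j)%:R.
  rewrite feval_mk; congr (_ * _); rewrite vL_sol LM_RLN_sum.
  rewrite (big_morph _ (feval0D pf (a:=a)) (feval00 pf a)).
  transitivity (inrR a (\sum_l glinv Psi k l * Psi l j)).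
    rewrite rmorph_sum; apply: eq_bigr => l _.
    by rewrite LM_RLNZ LM_RLN_one feval0Z feval0_mk mul1r [RHS]rmorphM -[X in _ = _ * inrR a X]f_m.
  have /matrixP/(_ k j) := glVmx Psi; rewrite !mxE => ->.
  by rewrite rmorph_nat.
under eq_bigr do rewrite h.
rewrite (bigD1 j) //= eqxx mulr1 big1 ?addr0 // => k /negbTE ->.
by rewrite mulr0.
Qed.

Lemma matcoef_prod I (s : seq I) (x : I -> LL) (y : I -> RL a) :
  (forall i, matcoef (x i) (y i)) -> matcoef (\prod_(i <- s) x i) (\prod_(i <- s) y i).
Proof.
move=> h; elim: s => [|i s IH]; first by rewrite !big_nil; exact: matcoef_1.
by rewrite !big_cons; apply: matcoefM.
Qed.
Lemma matcoef_sum I (s : seq I) (x : I -> LL) (y : I -> RL a) :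
  (forall i, matcoef (x i) (y i)) -> matcoef (\sum_(i <- s) x i) (\sum_(i <- s) y i).
Proof.
move=> h; elim: s => [|i s IH]; first by rewrite !big_nil; exact: matcoef_0.
by rewrite !big_cons; apply: matcoefD.
Qed.
Lemma matcoef_det : matcoef (\det (PsiPsi Psi)) (\det (map_mx (inlR a) C)).
Proof.
apply: matcoef_sum => s; apply: matcoefM.
  have := matcoefC ((-1) ^+ perm.odd_perm s).
  by rewrite !rmorphXn !rmorphN1.
by apply: matcoef_prod => i; rewrite [map_mx _ _ _ _]mxE; exact: matcoef_entry.
Qed.
Lemma matcoefX x y k : matcoef x y -> matcoef (x ^+ k) (y ^+ k).
Proof.
move=> h; elim: k => [|k IH]; first by rewrite !expr0; exact: matcoef_1.
by rewrite !exprS; apply: matcoefM.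
Qed.

(* The determinant is inverted only at the end, which avoids the dual of [M]. *)
Lemma matcoef_poly (g : GL R r) (gC : g = C :> 'M_r) (p : {mpoly F[n]}) : exists k,
  matcoef (evalGL (inl_t EL EL \o FL) p (PsiPsi Psi) * \det (PsiPsi Psi) ^+ k)
    (inlR a (evalGL a p g) * \det (map_mx (inlR a) C) ^+ k).
Proof.
elim/mpoly_alg_ind: p => [c|i|p q [k hk] [l hl]|p q [k hk] [l hl]].
- by exists 0; rewrite !expr0 !mulr1 !evalGLC; exact: matcoefC.
- case: (glvarP i) => [i' j'|i'].
    exists 0; rewrite !expr0 !mulr1 !evalGLX !glvar_entry gC; exact: matcoef_entry.
  exists 1%N; rewrite !expr1 !evalGLX !glvar_det -det_mulmx glVmx det1.
  rewrite det_map_mx -rmorphM -gC -det_mulmx glVmx det1 rmorph1; exact: matcoef_1.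
- exists (k + l)%N.
  have h1 := matcoefM hk (matcoefX l matcoef_det).
  have h2 := matcoefM hl (matcoefX k matcoef_det).
  have := matcoefD h1 h2.
  by rewrite !evalGLD rmorphD -!mulrA -!exprD [(l + k)%N]addnC -!mulrDl.
- exists (k + l)%N; have := matcoefM hk hl.
  by rewrite !evalGLM rmorphM !exprD mulrACA [X in matcoef _ X -> _]mulrACA.
Qed.

Lemma matrix_in_q (g : GL R r) : g = C :> 'M_r ->
  forall p : {mpoly F[n]}, in_q Psi p -> evalGL a p g = 0.
Proof.
move=> gC p qp; have [k] := matcoef_poly gC p.
rewrite (qp : evalGL _ _ _ = 0) mul0r => /matcoef_eq0 e.
apply: (inlR_inj gT (a := a)).
have dC : \det (map_mx (inlR a) C) * inlR a (\det (glinv g)) = 1.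
  by rewrite det_map_mx -rmorphM -gC -det_mulmx glmxV det1 rmorph1.
have := congr1 (fun z => z * inlR a (\det (glinv g)) ^+ k) e.
by rewrite -mulrA -exprMn dC expr1n mulr1 mul0r.
Qed.
End Matrix.

Lemma pi_aut_surj : exists g : Gamma Psi a, pi_aut gT Psi_Phi m_basis Phi_m g = t.
Proof.
have sB := sol_basis gT m_basis Phi_m Psi_Phi.
have coords (x : 'I_r -> RV a M) : exists C : 'M[R]_r,
    forall i, x i = \sum_k bmk a (C i k) (sol k).
  have /choice[c cE] i := RV_repr gT sB (x i).
  exists (\matrix_(i, k) c i k) => i; rewrite {1}cE.
  by apply: eq_bigr => k _; rewrite mxE.
have [t' tK t'K] := taut_bij t M'.
have t'_lin c x y : t' (c *: x + y) = c *: t' x + t' y.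
  by apply: (can_inj tK); rewrite (taut_lin t) !t'K.
have [C CE] := coords (fun i => t M' (bmk a 1 (sol i))).
have [D DE] := coords (fun i => t' (bmk a 1 (sol i))).
(* Matrices act on the column of solutions from the left, so composition reverses their order: s
   after s' has matrix B A. *)
have mulE (s : RV a M -> RV a M) (A B : 'M[R]_r) (s' : RV a M -> RV a M) :
    (forall c x y, s (c *: x + y) = c *: s x + s y) ->
    (forall i, s (bmk a 1 (sol i)) = \sum_k bmk a (A i k) (sol k)) ->
    (forall i, s' (bmk a 1 (sol i)) = \sum_k bmk a (B i k) (sol k)) ->
    cancel s' s -> B *m A = 1%:M.
  move=> sl sE s'E sK; apply/matrixP => i j.
  have s0 : s 0 = 0.
    have := sl (-1) 0 0; rewrite scaler0 addr0 scaleN1r => ->.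
    exact: addNr.
  have sD : {morph s : x y / x + y}.
    by move=> x y; have := sl 1 x y; rewrite !scale1r.
  have sZ c x : s (c *: x) = c *: s x.
    by rewrite -[c *: x]addr0 sl s0 addr0.
  have := sK (bmk a 1 (sol i)); rewrite s'E.
  have -> : s (\sum_k bmk a (B i k) (sol k)) = \sum_k bmk a ((B *m A) i k) (sol k).
    transitivity (\sum_k B i k *: s (bmk a 1 (sol k))).
      have big_s (u : seq 'I_r) : s (\sum_(k <- u) bmk a (B i k) (sol k)) =
          \sum_(k <- u) B i k *: s (bmk a 1 (sol k)).
        elim: u => [|k u IH]; first by rewrite !big_nil.
        by rewrite !big_cons sD IH -sZ bmkZl mulr1.
      exact: big_s.
    under eq_bigr => k _ do rewrite sE scaler_sumr.
    rewrite exchange_big; apply: eq_bigr => l _ /=; rewrite mxE bmk_sum.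
    by apply: eq_bigr => k _; rewrite bmkZl.
  have <- : \sum_k bmk a ((1%:M : 'M[R]_r) i k) (sol k) = bmk a 1 (sol i).
    rewrite (bigD1 i) //= mxE eqxx big1 ?addr0 // => k /negbTE ki.
    rewrite mxE eq_sym ki; apply: (@addrI _ (bmk a 0 (sol k))).
    by rewrite -bmkDl !addr0.
  by move/(RV_coord_uniq gT sB)/(_ j).
have CD : C *m D = 1%:M by exact: (mulE t' D C (t M') t'_lin DE CE tK).
have DC : D *m C = 1%:M by exact: (mulE (t M') C D t' (@taut_lin _ _ _ _ t M') CE DE t'K).
pose g0 := GLMk CD DC.
(* A point acts on the solutions through its inverse ([Act_sol]), so the preimage of [t] is the
   inverse in Gamma of the point with matrix [C]. *)
have [_ _ /(_ (GammaMk (matrix_in_q CE (erefl : g0 = C :> 'M_r))))[g gE]] :=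
  Gamma_subgroupP gT Psi_Phi a.
have gC : glinv g = C by apply: (glinv_uniq (g' := glV g0)); rewrite gE.
exists g; apply: taut_ext => N x; case: N x => N p x.
apply: (agree gT Psi_Phi m_basis Phi_m) => {N p} x.
have [c ->] := RV_repr gT sB x.
rewrite !taut_sum; apply: eq_bigr => i _.
have -> : bmk a (c i) (sol i) = c i *: (bmk a 1 (sol i) : RV a M).
  by rewrite bmkZl mulr1.
rewrite !tautZ; congr (_ *: _); rewrite CE.
have := Act_sol Psi_Phi Phi_m g i; rewrite gC => h.
exact: (@pi_funE _ gT _ _ _ Psi_Phi _ _ m_basis Phi_m _ _ g M' _ _ h).
Qed.
End Surjectivity.

(** Everything about the place and the separable closure is concentrated in the hypothesis
    [simple_tower], verified at the end. *)
Theorem simple_tower_galois (T : frobTower) (gT : simple_tower T)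
    (M : phiMod T) (r : nat) (m : 'I_r -> M) (m_basis : is_basis m)
    (Phi : GL (tE T) r) (Phi_m : forall i, pphi M (m i) = \sum_l Phi i l *: m l)
    (Psi : GL (tL T) r)
    (Psi_Phi : map_mx (tsL T) Psi = map_mx (tEL T) Phi *m Psi) :
  Gamma_subgroup Psi /\
  exists piM : point_map Psi M,
    [/\ is_piM piM, forall pi : point_map Psi M, is_piM pi -> pi = piM
      & is_group_iso piM].
Proof.
split; first exact: (Gamma_subgroupP gT Psi_Phi).
pose piM : point_map Psi M := fun R a g => pi_aut gT Psi_Phi m_basis Phi_m g.
have gd (N : tanObj M) : good Psi N := good_gen gT m_basis Phi_m Psi_Phi (tobjP N).
have homP : is_hom piM.
  split=> [R a g h gh e N x|R R' a a' u ua g g' g'E N x].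
    exact: pi_fun_mul e.
  apply/esym/pi_funE; apply: (Act_bc ua g'E); exact: pi_funP.
exists piM; split.
- split; first exact: homP.
  move=> R a g N x s xs.
  exact: (Act_all gT Psi_Phi (gd N) (pi_funP gT Psi_Phi m_basis Phi_m g x) xs).
(* The condition [is_piM] prescribes the image of [x] in terms of any representative over Sigma, and
   every [x] has one. *)
- move=> pi [_ piP].
  apply: functional_extensionality_dep => R.
  apply: functional_extensionality_dep => a.
  apply/funext => g; apply: taut_ext => N x.
  apply/esym/pi_funE; have [s xs] := sigma_exists (gd N) x.
  by exists s; split; [exact: xs | exact: (piP R a g N x s xs)].
- split; first exact: homP.
  move=> R a.
  have /choice[q qK] t := pi_aut_surj gT Psi_Phi m_basis Phi_m t (a := a).
  exists q => [g|t]; last exact: qK.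
  by apply: (pi_aut_inj (gT := gT) (Psi_Phi := Psi_Phi) (m_basis := m_basis) (Phi_m := Phi_m)); exact: qK.
Qed.


(** * The tower attached to a place *)

Section Irreducibility.

(** A root of [p] in a finite extension with N elements is also a root of X^N - X. By irreducibility
    [p] divides this polynomial, which has distinct roots in the extension. *)
Lemma irreducible_separable (Fq : finFieldType) (p : {poly Fq}) :
  irreducible_poly p -> separable_poly p.
Proof.
move=> irr; have [L _ [z pz _]] := irredp_FAdjoin irr.
pose L' : finFieldType := FinFieldExtType L.
pose f : {rmorphism Fq -> L'} := GRing.in_alg L.
suff pd : p %| 'X^#|L'| - 'X.
  rewrite -(separable_map f); have : map_poly f p %| map_poly f ('X^#|L'| - 'X).
    by rewrite dvdp_map.
  rewrite rmorphB /= map_polyXn map_polyX finField_genPoly => /dvdp_separable.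
  apply; rewrite separable_prod_XsubC; exact: index_enum_uniq.
have : ~~ coprimep p ('X^#|L'| - 'X).
  rewrite -(coprimep_map f); apply/negP => /coprimep_root => /(_ _ pz).
  by rewrite rmorphB /= map_polyXn map_polyX hornerD hornerN hornerXn hornerX expf_card subrr eqxx.
have [_ irr2] := irr; rewrite /coprimep => nc.
have := irr2 _ nc (dvdp_gcdl _ _); rewrite /eqp => /andP[_ h].
exact: dvdp_trans h (dvdp_gcdr _ _).
Qed.

Lemma separably_closed_split (k : fieldType) :
  (forall p : {poly k}, (1 < size p)%N -> separable_poly p -> exists x, root p x) ->
  forall p : {poly k}, p \is monic -> separable_poly p ->
  exists s : seq k, p = \prod_(x <- s) ('X - x%:P).
Proof.
move=> kc p; have [n] := ubnP (size p); elim: n p => // n IH p.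
rewrite ltnS => szp pm ps.
have [sp1|sp1] := leqP (size p) 1.
  exists [::]; rewrite big_nil; apply/eqP; rewrite -(eqp_monic pm (monic1 _)) -size_poly_eq1.
  by rewrite eqn_leq sp1 size_poly_gt0 monic_neq0.
have [x /factor_theorem[q pE]] := kc p sp1 ps.
have qm : q \is monic by rewrite -(monicMl _ (monicXsubC x)) mulrC -pE.
have [||s sE] := IH q _ qm.
- apply: leq_trans szp; rewrite pE size_mul ?monic_neq0 ?monicXsubC //.
  by rewrite size_XsubC addn2.
- by apply: dvdp_separable ps; rewrite pE dvdp_mulr.
by exists (x :: s); rewrite big_cons -sE mulrC.
Qed.

Lemma algebraic_prod_XsubC (k k' : fieldType) (f : {rmorphism k -> k'}) (s : seq k') :
  (forall x, x \in s -> algebraicOver f x) ->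
  forall i, algebraicOver f (\prod_(x <- s) ('X - x%:P))`_i.
Proof.
elim: s => [|x s IH] sa i.
  rewrite big_nil coef1 -(rmorph_nat f); exact: algebraic_id.
have {}IH i' : algebraicOver f (\prod_(x <- s) ('X - x%:P))`_i'.
  by apply: IH => y ys; apply: sa; rewrite inE ys orbT.
rewrite big_cons mulrBl coefB coefXM coefCM.
apply: algebraic_sub; last by apply: algebraic_mul => //; apply: sa; exact: mem_head.
by case: (i == 0%N) => //; exact: algebraic0.
Qed.

Context (Fq : finFieldType) (v : place Fq).
Context (K : fieldType) (iota : {rmorphism Fq -> K})
  (K_Fq : forall x : K, algebraicOver iota x -> exists c : Fq, iota c = x)
  (Ks : fieldType) (j : {rmorphism K -> Ks}) (j_sep : separable_closure j).

Lemma place_split : exists s : seq Ks,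
  map_poly (j \o iota) v = \prod_(x <- s) ('X - x%:P).
Proof.
apply: (separably_closed_split j_sep.2).
  by rewrite map_monic; exact: place_monic.
by rewrite separable_map; apply: irreducible_separable; exact: place_irr.
Qed.

(* The coefficients of a monic factor over [K] are algebraic over [Fq]. *)
Lemma place_irreducible : irreducible_poly (map_poly iota v).
Proof.
have [v1 virr] := place_irr v; split=> [|p p1 pv]; first by rewrite size_map_poly.
have v0 : map_poly iota v != 0 by rewrite -size_poly_gt0 size_map_poly ltnW.
have p0 : p != 0 by apply: contraNneq v0 => pz; move: pv; rewrite pz dvd0p.
have lp0 : lead_coef p != 0 by rewrite lead_coef_eq0.
pose p' := (lead_coef p)^-1 *: p.
have p'p : p' %= p by apply: eqp_scale; rewrite invr_eq0.
have p'm : p' \is monic by rewrite monicE lead_coefZ mulVf.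
have [s sE] := place_split.
have : map_poly j p' %| \prod_(x <- s) ('X - x%:P).
  by rewrite -sE map_poly_comp dvdp_map (eqp_dvdl _ p'p).
move=> /dvdp_prod_XsubC[b]; rewrite eqp_monic ?map_monic ?monic_prod_XsubC // => /eqP p'E.
have alg i : algebraicOver (j \o iota) (j p'`_i).
  have := algebraic_prod_XsubC (f := j \o iota) (s := mask b s) _ i.
  rewrite -p'E coef_map; apply=> x /mem_mask xs.
  exists (v : {poly Fq}); first by rewrite -size_poly_gt0 ltnW.
  by rewrite sE root_prod_XsubC.
have /choice[c cE] i : exists c, iota c = p'`_i.
  apply: K_Fq; have [q q0 qr] := alg i; exists q => //.
  by move: qr; rewrite map_poly_comp fmorph_root.
have p'c : p' = map_poly iota (\poly_(i < size p') c i).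
  apply/polyP => i; rewrite coef_map coef_poly; case: ltnP => sp; first exact/esym/cE.
  by rewrite nth_default //; exact/esym/(rmorph0 iota).
rewrite -(eqp_ltrans p'p) p'c eqp_map; apply: virr.
  by rewrite -(size_map_poly iota) -p'c (eqp_size p'p).
by rewrite -(dvdp_map iota) -p'c (eqp_dvdl _ p'p).
Qed.

End Irreducibility.

(** * Valuation and units in k(t)_v *)

Section LocalRing.
Context (Fq k : fieldType) (i : {rmorphism Fq -> k}) (v : place Fq).
Local Notation w := (map_poly i v).
Local Notation kv := (adic w).
Local Notation "x %:F" := (FracField.tofrac x).
Local Notation FF := {fraction {poly Fq}}.
Local Notation act := (kv_of_poly i v).
Local Notation tk := (tmk (FracField.tofrac (R := {poly Fq})) (kv_of_poly i v)).

Lemma frac_repr (a : FF) : exists n d : {poly Fq}, d != 0 /\ a = n%:F / d%:F.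
Proof.
elim/quotW: a => r; exists (\n_r), (\d_r); split; first exact: denom_ratioP.
have d0 : (\d_r)%:F != 0 :> FF by rewrite tofrac_eq0 denom_ratioP.
apply: (mulIf d0); rewrite divfK // mulrC.
unlock FracField.tofrac; rewrite [LHS](esym (FracField.pi_mul _ _)).
apply/eqmodP; rewrite /= FracField.equivfE /FracField.mulf.
by rewrite !numden_Ratio ?oner_eq0 ?mulr1 ?mul1r ?denom_ratioP.
Qed.

(** Tensoring with Fq(t) is a localisation, so finitely many terms have a common denominator. *)
Lemma ktv_pure (x : ktv i v) : exists a y, x = tk a y.
Proof.
elim/ktv_ind: x => [|a y|x x' [a [y ->]] [a' [y' ->]]].
- by exists 0, 0; rewrite tmk0l.
- by exists a, y.
have [n [d [d0 ->]]] := frac_repr a; have [n' [d' [d'0 ->]]] := frac_repr a'.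
have dF : d%:F != 0 :> FF by rewrite tofrac_eq0.
have d'F : d'%:F != 0 :> FF by rewrite tofrac_eq0.
exists ((d%:F * d'%:F)^-1), (act (n * d') * y + act (n' * d) * y').
rewrite tmkDr; transitivity (tk ((n * d')%:F * (d%:F * d'%:F)^-1) y +
  tk ((n' * d)%:F * (d%:F * d'%:F)^-1) y'); last by rewrite !tmkZ.
congr (tk _ _ + tk _ _).
  by rewrite tofracM invfM mulrACA divff // mulr1.
by rewrite tofracM invfM (mulrC (d%:F)^-1) mulrACA (divff dF) mulr1.
Qed.

Lemma vk_neq0 : w != 0.
Proof. by rewrite -size_poly_gt0 (ltn_trans _ (size_vk i v)). Qed.

Lemma adic_seq_mod (y : kv) n : adic_seq y n.+1 %% w = adic_seq y 1.
Proof.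
elim: n => [|n IH]; first exact: (adic_mod y 1).
rewrite -IH [adic_seq y n.+1]adicP.
have e p : (p %% w ^+ n.+1) %% w = p %% w.
  rewrite [in RHS](divp_eq p (w ^+ n.+1)) modpD [X in _ = X + _]modp_eq0 ?add0r //.
  by rewrite exprSr mulrA dvdp_mulIr.
by rewrite e.
Qed.

(** Coprimality modulo [w] passes to all powers of [w], and a Bezout relation gives an inverse at
    each level. *)
Lemma adic_unit (y : kv) : coprimep (adic_seq y 1) w -> exists z, y * z = 1.
Proof.
move=> cop.
have cn n : coprimep (adic_seq y n) (w ^+ n).
  case: n => [|n]; first by rewrite expr0 coprimep1.
  apply: coprimep_expr; rewrite coprimep_sym -coprimep_modr.
  by rewrite adic_seq_mod coprimep_sym.
have /choice[z zE] n : exists z : {poly k}, (adic_seq y n * z) %% w ^+ n = 1 %% w ^+ n.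
  have /Bezout_coprimepP[[a b] /= e] := cn n.
  have /eqpP[[c c'] /= /andP[c0 c'0] cE] := e.
  have e1 : (c'^-1 * c) *: (a * adic_seq y n + b * w ^+ n) = 1.
    by rewrite -scalerA cE scalerA mulVf // scale1r.
  exists ((c'^-1 * c) *: a); have -> : adic_seq y n * ((c'^-1 * c) *: a) =
      1 - ((c'^-1 * c) *: b) * w ^+ n.
    apply/eqP; rewrite eq_sym subr_eq; apply/eqP; rewrite -[LHS]e1 scalerDr.
    by congr (_ + _); [rewrite (mulrC a) scalerAr | rewrite scalerAl].
  by rewrite modpD modpN modp_mull subr0.
(* The inverses were chosen independently; they are compatible since inverses modulo [w ^+ n] are
   unique. *)
have zc n : z n %% w ^+ n = (z n.+1 %% w ^+ n.+1) %% w ^+ n.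
  rewrite modp_expS; apply/eqP; rewrite -subr_eq0 -modpN -modpD; apply/eqP/modp_eq0P.
  have cw : coprimep (w ^+ n) (adic_seq y n) by rewrite coprimep_sym.
  have e2 : (adic_seq y n * z n.+1) %% w ^+ n = 1 %% w ^+ n.
    rewrite [adic_seq y n]adicP mulrC modp_mul mulrC -(modp_expS w _ n) zE.
    exact: modp_expS.
  rewrite -(Gauss_dvdpr _ cw) mulrBr; apply/modp_eq0P.
  by rewrite modpD modpN zE e2 subrr.
exists (Adic zc); apply: adic_eq => n /=.
by rewrite modp_mul zE.
Qed.

Lemma modp_mulSl (p : {poly k}) n : (w * p) %% w ^+ n.+1 = w * (p %% w ^+ n).
Proof.
rewrite {1}(divp_eq p (w ^+ n)) mulrDr mulrCA -exprS modp_addl_mul_small //.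
rewrite exprS; have [->|r0] := eqVneq (p %% w ^+ n) 0.
  by rewrite mulr0 size_poly0 size_poly_gt0 mulf_neq0 ?expf_neq0 // vk_neq0.
rewrite !size_mul ?expf_neq0 ?vk_neq0 //.
have : (size (p %% w ^+ n)%R < size (w ^+ n)%R)%N by rewrite ltn_modp expf_neq0 // vk_neq0.
have := size_vk i v; case: (size w) => // l _ h.
by rewrite !addSn /= ltn_add2l.
Qed.

(** Division by [w] costs one power, so the [n]-th term of the quotient is read off from the term of
    [y] of index [n.+1]. *)
Lemma adic_div (y : kv) : adic_seq y 1 = 0 -> exists z, y = to_adic w w * z.
Proof.
move=> y1; have dy n : adic_seq y n.+1 = w * (adic_seq y n.+1 %/ w).
  by rewrite {1}(divp_eq (adic_seq y n.+1) w) adic_seq_mod y1 addr0 mulrC.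
have zc n : adic_seq y n.+1 %/ w = (adic_seq y n.+2 %/ w) %% w ^+ n.
  by apply: (mulfI vk_neq0); rewrite -dy -modp_mulSl -dy -adicP.
exists (Adic zc); apply: adic_eq => n /=.
by rewrite mulrC modp_mul mulrC -dy -adicP.
Qed.

(** A level at which [y] is nonzero bounds the number of divisions by [w]. The cofactor [u] is
    merely not divisible by [w]; when [w] is reducible, as over K^sep for d > 1, it may fail to be a
    unit. *)
Lemma adic_val (y : kv) : y <> 0 -> exists n u,
  y = to_adic w w ^+ n * u /\ adic_seq u 1 != 0.
Proof.
move=> y0; have [N] : exists N, adic_seq y N != 0.
  apply: contrapT => h; apply: y0; apply: adic_eq => n; rewrite /= mod0p.
  by apply/eqP/negPn/negP => yn; apply: h; exists n.
elim: N y {y0} => [|N IH] y; first by rewrite adicP expr0 modp1 eqxx.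
have [y1|y1] := eqVneq (adic_seq y 1) 0; last by exists 0, y; rewrite expr0 mul1r.
have [z yE] := adic_div y1; rewrite yE /= mulrC modp_mul mulrC modp_mulSl => h.
have [|n [u [zE u1]]] := IH z.
  by apply: contraNneq h => h; rewrite -adicP h mulr0.
by exists n.+1, u; rewrite exprS -mulrA -zE.
Qed.

Lemma ktv_inv_v n (y : kv) : tk (((v : {poly Fq}) ^+ n)%:F^-1) (to_adic w w ^+ n * y) = tk 1 y.
Proof.
have e : to_adic w w ^+ n = act ((v : {poly Fq}) ^+ n) by rewrite rmorphXn.
rewrite e -tmkZ divff // tofrac_eq0 expf_neq0 //.
exact: irredp_neq0 (place_irr v).
Qed.

Lemma small_coprime (p : {poly k}) : irreducible_poly w -> p != 0 ->
  (size p < size w)%N -> coprimep p w.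
Proof.
move=> [_ irr] p0 szp; rewrite coprimep_sym /coprimep.
apply: contraLR szp => nc; rewrite -leqNgt.
have := irr _ nc (dvdp_gcdl _ _); rewrite /eqp => /andP[_ h].
exact: dvdp_leq p0 (dvdp_trans h (dvdp_gcdr _ _)).
Qed.

Lemma adic_seq1_size (y : kv) : (size (adic_seq y 1) < size w)%N.
Proof. by rewrite -adic_mod expr1 ltn_modp vk_neq0. Qed.

(** Up to a nonzero element of Fq(t) and a power of [v], both invertible, a nonzero element is some
    [u] with nonzero residue mod [w]. Irreducibility makes the residue, hence [u], a unit. *)
Lemma ktv_field : irreducible_poly w -> fieldlike (ktv i v).
Proof.
move=> irr x; have [a [y ->]] := ktv_pure x => x0.
have a0 : a != 0 by apply: contraNneq x0 => ->; rewrite tmk0l.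
have y0 : y <> 0 by move=> y0; move: x0; rewrite y0 tmk0r eqxx.
have [n [u [yE u1]]] := adic_val y0.
have [z uz] := adic_unit (small_coprime irr u1 (adic_seq1_size u)).
exists (tk (a^-1 * ((v : {poly Fq}) ^+ n)%:F^-1) z).
rewrite tmkM mulrC mulrA divff // mul1r yE [z * _]mulrC -mulrA uz.
by rewrite ktv_inv_v.
Qed.

End LocalRing.

(** * Sigma-stable ideals and fixed elements of k(t)_v *)

Section SigmaSimple.
Context (Fq : finFieldType) (k : fieldType) (i : {rmorphism Fq -> k}) (v : place Fq).
Local Notation w := (map_poly i v).
Local Notation kv := (adic w).
Local Notation L := (ktv i v).
Local Notation sg := (sigma i v).
Local Notation fr := (map_poly (qfrob i)).
Local Notation tk := (tmk (FracField.tofrac (R := {poly Fq})) (kv_of_poly i v)).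

Lemma frob_fixed (c : k) : qfrob i c = c -> exists a, i a = c.
Proof.
move=> e; have : root (map_poly i ('X^#|Fq| - 'X)) c.
  by rewrite rmorphB /= map_polyXn map_polyX rootE hornerD hornerN hornerXn hornerX [_ ^+ _]e subrr.
rewrite finField_genPoly rmorph_prod rootE horner_prod => /prodf_eq0[a _].
rewrite /= map_polyXsubC hornerXsubC subr_eq0 => /eqP ->.
by exists a.
Qed.

Lemma frob_fixed_poly (p : {poly k}) : fr p = p -> exists q, map_poly i q = p.
Proof.
move=> e; have /choice[c cE] l : exists a, i a = p`_l.
  by apply: frob_fixed; rewrite -[RHS]/(p`_l) -[in RHS]e coef_map.
exists (\poly_(l < size p) c l); apply/polyP => l.
rewrite coef_map coef_poly; case: ltnP => sp; first exact: cE.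
by rewrite [RHS]nth_default //; exact: (rmorph0 i).
Qed.

Lemma frob_w : fr w = w.
Proof. exact: (place_map v (qfrob_base i)). Qed.

Definition asg : kv -> kv := adic_map (place_map v (qfrob_base i)).

Lemma sg_mk a y : sg (tk a y) = tk a (asg y).
Proof. exact: ktv_mapE. Qed.

(* The ideal of polynomials congruent mod [v] to an element of the [sigma]-stable
   ideal generated by [x] has a [sigma]-stable monic generator, which therefore
   lies in [Fq[t]] and divides the irreducible [v]. *)
Lemma sigma_simple (x : L) (y : kv) : x = tk 1 y -> y <> 0 ->
  exists m (c : 'I_m -> L), \sum_l c l * iter l sg x = 1.
Proof.
move=> xy y0.
pose J (s : L) := exists m (c : nat -> L), s = \sum_(l < m) c l * iter l sg x.
have JZ c s : J s -> J (c * s).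
  move=> [m [d ->]]; exists m, (fun l => c * d l); rewrite mulr_sumr.
  by apply: eq_bigr => l _; rewrite mulrA.
have J_widen m m' (c : nat -> L) : (m <= m')%N ->
    \sum_(l < m) c l * iter l sg x =
    \sum_(l < m') (if (l < m)%N then c l else 0) * iter l sg x.
  move=> mm'; rewrite (big_ord_widen m' (fun l => c l * iter l sg x)) // big_mkcond.
  by apply: eq_bigr => l _; case: ifP => // _; rewrite mul0r.
have JD s s' : J s -> J s' -> J (s + s').
  move=> [m [c ->]] [m' [c' ->]]; exists (maxn m m').
  exists (fun l => (if (l < m)%N then c l else 0) + (if (l < m')%N then c' l else 0)).
  rewrite (J_widen m (maxn m m')) ?leq_maxl // (J_widen m' (maxn m m')) ?leq_maxr //.
  by rewrite -big_split; apply: eq_bigr => l _; rewrite mulrDl.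
have J0 : J 0 by exists 0, (fun=> 0); rewrite big_ord0.
have Jx : J x by exists 1%N, (fun=> 1); rewrite big_ord1 mul1r.
have Jsg s : J s -> J (sg s).
  move=> [m [c ->]]; exists m.+1, (fun l => if l is l'.+1 then sg (c l') else 0).
  rewrite big_ord_recl mul0r add0r rmorph_sum; apply: eq_bigr => l _.
  by rewrite rmorphM.
pose JA z := J (tk 1 z).
have JAD z z' : JA z -> JA z' -> JA (z + z').
  by move=> h h'; rewrite /JA tmkDr; exact: JD.
have JAM z z' : JA z' -> JA (z * z').
  by move=> h; have := JZ (tk 1 z) _ h; rewrite tmkM mulr1.
have JAs z : JA z -> JA (asg z).
  by move=> h; rewrite /JA -sg_mk; exact: Jsg.
(* As [v] is invertible in [L], the ideal also contains [u], whose residue mod [w] is nonzero. *)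
have [N [u [yE u1]]] := adic_val y0.
have JAu : JA u.
  rewrite /JA -(ktv_inv_v N u) -yE.
  have := JZ (tk ((FracField.tofrac ((v : {poly Fq}) ^+ N))^-1) 1) _ Jx.
  by rewrite xy tmkM mulr1 mul1r.
pose P p := exists2 z, JA z & adic_seq z 1 = p %% w.
have seq1 (z : kv) : adic_seq z 1 %% w = adic_seq z 1 by exact: (adic_mod z 1).
have PD p q : P p -> P q -> P (p + q).
  move=> [z h e] [z' h' e']; exists (z + z'); first exact: JAD.
  by rewrite /= e e' modpD.
have PM p q : P q -> P (p * q).
  move=> [z h e]; exists (to_adic w p * z); first exact: JAM.
  by rewrite /= expr1 e modp_mul mulrC modp_mul mulrC.
have Ps p : P p -> P (fr p).
  move=> [z h e]; exists (asg z); first exact: JAs.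
  by rewrite /= e map_modp frob_w.
have Pu : P (adic_seq u 1) by exists u; rewrite ?seq1.
have Pw : P w by exists 0; rewrite ?modpp /= ?mod0p // /JA tmk0r.
have [g [g_monic Pg gmin]] : exists g, [/\ g \is monic, P g &
    forall p, P p -> (size p < size g)%N -> p = 0].
  have exn : exists n, `[< exists p, [/\ p != 0, P p & size p = n] >].
    by exists (size (adic_seq u 1)); apply/asboolP; exists (adic_seq u 1).
  case: (ex_minnP exn) => n /asboolP[p [p0 Pp szp]] nmin.
  have lp : (lead_coef p)^-1 != 0 by rewrite invr_eq0 lead_coef_eq0.
  exists ((lead_coef p)^-1 *: p); split.
  - by rewrite monicE lead_coefZ mulVf // lead_coef_eq0.
  - by rewrite -mul_polyC; exact: PM.
  - move=> q Pq; rewrite size_scale // szp => szq; apply/eqP/negPn/negP => q0.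
    have : (n <= size q)%N by apply: nmin; apply/asboolP; exists q.
    by rewrite leqNgt szq.
have g0 : g != 0 by exact: monic_neq0.
have Pdvd p : P p -> g %| p.
  move=> Pp; apply/modp_eq0P; apply: gmin; last by rewrite ltn_modp.
  have -> : p %% g = p + (- (p %/ g)) * g.
    by rewrite {2}(divp_eq p g) mulNr addrAC subrr add0r.
  by apply: PD => //; exact: PM.
(* Frobenius preserves the degree and the leading coefficient 1, so the difference lies in the ideal
   and has smaller size than [g]; minimality makes it zero. *)
have frg : fr g = g.
  have sz : size (fr g) = size g by rewrite size_map_poly.
  have Pd : P (fr g - g).
    by rewrite -mulN1r; apply: PD; [exact: Ps | exact: PM].
  apply/eqP; rewrite -subr_eq0; apply/eqP; apply: gmin => //.
  have mg : fr g \is monic by rewrite map_monic.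
  have s0 : (0 < size g)%N by rewrite size_poly_gt0.
  have [->|d0] := eqVneq (fr g - g) 0; first by rewrite size_poly0.
  have le : (size (fr g - g)%R <= size g)%N.
    by rewrite (leq_trans (size_polyD _ _)) // size_polyN sz maxnn.
  rewrite ltn_neqAle le andbT; apply: contraNneq d0 => e.
  rewrite -lead_coef_eq0 lead_coefE e coefB.
  have <- : lead_coef (fr g) = (fr g)`_(size g).-1 by rewrite lead_coefE sz.
  by rewrite -lead_coefE (monicP mg) (monicP g_monic) subrr.
have [h hE] := frob_fixed_poly frg.
have hv : h %| v by rewrite -(dvdp_map i) hE Pdvd.
(* Otherwise irreducibility of [v] over Fq makes [g] associate to [w], and [w] would divide the
   nonzero residue of [u]. *)
have g1 : size g == 1%N.
  apply: contraT => g1; have [_ irr] := place_irr v.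
  have hp : h %= v by apply: irr hv; rewrite -(size_map_poly i) hE.
  have wu : w %| adic_seq u 1.
    by rewrite -(eqp_dvdl _ (_ : g %= w)) ?Pdvd // -hE eqp_map.
  by move: u1; rewrite -seq1 (modp_eq0 wu) eqxx.
have [z JAz z1] : P 1.
  by have := Pg; rewrite (eqP (_ : g == 1)) // -(eqp_monic g_monic (monic1 _)) -size_poly_eq1.
have [|z' zz'] := @adic_unit Fq k i v z.
  by rewrite z1 coprimep_modl coprime1p.
have : J 1 by have := JAM z' z JAz; rewrite mulrC zz'.
by move=> [m [c e]]; exists m, (fun l => c l).
Qed.

(** Sigma fixes the factor in Fq(t), which is invertible when nonzero, so only elements of k[t]_v
    remain. *)
Lemma ktv_simple (x : L) : x != 0 ->
  exists m (c : 'I_m -> L), \sum_l c l * iter l sg x = 1.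
Proof.
have [a [y ->]] := ktv_pure x => x0.
have a0 : a != 0 by apply: contraNneq x0 => ->; rewrite tmk0l.
have y0 : y <> 0 by move=> y0; move: x0; rewrite y0 tmk0r eqxx.
have [m [c cE]] := sigma_simple (erefl (tk 1 y)) y0.
have it l : iter l sg (tk 1 y) = tk a^-1 1 * iter l sg (tk a y).
  elim: l => [|l IH]; first by rewrite tmkM mulVf // mul1r.
  rewrite !iterS IH [LHS]rmorphM; congr (_ * _).
  apply: etrans (sg_mk _ _) _; congr (tk _ _).
  exact: (rmorph1 asg).
exists m, (fun l => c l * tk a^-1 1); rewrite -[RHS]cE; apply: eq_bigr => l _.
by rewrite it mulrA.
Qed.

(** If [y] were nonzero, the iterates of 1 (x) y = 0 would generate 1, against [L] being a nonzero
    ring. *)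
Lemma ktv_mk_inj (y : kv) : tk 1 y = 0 -> y = 0.
Proof.
move=> e; apply: contrapT => y0; have [m [c cE]] := sigma_simple (erefl (tk 1 y)) y0.
have : (1 : L) = 0.
  rewrite -cE big1 // => l _; rewrite e.
  suff -> : iter l sg 0 = 0 by rewrite mulr0.
  by elim: (l : nat) => //= n ->; exact: rmorph0.
by move/eqP; rewrite oner_eq0.
Qed.

(** The integral factor is itself fixed, so all its coefficients are in Fq. The conclusion is
    phrased by sequences of remainders, so that it applies to the image of [u] under the composite
    through [E]. *)
Lemma ktv_fixed (x : L) : sg x = x ->
  exists a (u : adic (map_poly (idfun : Fq -> Fq) v)),
    forall y : kv, (forall n, adic_seq y n = map_poly i (adic_seq u n)) -> x = tk a y.
Proof.
have [a [y ->]] := ktv_pure x => e.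
(* For [a = 0] nothing can be said of [y], which need not be fixed. *)
have [a0|a0] := eqVneq a 0.
  by exists 0, 0 => z _; rewrite a0 !tmk0l.
have yfix : asg y = y.
  apply/eqP; rewrite -subr_eq0; apply/eqP; apply: ktv_mk_inj.
  have : tk a^-1 1 * (tk a (asg y) - tk a y) = 0 by rewrite -sg_mk e subrr mulr0.
  rewrite mulrBr !tmkM mulVf // !mul1r => <-.
  rewrite tmkDr; congr (_ + _); apply/eqP.
  by rewrite -addr_eq0 -tmkDr addNr tmk0r.
have /choice[u uE] n : exists q, map_poly i q = adic_seq y n.
  by apply: frob_fixed_poly; rewrite -[in RHS]yfix.
have uP n : u n = u n.+1 %% map_poly (idfun : Fq -> Fq) v ^+ n.
  apply: (map_inj_poly (fmorph_inj i) (rmorph0 i)).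
  by rewrite uE map_modp rmorphXn /= uE [LHS]adicP (map_poly_id (p := v)).
exists a, (Adic uP) => z zE; congr (tk a _).
by apply: adic_eq => n; rewrite zE /= uE.
Qed.
End SigmaSimple.

Lemma tower_simple (Fq : finFieldType) (v : place Fq)
  (K : fieldType) (iota : {rmorphism Fq -> K})
  (K_Fq : forall x : K, algebraicOver iota x -> exists c : Fq, iota c = x)
  (Ks : fieldType) (j : {rmorphism K -> Ks}) (j_sep : separable_closure j) :
  simple_tower (tower v iota j).
Proof.
split.
- apply: ktv_field; have -> : map_poly (idfun : Fq -> Fq) v = v by rewrite map_poly_id.
  exact: place_irr.
- by apply: ktv_field; exact: (@place_irreducible Fq v K iota K_Fq Ks j j_sep).
- move=> x /ktv_fixed[a [u uE]].
  exists (tmk _ _ a u); rewrite /= /twFE /twEL !ktv_mapE; apply/esym/uE => n /=.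
  by rewrite -map_poly_comp.
- exact: ktv_simple.
Qed.

Theorem theorem5p15
  (Fq : finFieldType) (v : place Fq)
  (K : fieldType) (iota : {rmorphism Fq -> K})
  (K_Fq : forall x : K, algebraicOver iota x -> exists c : Fq, iota c = x)
  (Ks : fieldType) (j : {rmorphism K -> Ks}) (j_sep : separable_closure j)
  (M : phiMod (tower v iota j)) (M_triv : L_trivial M)
  (r : nat) (m : 'I_r -> M) (m_basis : is_basis m)
  (Phi : GL (tE (tower v iota j)) r)
  (Phi_m : forall i, pphi M (m i) = \sum_l Phi i l *: m l)
  (Psi : GL (tL (tower v iota j)) r)
  (Psi_Phi : map_mx (tsL (tower v iota j)) Psi =
             map_mx (tEL (tower v iota j)) Phi *m Psi) :
  Gamma_subgroup Psi /\
  exists piM : point_map Psi M,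
    [/\ is_piM piM,
        forall pi : point_map Psi M, is_piM pi -> pi = piM
      & is_group_iso piM].
Proof.
exact: (simple_tower_galois (tower_simple v K_Fq j_sep) m_basis Phi_m Psi_Phi).
Qed.
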